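(* Let $k\ge 3$. There is a constant $c>0$ such that for all sufficiently large $n$ there exist at least $c\cdot 2^n$ pairwise non-isomorphic centrally symmetric combinatorial $(2k-1)$-spheres on the vertex set $V_n=\{\pm1,\dots,\pm n\}$ that are cs-$(k-1)$-neighborly with respect to $V_n$.
   Context: A combinatorial $(2k-1)$-sphere is a simplicial complex PL homeomorphic to the boundary of a $2k$-simplex. A simplicial complex $\Gamma$ on $V_n$ is centrally symmetric if $\sigma\in\Gamma$ implies $-\sigma=\{-v:v\in\sigma\}\in\Gamma$ and no face contains a pair $\{v,-v\}$. $\Gamma$ is cs-$i$-neighborly with respect to $V_n$ if every subset of $V_n$ of size at most $i$ containing no pair $\{v,-v\}$ is a face of $\Gamma$. *)

(* Defs.v *)
From mathcomp Require Import all_boot all_order all_algebra.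
From mathcomp Require Import reals.

Set Implicit Arguments.
Unset Strict Implicit.
Unset Printing Implicit Defensive.

Import Order.TTheory GRing.Theory Num.Theory.
Local Open Scope ring_scope.

(* Every element of T is required to be a vertex, so T is exactly the vertex
   set; the empty set counts as a face. *)
Definition simplicial_complex (T : finType) (G : {set {set T}}) : Prop :=
  [/\ set0 \in G,
      forall v : T, [set v] \in G
    & forall s t : {set T}, s \in G -> t \subset s -> t \in G].

Definition isomorphic (T T' : finType) (G : {set {set T}})
    (H : {set {set T'}}) : Prop :=
  exists2 f : T -> T', bijective f & forall s : {set T}, (f @: s \in H) = (s \in G).

Definition simplex_boundary (m : nat) : {set {set 'I_m.+1}} :=
  [set s : {set 'I_m.+1} | s \proper [set: 'I_m.+1]].

(* Barycentric coordinates: the vertex v is sent to the v-th standard basis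
   vector of R^T. *)
Definition realization (R : realType) (T : finType) (G : {set {set T}})
    (x : {ffun T -> R}) : bool :=
  [&& [forall v, 0 <= x v], \sum_v x v == 1 & [set v | x v != 0] \in G].

(* A list of pairs (a, b) stands for the set of solutions x of the system of
   inequalities <a, x> <= b. *)
Definition polyhedron (R : realType) (T : finType) : Type :=
  seq ({ffun T -> R} * R).

Definition in_polyhedron (R : realType) (T : finType) (P : polyhedron R T)
    (x : {ffun T -> R}) : bool :=
  all (fun h : {ffun T -> R} * R => \sum_v h.1 v * x v <= h.2) P.

Definition affine_on (R : realType) (T T' : finType) (P : polyhedron R T)
    (f : {ffun T -> R} -> {ffun T' -> R}) : Prop :=
  exists (A : T' -> T -> R) (b : T' -> R),
    forall x, in_polyhedron P x -> forall w, f x w = \sum_v A w v * x v + b w.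

(* |G| is a finite union of closed convex polyhedra on each of which f is
   affine.  The pieces are closed and finite in number, so continuity of f on
   |G| is automatic.  The values of f outside |G| are irrelevant. *)
Definition piecewise_linear (R : realType) (T T' : finType)
    (G : {set {set T}}) (f : {ffun T -> R} -> {ffun T' -> R}) : Prop :=
  exists Ps : seq (polyhedron R T),
    (forall x, realization G x = has (fun P => in_polyhedron P x) Ps) /\
    (forall P, P \in Ps -> affine_on P f).

Definition PL_homeomorphic (R : realType) (T T' : finType)
    (G : {set {set T}}) (H : {set {set T'}}) : Prop :=
  exists (f : {ffun T -> R} -> {ffun T' -> R})
         (g : {ffun T' -> R} -> {ffun T -> R}),
    [/\ forall x, realization G x -> realization H (f x) /\ g (f x) = x,
        forall y, realization H y -> realization G (g y) /\ f (g y) = y,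
        piecewise_linear G f
      & piecewise_linear H g].

Definition combinatorial_sphere (R : realType) (d : nat) (T : finType)
    (G : {set {set T}}) : Prop :=
  simplicial_complex G /\ PL_homeomorphic R G (simplex_boundary d.+1).

(* V_n = {+-1, ..., +-n}: (i, false) stands for i+1 and (i, true) for -(i+1). *)
Definition V (n : nat) : finType := ('I_n * bool)%type.

Definition opp_vertex (n : nat) (v : V n) : V n := (v.1, ~~ v.2).

Definition antipode_free (n : nat) (s : {set V n}) : Prop :=
  forall v : V n, ~ (v \in s /\ opp_vertex v \in s).

Definition centrally_symmetric (n : nat) (G : {set {set V n}}) : Prop :=
  forall s : {set V n}, s \in G ->
    [set opp_vertex v | v in s] \in G /\ antipode_free s.

Definition cs_neighborly (n i : nat) (G : {set {set V n}}) : Prop :=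
  forall s : {set V n}, (#|s| <= i)%N -> antipode_free s -> s \in G.

(* Main.v *)
(** Novik and Zheng build highly neighborly centrally symmetric spheres by
    replacing a ball [B] and its antipode in such a sphere on the indices below
    [n] by the cones over their boundaries with apexes [(n, false)] and
    [(n, true)].  The join [H] of such a [(2k-3)]-sphere on [N = n - 2] indices
    with a 4-cycle on the last two indices is cs-[(k-1)]-neighborly of dimension
    [2k-1].  If [e] is an edge of the 4-cycle, [A = e + {c+2, c+6, ..., c+4k-6}]
    and [B = {c, c+4, ..., c+4k-4}] (all of one sign), then [B] is a missing face
    and the star of [A] is the join of [A] and the boundary of [B], so that it
    can be flipped to the join of [B] and the boundary of [A].  For [c] congruent
    to 0 or 1 modulo 4 these flips are independent; performing antipodal pairs of
    them, at none or at one of the four edges for every [c], gives about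
    [5^(N/2)] labelled spheres.  They all contain a ball (the join of an edge and
    a Novik-Zheng ball) that has all the indices below [N] as vertices and whose
    facets are connected through ridges, hence an isomorphism between two of them
    is determined by the images of [2k+2] vertices.  So the isomorphism classes
    have size polynomial in [n], and [sqrt 5 > 2].

    The only PL homeomorphisms needed are bistellar flips.  That a ball [L] may be
    replaced by the cone over its boundary [dL] is a special case of the
    exchange of [A * dB * L] for [dA * B * L + A * B * dL], which is taken as the
    definition of a ball; in this form it passes through the recursion of Novik
    and Zheng without the theory of regular neighborhoods. *)
Require Import Defs.
From mathcomp Require Import all_boot all_order all_algebra.
From mathcomp Require Import reals.
From mathcomp Require Import boolp finmap.
From mathcomp Require Import zify ring lra.

Set Implicit Arguments.
Unset Strict Implicit.
Unset Printing Implicit Defensive.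

Import Order.TTheory GRing.Theory Num.Theory.
Local Open Scope ring_scope.

(** * Piecewise linear homeomorphisms of finite complexes *)

(** A flip must be carried out inside a larger complex, so the equivalences have to hold relative to
    a border. Rather than with homeomorphisms that fix a border, [PLrel] works by quantifying over
    every surrounding complex [K] that meets both sides only in the border. Such statements localize
    well, but they compose only if the intermediate complex does not run into [K] elsewhere;
    subdividing [K] away from the border removes this obstacle.

    The exchange that defines a ball carries two simplices [A], [B] and a factor [G]. This
    generality is what closes the induction: a new apex can be added to [A] or to [B], and every
    other condition on faces can be moved into [G], so each gluing step of the recursion is a chain
    of exchanges with altered parameters. Joins are written as conjunctions of conditions on
    disjoint sets of vertices, which makes each verification a propositional tautology about a
    single face. *)

Definition downward_closed (T : finType) (G : {set {set T}}) : Prop :=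
  forall s t : {set T}, s \in G -> t \subset s -> t \in G.

Section PiecewiseLinear.
Variable R : realType.

Definition pullback (T T' : finType) (A : T' -> T -> R) (b : T' -> R)
    (h : {ffun T' -> R} * R) : {ffun T -> R} * R :=
  ([ffun v => \sum_w h.1 w * A w v], h.2 - \sum_w h.1 w * b w).

Lemma pullbackP (T T' : finType) (A : T' -> T -> R) (b : T' -> R)
    (h : {ffun T' -> R} * R) (x : {ffun T -> R}) (y : {ffun T' -> R}) :
  (forall w, y w = \sum_v A w v * x v + b w) ->
  (\sum_v (pullback A b h).1 v * x v <= (pullback A b h).2) =
  (\sum_w h.1 w * y w <= h.2).
Proof.
move=> yE /=; rewrite lerBrDr; congr (_ <= _).
rewrite (eq_bigr (fun v => \sum_w h.1 w * (A w v * x v))); last first.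
  by move=> v _; rewrite ffunE mulr_suml; apply: eq_bigr => w _; rewrite mulrA.
rewrite exchange_big -big_split /=; apply: eq_bigr => w _.
by rewrite yE mulrDr mulr_sumr.
Qed.

Lemma in_polyhedron_pullback (T T' : finType) (A : T' -> T -> R) (b : T' -> R)
    (Q : polyhedron R T') (x : {ffun T -> R}) (y : {ffun T' -> R}) :
  (forall w, y w = \sum_v A w v * x v + b w) ->
  in_polyhedron (map (pullback A b) Q) x = in_polyhedron Q y.
Proof.
move=> yE; rewrite /in_polyhedron all_map; apply: eq_all => h /=.
exact: pullbackP.
Qed.

Lemma affine_comp (T1 T2 T3 : finType) (P : polyhedron R T1)
    (Q : polyhedron R T2) (f : {ffun T1 -> R} -> {ffun T2 -> R})
    (g : {ffun T2 -> R} -> {ffun T3 -> R}) :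
  (forall x, in_polyhedron P x -> in_polyhedron Q (f x)) ->
  affine_on P f -> affine_on Q g -> affine_on P (g \o f).
Proof.
move=> PQ [A [a fE]] [B [b gE]].
exists (fun w v => \sum_u B w u * A u v), (fun w => \sum_u B w u * a u + b w).
move=> x xP w; rewrite /= gE ?PQ // addrA; congr (_ + _).
rewrite (eq_bigr (fun u => \sum_v B w u * (A u v * x v) + B w u * a u)).
  rewrite big_split /= exchange_big; congr (_ + _); apply: eq_bigr => v _.
  by rewrite mulr_suml; apply: eq_bigr => u _; rewrite mulrA.
by move=> u _; rewrite fE // mulrDr mulr_sumr.
Qed.

Lemma piecewise_linear_comp (T1 T2 T3 : finType) (G : {set {set T1}})
    (H : {set {set T2}}) (f : {ffun T1 -> R} -> {ffun T2 -> R})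
    (g : {ffun T2 -> R} -> {ffun T3 -> R}) :
  (forall x, realization G x -> realization H (f x)) ->
  piecewise_linear G f -> piecewise_linear H g -> piecewise_linear G (g \o f).
Proof.
move=> fGH [Ps [GE Paff]] [Qs [HE Qaff]].
(* The pieces are the intersections of a piece [P] of [f] with the preimage of a piece [Q] of [g].
   The preimage is a polyhedron only through the affine form of [f] on [P], so the list is built
   piece by piece. *)
suff [Rs [RsE Raff]] : exists Rs : seq (polyhedron R T1),
    (forall x, has (fun P => in_polyhedron P x) Rs =
       has (fun P => in_polyhedron P x) Ps &&
       has (fun Q => in_polyhedron Q (f x)) Qs) /\
    (forall P, P \in Rs -> affine_on P (g \o f)).
  exists Rs; split=> // x; rewrite RsE -GE -HE.
  by case: (boolP (realization G x)) => // /fGH ->.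
elim: Ps Paff {GE} => [|P Ps IH] Paff; first by exists [::].
have [|Rs [RsE Raff]] := IH; first by move=> Q Qin; apply: Paff; rewrite inE Qin orbT.
have [A [a fE]] := Paff P (mem_head _ _).
have pb x Q : in_polyhedron P x ->
    in_polyhedron (map (pullback A a) Q) x = in_polyhedron Q (f x).
  by move=> xP; apply: in_polyhedron_pullback => w; apply: fE.
exists ([seq P ++ map (pullback A a) Q | Q <- Qs] ++ Rs); split.
  move=> x; rewrite has_cat RsE /= andb_orl; congr (_ || _).
  rewrite has_map; case: (boolP (in_polyhedron P x)) => xP /=.
    by apply: eq_has => Q /=; rewrite /in_polyhedron all_cat -!/(in_polyhedron _ _) xP pb.
  apply/negbTE/hasPn => Q _ /=.
  by rewrite /in_polyhedron all_cat -!/(in_polyhedron _ _) (negbTE xP).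
move=> P'; rewrite mem_cat => /orP[|]; last exact: Raff.
move=> /mapP[Q Qin ->].
apply: (@affine_comp _ _ _ _ Q) (Qaff Q Qin).
  move=> x; rewrite /in_polyhedron all_cat -!/(in_polyhedron _ _) => /andP[xP].
  by rewrite pb.
exists A, a => x; rewrite /in_polyhedron all_cat => /andP[xP _]; exact: fE.
Qed.

Lemma PL_homeomorphic_sym (T T' : finType) (G : {set {set T}})
    (H : {set {set T'}}) : PL_homeomorphic R G H -> PL_homeomorphic R H G.
Proof. by move=> [f [g [? ? ? ?]]]; exists g, f. Qed.

Lemma PL_homeomorphic_trans (T1 T2 T3 : finType) (G1 : {set {set T1}})
    (G2 : {set {set T2}}) (G3 : {set {set T3}}) :
  PL_homeomorphic R G1 G2 -> PL_homeomorphic R G2 G3 -> PL_homeomorphic R G1 G3.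
Proof.
move=> [f [g [fP gP fL gL]]] [f' [g' [fP' gP' fL' gL']]].
exists (f' \o f), (g \o g'); split.
- move=> x /fP[fx gfx]; have [? gfx'] := fP' _ fx.
  by split=> //=; rewrite gfx' gfx.
- move=> y /gP'[gy fgy]; have [? fgy'] := gP _ gy.
  by split=> //=; rewrite fgy' fgy.
- by apply: piecewise_linear_comp fL fL' => x /fP[].
- by apply: piecewise_linear_comp gL' gL => x /gP'[].
Qed.

Definition simplex_polyhedron (T : finType) (s : {set T}) : polyhedron R T :=
  [seq ([ffun w => - (w == v)%:R], 0) | v <- enum T] ++
  [seq ([ffun w => (w == v)%:R], 0) | v <- enum (~: s)] ++
  [:: ([ffun=> 1], 1); ([ffun=> -1], -1)].

Lemma sum_delta (T : finType) (x : T -> R) (v : T) :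
  \sum_w (w == v)%:R * x w = x v.
Proof.
rewrite (bigD1 v) //= eqxx mul1r big1 ?addr0 // => w /negbTE ->.
by rewrite mul0r.
Qed.

Lemma in_simplex_polyhedron (T : finType) (s : {set T}) (x : {ffun T -> R}) :
  in_polyhedron (simplex_polyhedron s) x =
  [&& [forall v, 0 <= x v], \sum_v x v == 1 & [set v | x v != 0] \subset s].
Proof.
rewrite /in_polyhedron !all_cat.
have -> : all (fun h : {ffun T -> R} * R => \sum_v h.1 v * x v <= h.2)
    [seq ([ffun w => - (w == v)%:R], 0) | v <- enum T] = [forall v, 0 <= x v].
  rewrite all_map; apply/allP/forallP => [H v|H v _].
    have := H v (mem_enum _ _) => /=.
    under eq_bigr do rewrite ffunE mulNr.
    by rewrite sumrN sum_delta oppr_le0.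
  rewrite /=; under eq_bigr do rewrite ffunE mulNr.
  by rewrite sumrN sum_delta oppr_le0.
have [/forallP x0|//] := boolP [forall v, 0 <= x v]; rewrite /= andbC.
congr (_ && _).
  under eq_bigr do rewrite ffunE mul1r.
  under [X in (X <= -1)]eq_bigr do rewrite ffunE mulN1r.
  by rewrite sumrN lerN2 andbT eq_le.
rewrite all_map; apply/allP/subsetP => [H v|H v].
  rewrite inE; apply: contraR => vs.
  have := H v; rewrite mem_enum inE vs => /(_ isT) /=.
  under eq_bigr do rewrite ffunE.
  by rewrite sum_delta eq_le x0 => ->.
rewrite mem_enum inE => vs /=.
under eq_bigr do rewrite ffunE.
rewrite sum_delta; have := H v; rewrite inE.
by case: eqP => [-> //|_ /(_ isT)]; rewrite (negbTE vs).
Qed.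

Lemma realization_simplices (T : finType) (G : {set {set T}})
    (x : {ffun T -> R}) : downward_closed G ->
  realization G x = has (fun s => in_polyhedron (simplex_polyhedron s) x) (enum G).
Proof.
move=> Gd; apply/idP/hasP => [/and3P[x0 x1 xG]|[s]].
  by exists [set v | x v != 0]; rewrite ?mem_enum // in_simplex_polyhedron x0 x1 /=.
rewrite mem_enum in_simplex_polyhedron => sG /and3P[x0 x1 xs].
by rewrite /realization x0 x1 (Gd _ _ sG xs).
Qed.

Lemma piecewise_linear_linear (T T' : finType) (G : {set {set T}})
    (A : T' -> T -> R) : downward_closed G ->
  piecewise_linear G (fun x => [ffun w => \sum_v A w v * x v]).
Proof.
move=> Gd; exists [seq simplex_polyhedron s | s <- enum G]; split.
  by move=> x; rewrite realization_simplices // has_map.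
move=> P _; exists A, (fun=> 0) => x _ w.
by rewrite ffunE addr0.
Qed.

(** [T'] may have elements outside the image of [phi]. Extending barycentric coordinates by zero and
    restricting them back are both linear, so no subdivision is involved. *)
Lemma PL_relabel (T T' : finType) (phi : T -> T') (G : {set {set T}})
    (G' : {set {set T'}}) : injective phi ->
  downward_closed G -> (forall s, (s \in G') = [exists t in G, s == phi @: t]) ->
  PL_homeomorphic R G G'.
Proof.
move=> phiI Gd G'E.
have G'd : downward_closed G'.
  move=> s t; rewrite !G'E => /existsP[u /andP[uG /eqP ->]] tu.
  apply/existsP; exists (phi @^-1: t); apply/andP; split.
    apply: Gd uG _; apply/subsetP => v; rewrite inE => /(subsetP tu).
    by rewrite mem_imset.
  apply/eqP/setP => w; apply/idP/imsetP => [wt|[v]]; last by rewrite inE => ? ->.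
  have /imsetP[v vu wE] := subsetP tu _ wt.
  by exists v; rewrite ?inE -?wE.
pose f (x : {ffun T -> R}) : {ffun T' -> R} :=
  [ffun w => \sum_v (phi v == w)%:R * x v].
pose g (y : {ffun T' -> R}) : {ffun T -> R} :=
  [ffun v => \sum_w (w == phi v)%:R * y w].
have fphi x v : f x (phi v) = x v.
  by rewrite ffunE -[RHS](sum_delta x); apply: eq_bigr => w _; rewrite (inj_eq phiI).
have f0 x w : w \notin codom phi -> f x w = 0.
  move=> wN; rewrite ffunE big1 // => v _.
  by case: eqP => [E|]; rewrite ?mul0r //; rewrite -E codom_f in wN.
have gE y v : g y v = y (phi v) by rewrite ffunE sum_delta.
have supp_f x : [set w | f x w != 0] = phi @: [set v | x v != 0].
  apply/setP => w; rewrite !inE; apply/idP/imsetP => [|[v + ->]]; last first.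
    by rewrite inE fphi.
  case: (boolP (w \in codom phi)) => [/codomP[v ->]|/f0 ->]; last by rewrite eqxx.
  by rewrite fphi => xv; exists v; rewrite ?inE.
have sum_f (y : {ffun T' -> R}) : (forall w, w \notin codom phi -> y w = 0) ->
    \sum_w y w = \sum_v y (phi v).
  move=> y0; rewrite (bigID (mem (codom phi))) /= [X in _ + X]big1 ?addr0 //.
  rewrite -(big_imset (A := predT) y (in2W phiI)) /=; apply: eq_bigl => w.
  by apply/codomP/imsetP => [[v ->]|[v _ ->]]; exists v.
exists f, g; split.
- move=> x /and3P[/forallP x0 /eqP x1 xG]; split; last first.
    by apply/ffunP => v; rewrite gE fphi.
  apply/and3P; split.
  + apply/forallP => w; case: (boolP (w \in codom phi)) => [/codomP[v ->]|/f0 -> //].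
    by rewrite fphi.
  + rewrite sum_f; last exact: f0.
    by under eq_bigr do rewrite fphi; rewrite x1.
  + by rewrite G'E supp_f; apply/existsP; eexists; apply/andP; split; [exact: xG|].
- move=> y /and3P[/forallP y0 /eqP y1]; rewrite G'E => /existsP[t /andP[tG /eqP yt]].
  have yN w : w \notin codom phi -> y w = 0.
    move=> wN; apply/eqP; apply: contraNT wN => yw.
    have : w \in [set w | y w != 0] by rewrite inE.
    by rewrite yt => /imsetP[v _ ->]; exact: codom_f.
  split.
    apply/and3P; split.
    + by apply/forallP => v; rewrite gE.
    + by under eq_bigr do rewrite gE; rewrite -sum_f // y1.
    + suff -> : [set v | g y v != 0] = t by [].
      apply/setP => v; rewrite inE gE -(mem_imset t v phiI) -yt inE.
      by [].
  apply/ffunP => w; case: (boolP (w \in codom phi)) => [/codomP[v ->]|wN].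
    by rewrite fphi gE.
  by rewrite f0 // yN.
- exact: piecewise_linear_linear.
- exact: piecewise_linear_linear.
Qed.

(** * Flips realized as piecewise linear maps *)

Section Flip.
Variables (T : finType) (A B : {set T}) (G G' : {set {set T}}).
Variables (a0 : T) (a0A : a0 \in A).

Definition least_coordinate (x : {ffun T -> R}) : R := x [arg min_(a < a0 in A) x a]%O.

Lemma least_coordinate_le (x : {ffun T -> R}) a : a \in A -> least_coordinate x <= x a.
Proof. by rewrite /least_coordinate; case: arg_minP => // i _ H /H. Qed.

Lemma least_coordinate_mem (x : {ffun T -> R}) :
  exists2 a, a \in A & least_coordinate x = x a.
Proof. by rewrite /least_coordinate; case: arg_minP => // i iA _; exists i. Qed.

(** The largest multiple of the barycenter of [A] is removed from [x], and the same mass is spread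
    evenly over [B]. This is the identity on points whose support does not contain [A]. *)
Definition flip_map (x : {ffun T -> R}) : {ffun T -> R} :=
  [ffun w => x w - least_coordinate x * (w \in A)%:R +
     least_coordinate x * (#|A|%:R / #|B|%:R) * (w \in B)%:R].

Hypotheses (AB : [disjoint A & B]) (B0 : B != set0) (Gd : downward_closed G).
Hypothesis stay : forall s, s \in G -> ~~ (A \subset s) -> s \in G'.
Hypothesis exchange : forall s t : {set T}, s \in G -> A \subset s -> t \proper A ->
  (s :\: A) :|: t :|: B \in G'.

Lemma least_coordinate_ge0 (x : {ffun T -> R}) : (forall v, 0 <= x v) -> 0 <= least_coordinate x.
Proof. by have [a _ ->] := least_coordinate_mem x. Qed.

Lemma least_coordinate0 (x : {ffun T -> R}) : (forall v, 0 <= x v) ->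
  ~~ (A \subset [set v | x v != 0]) -> least_coordinate x = 0.
Proof.
move=> x0 /subsetPn[a aA]; rewrite inE negbK => /eqP xa.
apply/eqP; rewrite eq_le least_coordinate_ge0 // andbT -xa.
exact: least_coordinate_le.
Qed.

Lemma flip_map_id (x : {ffun T -> R}) : least_coordinate x = 0 -> flip_map x = x.
Proof. by move=> x0; apply/ffunP => w; rewrite ffunE x0 !mul0r subr0 addr0. Qed.

Lemma card_B_neq0 : #|B|%:R != 0 :> R.
Proof. by rewrite pnatr_eq0 cards_eq0. Qed.

Lemma flip_map_sum (x : {ffun T -> R}) : \sum_w flip_map x w = \sum_w x w.
Proof.
have sumE (S : {set T}) : \sum_w (w \in S)%:R = #|S|%:R :> R.
  rewrite -sum1_card natr_sum [RHS]big_mkcond; apply: eq_bigr => w _.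
  by case: (w \in S).
under eq_bigr do rewrite ffunE.
rewrite !big_split /= sumrN -!mulr_sumr !sumE.
by rewrite -mulrA divfK ?card_B_neq0 // subrK.
Qed.

Lemma flip_map_realization (x : {ffun T -> R}) : realization G x -> realization G' (flip_map x).
Proof.
move=> /and3P[/forallP x0 /eqP x1 xG].
case: (boolP (A \subset [set v | x v != 0])) => [sA|sA]; last first.
  rewrite flip_map_id; last exact: least_coordinate0.
  by rewrite /realization x1 eqxx stay // !andbT; apply/forallP.
have m0 := least_coordinate_ge0 x0.
have mpos : 0 < least_coordinate x.
  rewrite lt_def m0 andbT; have [a aA ->] := least_coordinate_mem x.
  by have := subsetP sA a aA; rewrite inE.
have c0 : 0 < #|A|%:R / #|B|%:R :> R.
  rewrite divr_gt0 // ltr0n card_gt0 //.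
  by apply/set0Pn; exists a0.
have xB w : w \in B -> w \in A = false.
  by move=> wB; apply/negbTE; apply: contraTN AB => wA; apply/pred0Pn; exists w; rewrite /= wA wB.
have f0 w : 0 <= flip_map x w.
  rewrite ffunE; case: (boolP (w \in A)) => wA; case: (boolP (w \in B)) => wB.
  - by rewrite (xB _ wB) in wA.
  - by rewrite mulr1 mulr0 addr0 subr_ge0 least_coordinate_le.
  - by rewrite mulr0 subr0 mulr1 addr_ge0 // mulr_ge0 // ltW.
  - by rewrite !mulr0 subr0 addr0.
apply/and3P; split; [exact/forallP| by rewrite flip_map_sum x1 |].
(* The coordinates of [A] attaining the minimum become zero, so a proper subset of [A] survives and
   all of [B] is added. *)
suff -> : [set w | flip_map x w != 0] = ([set v | x v != 0] :\: A) :|: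
    [set a in A | x a != least_coordinate x] :|: B.
  apply: exchange => //; apply/properP; split; first by apply/subsetP => a; rewrite inE => /andP[].
  by have [a aA E] := least_coordinate_mem x; exists a; rewrite // inE E eqxx andbF.
apply/setP => w; rewrite !inE ffunE.
case: (boolP (w \in A)) => wA; case: (boolP (w \in B)) => wB /=.
- by rewrite (xB _ wB) in wA.
- by rewrite mulr1 mulr0 addr0 subr_eq0 orbF.
- rewrite mulr0 subr0 mulr1 orbT.
  by rewrite gt_eqF // ltr_wpDl // mulr_gt0.
- by rewrite !mulr0 subr0 addr0 !orbF.
Qed.

Lemma flip_map_piecewise_linear : piecewise_linear G flip_map.
Proof.
(* The minimum over [A] is linear once the vertex [a] attaining it is fixed, so each face is cut
   according to that vertex. *)
pose P (s : {set T}) a : polyhedron R T := simplex_polyhedron s ++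
  [seq ([ffun w => (w == a)%:R - (w == a')%:R], 0) | a' <- enum A].
have inP s a x : in_polyhedron (P s a) x = in_polyhedron (simplex_polyhedron s) x &&
    [forall a' in A, x a <= x a'].
  rewrite /in_polyhedron all_cat; congr (_ && _).
  rewrite all_map; apply/allP/forall_inP => H a' aA.
    have := H a'; rewrite mem_enum => /(_ aA) /=.
    under eq_bigr do rewrite ffunE mulrBl.
    by rewrite sumrB !sum_delta subr_le0.
  rewrite mem_enum in aA; rewrite /=.
  under eq_bigr do rewrite ffunE mulrBl.
  by rewrite sumrB !sum_delta subr_le0 H.
exists [seq P s a | s <- enum G, a <- enum A]; split.
  move=> x; rewrite realization_simplices //; apply/hasP/hasP => [[s sG xs]|].
    have [a aA aE] := least_coordinate_mem x.
    exists (P s a); first by apply/allpairsP; exists (s, a); rewrite mem_enum.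
    rewrite inP xs /=; apply/forall_inP => a' a'A.
    by rewrite -aE least_coordinate_le.
  move=> [Q /allpairsP[[s a] /= [sG aA ->]]]; rewrite inP => /andP[xs _].
  by exists s.
move=> Q /allpairsP[[s a] /= [sG]]; rewrite mem_enum => aA ->.
pose c := #|A|%:R / #|B|%:R : R.
exists (fun w v => (v == w)%:R - (v == a)%:R * (w \in A)%:R + (v == a)%:R * (c * (w \in B)%:R)).
exists (fun=> 0) => x; rewrite inP => /andP[_ /forall_inP xa] w.
have E : least_coordinate x = x a.
  apply/eqP; rewrite eq_le least_coordinate_le //=.
  by have [b bA ->] := least_coordinate_mem x; apply: xa.
rewrite ffunE E -/c addr0.
under eq_bigr do rewrite mulrDl mulrBl.
rewrite big_split sumrB /= sum_delta; congr (_ - _ + _).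
  rewrite -[in LHS](sum_delta x a) mulr_suml; apply: eq_bigr => v _; ring.
rewrite -[in LHS](sum_delta x a) !mulr_suml; apply: eq_bigr => v _; ring.
Qed.

End Flip.

(** No face of [G] contains [B], so some coordinate of [x] in [B] is zero. The least coordinate of
    the image over [B] is therefore exactly the mass that was moved there, and the reverse map takes
    it back. *)
Lemma flip_map_inv (T : finType) (A B : {set T}) (a0 b0 : T) (G : {set {set T}})
    (a0A : a0 \in A) (b0B : b0 \in B) :
  [disjoint A & B] -> (forall s, s \in G -> ~~ (B \subset s)) ->
  forall x : {ffun T -> R}, realization G x ->
    flip_map B A b0 (flip_map A B a0 x) = x.
Proof.
move=> AB GB x /and3P[/forallP x0 _ xG].
have xB w : w \in B -> w \in A = false.
  by move=> wB; apply/negbTE; apply: contraTN AB => wA; apply/pred0Pn; exists w; rewrite /= wA wB.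
set m := least_coordinate A a0 x; set y := flip_map A B a0 x.
have m0 : 0 <= m by apply: least_coordinate_ge0.
have cA : #|A|%:R != 0 :> R by rewrite pnatr_eq0 cards_eq0; apply/set0Pn; exists a0.
have cB : #|B|%:R != 0 :> R by rewrite pnatr_eq0 cards_eq0; apply/set0Pn; exists b0.
have mB : least_coordinate B b0 y = m * (#|A|%:R / #|B|%:R).
  have yB b : b \in B -> y b = x b + m * (#|A|%:R / #|B|%:R).
    by move=> bB; rewrite ffunE bB (xB _ bB) mulr0 subr0 mulr1.
  apply/eqP; rewrite eq_le; apply/andP; split.
    have /subsetPn[b bB] := GB _ xG; rewrite inE negbK => /eqP xb.
    by rewrite -[leRHS]add0r -xb -yB // least_coordinate_le.
  have [b bB ->] := least_coordinate_mem b0B y.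
  by rewrite yB // lerDr.
apply/ffunP => w; rewrite [LHS]ffunE mB ffunE -/m.
case: (boolP (w \in A)) => wA; case: (boolP (w \in B)) => wB.
- by rewrite (xB _ wB) in wA.
- rewrite !mulr1 !mulr0; field; exact/andP.
- rewrite !mulr1 !mulr0; ring.
- by rewrite !mulr0; ring.
Qed.

(** The hypotheses do not name the links of [A] and [B]: they allow [A * dB * L] to be exchanged for
    [dA * B * L] with any complex [L], which contains bistellar moves and stellar subdivisions as
    special cases. *)
Lemma PL_flip (T : finType) (A B : {set T}) (G G' : {set {set T}}) :
  A != set0 -> B != set0 -> [disjoint A & B] ->
  downward_closed G -> downward_closed G' ->
  (forall s, s \in G -> ~~ (B \subset s)) ->
  (forall s, s \in G' -> ~~ (A \subset s)) ->
  (forall s, s \in G -> ~~ (A \subset s) -> s \in G') ->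
  (forall s, s \in G' -> ~~ (B \subset s) -> s \in G) ->
  (forall s t : {set T}, s \in G -> A \subset s -> t \proper A -> (s :\: A) :|: t :|: B \in G') ->
  (forall s t : {set T}, s \in G' -> B \subset s -> t \proper B -> (s :\: B) :|: t :|: A \in G) ->
  PL_homeomorphic R G G'.
Proof.
move=> A0 B0 AB Gd G'd GB G'A GG' G'G mv mv'.
have BA : [disjoint B & A] by rewrite disjoint_sym.
have /set0Pn[a0 a0A] := A0; have /set0Pn[b0 b0B] := B0.
exists (flip_map A B a0), (flip_map B A b0); split.
- by move=> x xG; split; [exact: flip_map_realization xG|exact: flip_map_inv xG].
- by move=> x xG; split; [exact: flip_map_realization xG|exact: flip_map_inv xG].
- exact: flip_map_piecewise_linear.
- exact: flip_map_piecewise_linear.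
Qed.

End PiecewiseLinear.

(** * Complexes on signed indices *)

Local Open Scope fset_scope.

(** An infinite supply of vertices, so that scratch vertices are always available. [carrier] returns
    to the finite vertex types of the statement. *)
Definition U : choiceType := (nat * bool)%type.
Definition cpx : Type := {fset U} -> Prop.

Definition down (X : cpx) : Prop := forall s t : {fset U}, X s -> t `<=` s -> X t.

Definition bounded_by (m : nat) (X : cpx) : Prop :=
  forall s, X s -> forall u, u \in s -> (u.1 < m)%N.

Definition bounded (X : cpx) : Prop := exists m, bounded_by m X.

Definition cup (X Y : cpx) : cpx := fun s => X s \/ Y s.

Lemma cpx_ext (X Y : cpx) : (forall s, X s <-> Y s) -> X = Y.
Proof. by move=> XY; apply/funext => s; apply/propext. Qed.

Lemma bounded_by_leq (m n : nat) (X : cpx) :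
  (m <= n)%N -> bounded_by m X -> bounded_by n X.
Proof. by move=> mn Xm s Xs u us; apply: leq_trans (Xm s Xs u us) mn. Qed.

Lemma bounded_cup (X Y : cpx) : bounded X -> bounded Y -> bounded (cup X Y).
Proof.
move=> [m Xm] [n Yn]; exists (maxn m n) => s [Xs|Ys].
  by apply: (bounded_by_leq _ Xm) Xs; rewrite leq_maxl.
by apply: (bounded_by_leq _ Yn) Ys; rewrite leq_maxr.
Qed.

Lemma down_cup (X Y : cpx) : down X -> down Y -> down (cup X Y).
Proof. by move=> Xd Yd s t [/Xd H|/Yd H] /H ?; [left|right]. Qed.

Lemma fset_bound (A : {fset U}) : exists m, forall u, u \in A -> (u.1 < m)%N.
Proof.
exists (\max_(u <- enum_fset A) u.1).+1 => u uA; rewrite ltnS.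
by apply: (@leq_bigmax_seq _ _ xpredT (fun u : U => u.1)).
Qed.

Definition vertex (m : nat) (v : V m) : U := (val v.1, v.2).

Lemma vertex_inj m : injective (@vertex m).
Proof. by move=> [i a] [j b] [/val_inj -> ->]. Qed.

Definition face_of (m : nat) (s : {set V m}) : {fset U} := [fset vertex v | v in s].

Lemma vertex_face_of m (s : {set V m}) v : (vertex v \in face_of s) = (v \in s).
Proof. by rewrite mem_imfset //; apply: vertex_inj. Qed.

Lemma vertexP m (u : U) : (u.1 < m)%N -> exists v : V m, u = vertex v.
Proof. by case: u => i a /= im; exists (Ordinal im, a). Qed.

Lemma in_face_of m (s : {set V m}) (u : U) : u \in face_of s -> exists2 v, v \in s & u = vertex v.
Proof. by move=> /imfsetP[v /= vs ->]; exists v. Qed.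

Definition trace (m : nat) (A : {fset U}) : {set V m} := [set v | vertex v \in A].

Lemma face_of_trace m (A : {fset U}) : (forall u, u \in A -> (u.1 < m)%N) ->
  face_of (trace m A) = A.
Proof.
move=> Am; apply/fsetP => u; apply/idP/idP => [/in_face_of[v + ->]|uA].
  by rewrite inE.
by have [v uE] := vertexP (Am _ uA); rewrite uE vertex_face_of inE -uE.
Qed.

Lemma face_of_sub m (s t : {set V m}) : (face_of s `<=` face_of t) = (s \subset t).
Proof.
apply/fsubsetP/subsetP => H v; last by move=> /in_face_of[w /H ws ->]; rewrite vertex_face_of.
by rewrite -!vertex_face_of => /H.
Qed.

Lemma face_of_inj m : injective (@face_of m).
Proof. by move=> s t E; apply/setP => v; rewrite -!vertex_face_of E. Qed.

Lemma face_ofU m (s t : {set V m}) : face_of (s :|: t) = face_of s `|` face_of t.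
Proof.
apply/fsetP => u; rewrite inE; apply/idP/orP.
  by move=> /in_face_of[v + ->]; rewrite inE !vertex_face_of => /orP.
by move=> [] /in_face_of[v vs ->]; rewrite vertex_face_of inE vs ?orbT.
Qed.

Lemma face_ofD m (s t : {set V m}) : face_of (s :\: t) = face_of s `\` face_of t.
Proof.
apply/fsetP => u; rewrite inE; apply/idP/andP.
  by move=> /in_face_of[v + ->]; rewrite inE !vertex_face_of => /andP.
by move=> [] + /in_face_of[v vs uE]; rewrite uE !vertex_face_of inE vs andbT.
Qed.

Definition carrier (m : nat) (X : cpx) : {set {set V m}} :=
  [set s | `[< X (face_of s) >]].

Lemma in_carrier m X (s : {set V m}) : (s \in carrier m X) = `[< X (face_of s) >].
Proof. by rewrite inE. Qed.

Lemma carrier_down m X : down X -> downward_closed (carrier m X).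
Proof.
move=> Xd s t; rewrite !in_carrier => /asboolP Xs ts; apply/asboolP.
by apply: Xd Xs _; rewrite face_of_sub.
Qed.

Section Complexes.
Variable R : realType.

(** The bound [m] is existential because it can always be enlarged, by [PL_carrier2]. *)
Definition PLh (X Y : cpx) : Prop := exists m,
  [/\ bounded_by m X, bounded_by m Y & PL_homeomorphic R (carrier m X) (carrier m Y)].

Lemma PL_carrier m n X : down X -> bounded_by m X -> (m <= n)%N ->
  PL_homeomorphic R (carrier m X) (carrier n X).
Proof.
move=> Xd Xm mn.
pose phi (v : V m) : V n := (widen_ord mn v.1, v.2).
have phiE v : vertex (phi v) = vertex v by [].
have phi_face (t : {set V m}) : face_of (phi @: t) = face_of t.
  apply/fsetP => u; apply/idP/idP => [/in_face_of[w /imsetP[v vt ->] ->]|].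
    by rewrite phiE vertex_face_of.
  move=> /in_face_of[v vt ->]; rewrite -phiE vertex_face_of.
  exact: imset_f.
apply: (@PL_relabel R _ _ phi).
- by move=> v w /(congr1 (@vertex n)); rewrite !phiE => /vertex_inj.
- exact: carrier_down.
move=> s; apply/idP/existsP.
  rewrite in_carrier => /asboolP Xs.
  exists (trace m (face_of s)); rewrite in_carrier face_of_trace; last exact: Xm.
  rewrite asboolT //=; apply/eqP/face_of_inj.
  by rewrite phi_face face_of_trace //; exact: Xm.
move=> [t /andP[tX /eqP ->]]; move: tX; rewrite !in_carrier.
by rewrite phi_face.
Qed.

Lemma PL_carrier2 m n X Y : down X -> down Y -> bounded_by m X -> bounded_by m Y ->
  (m <= n)%N -> PL_homeomorphic R (carrier m X) (carrier m Y) ->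
  PL_homeomorphic R (carrier n X) (carrier n Y).
Proof.
move=> Xd Yd Xm Ym mn XY.
apply: PL_homeomorphic_trans (PL_homeomorphic_trans XY (PL_carrier Yd Ym mn)).
exact/PL_homeomorphic_sym/PL_carrier.
Qed.

Lemma PLh_sym X Y : PLh X Y -> PLh Y X.
Proof. by move=> [m [Xm Ym XY]]; exists m; split=> //; exact: PL_homeomorphic_sym. Qed.

Lemma PLh_trans X Y Z : down X -> down Y -> down Z -> PLh X Y -> PLh Y Z -> PLh X Z.
Proof.
move=> Xd Yd Zd [m [Xm Ym XY]] [n [Yn Zn YZ]]; exists (maxn m n); split.
- exact: bounded_by_leq (leq_maxl _ _) Xm.
- exact: bounded_by_leq (leq_maxr _ _) Zn.
apply: (@PL_homeomorphic_trans _ _ _ _ _ (carrier (maxn m n) Y)).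
  exact: PL_carrier2 (leq_maxl _ _) XY.
exact: PL_carrier2 (leq_maxr _ _) YZ.
Qed.

Lemma PLh_refl X : down X -> bounded X -> PLh X X.
Proof. by move=> Xd [m Xm]; exists m; split=> //; exact: PL_carrier. Qed.

Lemma PLh_flip (A B : {fset U}) (X Y : cpx) :
  A != fset0 -> B != fset0 -> [disjoint A & B] ->
  down X -> down Y -> bounded X -> bounded Y ->
  (forall s, X s -> ~~ (B `<=` s)) -> (forall s, Y s -> ~~ (A `<=` s)) ->
  (forall s, X s -> ~~ (A `<=` s) -> Y s) ->
  (forall s, Y s -> ~~ (B `<=` s) -> X s) ->
  (forall s t, X s -> A `<=` s -> t `<=` A -> ~~ (A `<=` t) -> Y ((s `\` A) `|` t `|` B)) ->
  (forall s t, Y s -> B `<=` s -> t `<=` B -> ~~ (B `<=` t) -> X ((s `\` B) `|` t `|` A)) ->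
  PLh X Y.
Proof.
move=> A0 B0 AB Xd Yd [mX Xm] [mY Ym] XB YA XY YX mvX mvY.
have [mA Am] := fset_bound A; have [mB Bm] := fset_bound B.
pose m := maxn (maxn mX mY) (maxn mA mB).
have {}Am (u : U) : u \in A -> (u.1 < m)%N by move/Am => ?; rewrite /m; lia.
have {}Bm (u : U) : u \in B -> (u.1 < m)%N by move/Bm => ?; rewrite /m; lia.
exists m; split.
- by apply: bounded_by_leq Xm; rewrite /m; lia.
- by apply: bounded_by_leq Ym; rewrite /m; lia.
pose A' := trace m A; pose B' := trace m B.
have EA : face_of A' = A by apply: face_of_trace.
have EB : face_of B' = B by apply: face_of_trace.
have subA (s : {set V m}) : (A' \subset s) = (A `<=` face_of s) by rewrite -face_of_sub EA.
have subB (s : {set V m}) : (B' \subset s) = (B `<=` face_of s) by rewrite -face_of_sub EB.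
apply: (@PL_flip R _ A' B').
- apply: contraNneq A0 => A'0; rewrite -EA A'0; apply/eqP/fsetP => u.
  by apply/idP => /in_face_of[v]; rewrite inE.
- apply: contraNneq B0 => B'0; rewrite -EB B'0; apply/eqP/fsetP => u.
  by apply/idP => /in_face_of[v]; rewrite inE.
- apply/pred0P => v /=; rewrite !inE.
  by apply/negP => /andP[vA vB]; move/fdisjointP: AB => /(_ _ vA); rewrite vB.
- exact: carrier_down.
- exact: carrier_down.
- by move=> s; rewrite in_carrier subB => /asboolP /XB.
- by move=> s; rewrite in_carrier subA => /asboolP /YA.
- by move=> s; rewrite !in_carrier subA => /asboolP /XY H /H ?; apply/asboolP.
- by move=> s; rewrite !in_carrier subB => /asboolP /YX H /H ?; apply/asboolP.
- move=> s t; rewrite !in_carrier subA properE -!face_of_sub EA => /asboolP Xs As /andP[tA At].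
  by apply/asboolP; rewrite !face_ofU face_ofD EA EB; exact: mvX.
- move=> s t; rewrite !in_carrier subB properE -!face_of_sub EB => /asboolP Ys Bs /andP[tB Bt].
  by apply/asboolP; rewrite !face_ofU face_ofD EA EB; exact: mvY.
Qed.

(** * Stellar subdivisions and general position *)

Definition stellar (s0 : {fset U}) (x : U) (X : cpx) : cpx := fun s =>
  ~~ (s0 `<=` s) /\ ((x \notin s /\ X s) \/ (x \in s /\ X ((s `\ x) `|` s0))).

Lemma stellar_down s0 (x : U) (X : cpx) : down X -> down (stellar s0 x X).
Proof.
move=> Xd s t [s0s H] ts; split.
  by apply: contra s0s => /fsubset_trans; apply.
case: (boolP (x \in t)) => xt; [right|left]; split=> //.
  have xs : x \in s by apply: (fsubsetP ts).
  case: H => [[]|[_ H]]; first by rewrite xs.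
  apply: Xd H _; apply: fsetUSS => //; apply: fsetSD ts.
case: H => [[_ H]|[_ H]]; apply: Xd H _ => //.
apply/fsubsetP => u ut; rewrite !inE (fsubsetP ts) // andbT.
by apply/orP; left; apply: contraNneq xt => <-.
Qed.

Lemma stellar_bounded s0 (x : U) (X : cpx) : down X -> bounded X -> bounded (stellar s0 x X).
Proof.
move=> Xd [m Xm]; exists (maxn m x.1.+1) => s [_ [[_ Xs]|[xs Xs]]] u us.
  by have := Xm _ Xs u us; lia.
have [->|ux] := eqVneq u x; first lia.
have : u \in (s `\ x) `|` s0 by rewrite !inE ux us.
by move=> /(Xm _ Xs); lia.
Qed.

(** Stellar subdivision is the flip of [s0] against the single vertex [x], whose boundary consists
    of the empty face. *)
Lemma PLh_stellar (s0 : {fset U}) (x : U) (X : cpx) : down X -> bounded X -> s0 != fset0 -> x \notin s0 ->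
  (forall s, X s -> x \notin s) -> PLh X (stellar s0 x X).
Proof.
move=> Xd Xb s00 xs0 xX; apply: (@PLh_flip s0 [fset x]) => //.
- by apply/fset0Pn; exists x; rewrite inE.
- by apply/fdisjointP => u us0; rewrite inE; apply: contraNneq xs0 => <-.
- exact: stellar_down.
- exact: stellar_bounded.
- by move=> s Xs; rewrite fsub1set xX.
- by move=> s [].
- by move=> s Xs As; split=> //; left; split=> //; exact: xX.
- by move=> s [_ [[_]|[xs _]]] //; rewrite fsub1set xs.
- move=> s t Xs s0s ts0 s0t; split.
    apply: contra s0t => /fsubsetP s0s'; apply/fsubsetP => u us0.
    have := s0s' u us0; rewrite !inE us0 /=.
    by move=> /orP[//|/eqP ux]; rewrite -ux us0 in xs0.
  right; rewrite !inE eqxx orbT; split=> //.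
  apply: Xd Xs _; apply/fsubsetP => u; rewrite !inE.
  case: (boolP (u \in s0)) => [/(fsubsetP s0s) //|us0]; rewrite orbF /=.
  move=> /andP[/negbTE ->]; rewrite orbF => /orP[//|].
  by move=> /(fsubsetP ts0); rewrite (negbTE us0).
- move=> s t [_ H]; rewrite fsub1set => xs tx xt.
  have -> : t = fset0.
    by move: tx; rewrite fsubset1 => /orP[/eqP tE|/eqP //]; rewrite tE fsubset_refl in xt.
  rewrite fsetU0; by case: H => [[]|[_]] //; rewrite xs.
Qed.

Definition Vn (m : nat) : {fset U} := face_of [set: V m].

Lemma in_Vn m (u : U) : (u \in Vn m) = (u.1 < m)%N.
Proof.
apply/idP/idP => [/in_face_of[v _ ->]|/vertexP[v ->]]; first exact: ltn_ord.
by rewrite vertex_face_of inE.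
Qed.

Lemma bounded_byP m (X : cpx) : bounded_by m X <-> forall s, X s -> s `<=` Vn m.
Proof.
split=> H s Xs; first by apply/fsubsetP => u us; rewrite in_Vn; apply: H us.
by move=> u us; rewrite -in_Vn; apply: (fsubsetP (H s Xs)).
Qed.

(* Subdividing [K] away from [b] puts it in general position with respect to
   any complex on the vertices [Vn m] that it meets only along [b]. *)
Lemma general_position m (b K : cpx) : down K -> bounded K ->
  exists K', [/\ down K', bounded K',
    forall s, K' s -> s `<=` Vn m -> s = fset0 \/ b s &
    forall X, down X -> bounded_by m X ->
      (forall s, s != fset0 -> K s -> X s -> b s) -> PLh (cup K X) (cup K' X)].
Proof.
(* Subdividing at one bad face destroys it. The new faces contain the vertex [x] outside [Vn m] and
   so are not bad; hence the number of bad faces decreases. *)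
pose bad (K : cpx) := [fset s in fpowerset (Vn m) | `[< [/\ K s, s != fset0 & ~ b s] >]].
have [n] := ubnP #|` bad K|; elim: n K => // n IH K ltn Kd Kb.
have [badK|/fset0Pn[s0]] := eqVneq (bad K) fset0.
  exists K; split=> // [s Ks sm|X Xd Xm _]; last first.
    by apply: PLh_refl; [exact: down_cup|apply: bounded_cup => //; exists m].
  have [->|s0] := eqVneq s fset0; first by left.
  right; apply: contrapT => nb.
  suff : s \in bad K by rewrite badK.
  by rewrite !inE /= fpowersetE sm; apply/asboolP.
rewrite !inE /= fpowersetE => /andP[s0m /asboolP[Ks0 s00 nbs0]].
have [mK Km] := Kb.
pose x : U := ((m + mK)%N, false).
have xm : x \notin Vn m by rewrite in_Vn /x /=; lia.
have xK (s : {fset U}) : K s -> x \notin s.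
  by move=> Ks; apply/negP => /(Km _ Ks); rewrite /x /=; lia.
have xs0 : x \notin s0 by apply: contra xm; apply: (fsubsetP s0m).
pose K1 := stellar s0 x K.
have K1K (s : {fset U}) : K1 s -> s `<=` Vn m -> K s.
  move=> [_ [[//]|[xs _]]] sm; case/negP: xm; exact: (fsubsetP sm).
have [|||K' [K'd K'b K'g K'P]] := IH K1.
- rewrite -ltnS; apply: leq_trans ltn; rewrite ltnS.
  apply: fproper_ltn_card; rewrite fproperE; apply/andP; split.
    apply/fsubsetP => s; rewrite !inE /= fpowersetE => /andP[sm /asboolP[K1s ? ?]].
    by rewrite sm; apply/asboolP; split=> //; apply: K1K.
  apply/fsubsetPn; exists s0; first by rewrite !inE /= fpowersetE s0m; apply/asboolP.
  by rewrite !inE /= fpowersetE s0m; apply/asboolP => -[[]]; rewrite fsubset_refl.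
- exact: stellar_down.
- exact: stellar_bounded.
exists K'; split=> // X Xd Xm KX.
have Xsub : forall s, X s -> s `<=` Vn m by apply/bounded_byP.
have K1X (s : {fset U}) : s != fset0 -> K1 s -> X s -> b s.
  by move=> s1 K1s Xs; apply: KX => //; apply: K1K => //; apply: Xsub.
have XB : bounded X by exists m.
have K1d : down K1 by exact: stellar_down.
apply: (@PLh_trans _ (cup K1 X)) (K'P _ Xd Xm K1X); try exact: down_cup.
have X_s0 (s : {fset U}) : X s -> ~~ (s0 `<=` s).
  by move=> Xs; apply/negP => s0s; apply: nbs0; apply: KX => //; apply: Xd Xs _.
(* No face of [X] contains [s0], since [s0] would then be a common face outside [b]. Subdividing the
   union thus leaves [X] intact. *)
have <- : stellar s0 x (cup K X) = cup K1 X.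
  apply: cpx_ext => s; split.
    move=> [s0s [[xs [Ks|Xs]]|[xs [Ks|Xs]]]]; try by [right].
    - by left; split=> //; left.
    - by left; split=> //; right.
    - by have := X_s0 _ Xs; rewrite fsubsetUr.
  move=> [[s0s [[xs Ks]|[xs Ks]]]|Xs].
  - by split=> //; left; split=> //; left.
  - by split=> //; right; split=> //; left.
  - split; first exact: X_s0.
    left; split; last by right.
    by apply: contra xm; apply: (fsubsetP (Xsub _ Xs)).
apply: PLh_stellar => //.
- exact: down_cup.
- exact: bounded_cup.
- by move=> s [/xK //|/Xsub sm]; apply: contra xm; apply: (fsubsetP sm).
Qed.

(** [X] and [Y] may replace each other inside any complex [K] that meets them, apart from the empty
    face, only in faces of [b]. *)
Definition PLrel (b X Y : cpx) : Prop := forall K, down K -> bounded K ->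
  (forall s, s != fset0 -> K s -> X s -> b s) ->
  (forall s, s != fset0 -> K s -> Y s -> b s) -> PLh (cup K X) (cup K Y).

Lemma PLrel_sym b X Y : PLrel b X Y -> PLrel b Y X.
Proof. by move=> H K Kd Kb KY KX; apply: PLh_sym; apply: H. Qed.

(** [K] is under control with respect to [X] and [Z] but may meet the intermediate [Y] outside [b].
    It is first moved off all three complexes by [general_position], and moved back at the end. *)
Lemma PLrel_trans b X Y Z : down X -> down Y -> down Z ->
  bounded X -> bounded Y -> bounded Z -> PLrel b X Y -> PLrel b Y Z -> PLrel b X Z.
Proof.
move=> Xd Yd Zd [mX Xm] [mY Ym] [mZ Zm] XY YZ K Kd Kb KX KZ.
pose m := maxn mX (maxn mY mZ).
have {}Xm : bounded_by m X by apply: bounded_by_leq Xm; rewrite /m; lia.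
have {}Ym : bounded_by m Y by apply: bounded_by_leq Ym; rewrite /m; lia.
have {}Zm : bounded_by m Z by apply: bounded_by_leq Zm; rewrite /m; lia.
have [K' [K'd K'b K'g K'P]] := general_position m b Kd Kb.
have K'X (s : {fset U}) : s != fset0 -> K' s -> X s -> b s.
  by move=> s0 Ks /(proj1 (bounded_byP _ _) Xm) /(K'g _ Ks)[sE|//]; rewrite sE eqxx in s0.
have K'Y (s : {fset U}) : s != fset0 -> K' s -> Y s -> b s.
  by move=> s0 Ks /(proj1 (bounded_byP _ _) Ym) /(K'g _ Ks)[sE|//]; rewrite sE eqxx in s0.
have K'Z (s : {fset U}) : s != fset0 -> K' s -> Z s -> b s.
  by move=> s0 Ks /(proj1 (bounded_byP _ _) Zm) /(K'g _ Ks)[sE|//]; rewrite sE eqxx in s0.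
apply: (@PLh_trans _ (cup K' X)) (K'P _ Xd Xm KX) _; try exact: down_cup.
apply: (@PLh_trans _ (cup K' Y)) (XY _ K'd K'b K'X K'Y) _; try exact: down_cup.
apply: (@PLh_trans _ (cup K' Z)) (YZ _ K'd K'b K'Y K'Z) _; try exact: down_cup.
exact: PLh_sym (K'P _ Zd Zm KZ).
Qed.

(** The common part [E] of [X] and [Y] is absorbed into the surrounding complex, so that only the
    local change from [X1] to [Y1] has to be known. The remaining conditions say that neither [E]
    nor the old border touches the changed part outside [b1]. *)
Lemma PLrel_step (E X1 Y1 b1 b X Y : cpx) : down E -> bounded E ->
  (forall s, X s <-> E s \/ X1 s) -> (forall s, Y s <-> E s \/ Y1 s) ->
  (forall s, E s -> X1 s -> b1 s) -> (forall s, E s -> Y1 s -> b1 s) ->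
  (forall s, b s -> X1 s -> b1 s) -> (forall s, b s -> Y1 s -> b1 s) ->
  PLrel b1 X1 Y1 -> PLrel b X Y.
Proof.
move=> Ed Eb XE YE EX EY bX bY XY K Kd Kb KX KY.
have -> : cup K X = cup (cup K E) X1.
  by apply: cpx_ext => s; rewrite /cup XE; tauto.
have -> : cup K Y = cup (cup K E) Y1.
  by apply: cpx_ext => s; rewrite /cup YE; tauto.
apply: XY; [exact: down_cup|exact: bounded_cup| |].
  move=> s s0 [Ks|Es] X1s; last exact: EX.
  by apply: bX => //; apply: KX => //; apply/XE; right.
move=> s s0 [Ks|Es] Y1s; last exact: EY.
by apply: bY => //; apply: KY => //; apply/YE; right.
Qed.

End Complexes.

(** * Exchanging balls *)

(** A complex on the vertex set [S] is represented by a condition that looks at [S] only. The join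
    of complexes on disjoint vertex sets is then the conjunction of their conditions; [independent]
    is the matching notion for a factor that ignores [Q]. *)
Definition cylinder (S : {fset U}) (L : cpx) : Prop :=
  forall s t : {fset U}, (forall u, u \in S -> (u \in s) = (u \in t)) -> L s -> L t.

Definition independent (Q : {fset U}) (G : cpx) : Prop :=
  forall s t : {fset U}, (forall u, u \notin Q -> (u \in s) = (u \in t)) -> G s -> G t.

Lemma down_and (X Y : cpx) : down X -> down Y -> down (fun s => X s /\ Y s).
Proof. by move=> Xd Yd s t [Xs Ys] ts; split; [exact: Xd Xs ts|exact: Yd Ys ts]. Qed.

Lemma down_or (X Y : cpx) : down X -> down Y -> down (fun s => X s \/ Y s).
Proof. exact: down_cup. Qed.

Lemma down_nsub (A : {fset U}) : down (fun s => ~ (A `<=` s)).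
Proof. by move=> s t As ts At; apply: As; apply: fsubset_trans ts. Qed.

Lemma down_notin (u : U) : down (fun s => ~ (u \in s)).
Proof. by move=> s t us ts ut; apply: us; apply: (fsubsetP ts). Qed.

Lemma down_del (u : U) (X : cpx) : down X -> down (fun s => X (s `\ u)).
Proof. by move=> Xd s t Xs ts; apply: Xd Xs _; apply: fsetSD. Qed.

Lemma bounded_sub (X Y : cpx) : bounded Y -> (forall s, X s -> Y s) -> bounded X.
Proof. by move=> [m Ym] XY; exists m => s /XY; exact: Ym. Qed.

Lemma bounded_del (u : U) (X : cpx) : bounded X -> bounded (fun s => X (s `\ u)).
Proof.
move=> [m Xm]; exists (maxn m u.1.+1) => s Xs v vs.
have [->|vu] := eqVneq v u; first lia.
have : v \in s `\ u by rewrite !inE vu vs.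
by move=> /(Xm _ Xs); lia.
Qed.

Lemma subU1P (u : U) (A s : {fset U}) : u |` A `<=` s <-> (u \in s /\ A `<=` s).
Proof. by rewrite fsubUset fsub1set; split=> /andP. Qed.

Lemma sub1P (u : U) (s : {fset U}) : [fset u] `<=` s <-> u \in s.
Proof. by rewrite fsub1set. Qed.

Lemma sub0P (s : {fset U}) : fset0 `<=` s <-> True.
Proof. by rewrite fsub0set. Qed.

Ltac down_tac := repeat first
  [ assumption | apply: down_nsub | apply: down_notin | apply: down_and
  | apply: down_or | apply: down_del ].

(* A propositional tautology checker by truth tables; [tauto] is too slow on
   the inclusions between complexes below. *)
Inductive form :=
  | Atom of nat | Truth | Falsity
  | Conj of form & form | Disj of form & form | Impl of form & form.

Fixpoint denote (e : seq Prop) (f : form) : Prop :=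
  match f with
  | Atom n => nth True e n
  | Truth => True
  | Falsity => False
  | Conj f g => denote e f /\ denote e g
  | Disj f g => denote e f \/ denote e g
  | Impl f g => denote e f -> denote e g
  end.

Fixpoint evalb (e : seq bool) (f : form) : bool :=
  match f with
  | Atom n => nth true e n
  | Truth => true
  | Falsity => false
  | Conj f g => evalb e f && evalb e g
  | Disj f g => evalb e f || evalb e g
  | Impl f g => evalb e f ==> evalb e g
  end.

Fixpoint tautology (n : nat) (e : seq bool) (f : form) : bool :=
  if n is m.+1 then tautology m (true :: e) f && tautology m (false :: e) f
  else evalb e f.

Lemma evalbP (e : seq Prop) (f : form) :
  evalb [seq `[< P >] | P <- e] f <-> denote e f.
Proof.
elim: f => //= [n|f IHf g IHg|f IHf g IHg|f IHf g IHg].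
- elim: e n => [|P e IH] [|n] //=; split; first by move/asboolP.
  by move=> ?; apply/asboolP.
- by split=> [/andP[/IHf ? /IHg]|[/IHf -> /IHg]].
- by split=> [/orP[/IHf|/IHg]|[/IHf ->|/IHg ->]]; [left|right| |rewrite orbT].
- split=> [/implyP fg /IHf /fg /IHg //|fg]; apply/implyP => /IHf /fg.
  by move/IHg.
Qed.

Lemma tautologyP (e : seq Prop) (f : form) : tautology (size e) [::] f -> denote e f.
Proof.
have gen n (b : seq bool) : tautology n b f -> forall c, size c = n ->
    evalb (catrev c b) f.
  elim: n b => [|n IH] b /=; first by move=> fb c /size0nil ->.
  by move=> /andP[ft ff] [|[] c] //= [sc]; apply: IH.
move=> /gen /(_ (rev [seq `[< P >] | P <- e])).
rewrite size_rev size_map => /(_ erefl).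
by rewrite catrevE revK cats0 => /evalbP.
Qed.

Ltac add_atom P l :=
  lazymatch l with
  | context [@cons Prop P _] => l
  | _ => constr:(@cons Prop P l)
  end.

Ltac collect P l :=
  lazymatch P with
  | ?A /\ ?B => let l := collect A l in collect B l
  | ?A \/ ?B => let l := collect A l in collect B l
  | ?A <-> ?B => let l := collect A l in collect B l
  | ~ ?A => collect A l
  | ?A -> ?B => let l := collect A l in collect B l
  | True => l
  | False => l
  | _ => add_atom P l
  end.

Ltac position P l :=
  lazymatch l with
  | @cons Prop P _ => constr:(O)
  | @cons Prop _ ?l => let n := position P l in constr:(S n)
  end.

Ltac reify P l :=
  lazymatch P with
  | ?A /\ ?B => let f := reify A l in let g := reify B l in constr:(Conj f g)
  | ?A \/ ?B => let f := reify A l in let g := reify B l in constr:(Disj f g)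
  | ?A <-> ?B => let f := reify A l in let g := reify B l in
                constr:(Conj (Impl f g) (Impl g f))
  | ~ ?A => let f := reify A l in constr:(Impl f Falsity)
  | ?A -> ?B => let f := reify A l in let g := reify B l in constr:(Impl f g)
  | True => constr:(Truth)
  | False => constr:(Falsity)
  | _ => let n := position P l in constr:(Atom n)
  end.

Ltac atoms :=
  cbv beta;
  match goal with
  | |- ?P =>
      let l := collect P (@nil Prop) in
      let f := reify P l in
      change (denote l f); apply: tautologyP; vm_cast_no_check (erefl true)
  end.

(** * Calculus of exchanges: cones, gluing and replacement *)

Section Calculus.
Variable R : realType.

Definition lhs (B : {fset U}) (G L : cpx) : cpx :=
  fun s => G s /\ (~ (B `<=` s) /\ L s).

Definition rhs (A : {fset U}) (G L dL : cpx) : cpx :=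
  fun s => G s /\ ((~ (A `<=` s) /\ L s) \/ dL s).

(** [G] is the remaining join factor together with all faces on [S], [A] and [B]. Cylinders are
    infinite complexes; boundedness of [G] is what makes both sides of an exchange finite. *)
Definition frame (S A B : {fset U}) (G : cpx) : Prop :=
  [/\ down G, bounded G, independent (S `|` A `|` B) G,
      forall u, u \in A -> u \notin B &
      forall u, u \in S -> u \notin A /\ u \notin B].

(* In terms of joins [lhs B G L] is [A * dB * G * L] and [rhs A G L dL] is
   [B * dA * G * L + A * B * G * dL]; both contain all of [A] and [B] as
   vertices, which is why a face condition only forbids [B] or [A]. *)
Definition exchange (L dL : cpx) (A B : {fset U}) (G : cpx) : Prop :=
  PLrel R (fun s => lhs B G L s /\ rhs A G L dL s) (lhs B G L) (rhs A G L dL).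

Record bordered (S : {fset U}) (L dL : cpx) : Prop := Bordered {
  bordered_down : down L;
  border_down : down dL;
  bordered_cylinder : cylinder S L;
  border_cylinder : cylinder S dL;
  border_sub : forall s, dL s -> L s }.

(** With [A] nonempty only cones over [L] are tested. This holds for spheres as well as for balls,
    and it is what makes the cone over [L] a ball in [ball_cone]. *)
Definition cone_ball (S : {fset U}) (L dL : cpx) : Prop :=
  bordered S L dL /\ forall A B G, frame S A B G -> A != fset0 -> B != fset0 ->
    exchange L dL A B G.

(** Here [A] may be empty, and then [dB * G * L] is exchanged for [B * G * dL]. For a single vertex
    [B] this replaces [L] by the cone over its border. *)
Definition ball (S : {fset U}) (L dL : cpx) : Prop :=
  bordered S L dL /\ forall A B G, frame S A B G -> B != fset0 ->
    exchange L dL A B G.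

Lemma ball_cone_ball S L dL : ball S L dL -> cone_ball S L dL.
Proof. by move=> [LS H]; split=> // A B G f _; exact: H. Qed.

Lemma lhs_down B G L : down G -> down L -> down (lhs B G L).
Proof. by move=> ? ?; rewrite /lhs; down_tac. Qed.

Lemma rhs_down A G L dL : down G -> down L -> down dL -> down (rhs A G L dL).
Proof. by move=> ? ? ?; rewrite /rhs; down_tac. Qed.

Lemma fresh_vertex (G : cpx) (A B : {fset U}) : bounded G ->
  exists x : U, [/\ x \notin A, x \notin B & forall s, G s -> x \notin s].
Proof.
move=> [m Gm]; have [a Aa] := fset_bound A; have [b Bb] := fset_bound B.
exists (maxn m (maxn a b), false); split.
- by apply/negP => /Aa /=; lia.
- by apply/negP => /Bb /=; lia.
- by move=> s Gs; apply/negP => /(Gm _ Gs) /=; lia.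
Qed.

(** With an empty border the exchange is one flip of [A] and [B] joined with [L], so that [L] may be
    any complex. *)
Lemma cone_ball_closed S L : down L -> cylinder S L -> cone_ball S L (fun=> False).
Proof.
move=> Ld LS; split; first by split.
move=> A B G [Gd Gb GI AB SAB] A0 B0 K Kd Kb KX KY.
(* If [K] had a face containing [A], then [A] would be a common face of [K] and the left side, hence
   a face of the border; but the right side has no face containing [A]. The argument for [B] is
   symmetric. *)
have AK s : lhs B G L fset0 -> K s -> ~ (A `<=` s).
  move=> [G0 [_ L0]] Ks As.
  have KA : K A by exact: Kd Ks As.
  have [] := KX A A0 KA; last by move=> _ [_ [[] |//]]; rewrite fsubset_refl.
  split; first by apply: GI G0 => u; rewrite !inE !negb_or => /andP[/andP[_ /negbTE ->]].
  split; last by apply: LS L0 => u /SAB[/negbTE -> _]; rewrite inE.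
  move=> BA; have /fset0Pn[u uB] := B0.
  by have /AB := fsubsetP BA u uB; rewrite uB.
have BK s : lhs B G L fset0 -> K s -> ~ (B `<=` s).
  move=> [G0 [_ L0]] Ks Bs.
  have KB : K B by exact: Kd Ks Bs.
  have [|] := KY B B0 KB; last by move=> [_ []]; rewrite fsubset_refl.
  split; first by apply: GI G0 => u; rewrite !inE !negb_or => /andP[_ /negbTE ->].
  left; split; last by apply: LS L0 => u /SAB[_ /negbTE ->]; rewrite inE.
  move=> AB'; have /fset0Pn[u uA] := A0.
  by have := AB u uA; rewrite (fsubsetP AB').
have X0 s : lhs B G L s -> lhs B G L fset0.
  by move=> Xs; have Xd : down (lhs B G L) by [exact: lhs_down]; apply: Xd Xs _; exact: fsub0set.
have Y0 s : rhs A G L (fun=> False) s -> lhs B G L fset0.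
  move=> [Gs [[_ Ls]|//]]; split; first by apply: Gd Gs _; exact: fsub0set.
  split; last by apply: Ld Ls _; exact: fsub0set.
  by rewrite fsubset0; apply/negP.
have [H0|H0] := EM (lhs B G L fset0); last first.
  have -> : cup K (lhs B G L) = cup K (rhs A G L (fun=> False)).
    apply: cpx_ext => s; split=> -[Ks|Xs]; try (by left).
      by case: H0; exact: X0 Xs.
    by case: H0; exact: Y0 Xs.
  apply: PLh_refl; first by apply: down_cup => //; exact: rhs_down.
  by apply: bounded_cup => //; apply: bounded_sub Gb _ => s [].
apply: (@PLh_flip R A B) => //.
- by apply/fdisjointP.
- by apply: down_cup => //; exact: lhs_down.
- by apply: down_cup => //; exact: rhs_down.
- by apply: bounded_cup => //; apply: bounded_sub Gb _ => s [].
- by apply: bounded_cup => //; apply: bounded_sub Gb _ => s [].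
- by move=> s [Ks|[_ [Bs _]]]; apply/negP => //; exact: BK.
- by move=> s [Ks|[_ [[As _]|//]]]; apply/negP => //; exact: AK.
- by move=> s [Ks|[Gs [Bs Ls]]] /negP As; [left|right; split=> //; left].
- by move=> s [Ks|[Gs [[As Ls]|//]]] /negP Bs; [left|right].
- move=> s t [Ks As|[Gs [Bs Ls]] As tA At]; first by case: (AK s).
  right; split.
    apply: GI Gs => u; rewrite !inE !negb_or => /andP[/andP[_ /negbTE uA] /negbTE ->].
    by rewrite uA orbF /=; case: (boolP (u \in t)) => [/(fsubsetP tA)|]; rewrite ?uA ?orbF.
  left; split; last first.
    apply: LS Ls => u /SAB[/negbTE uA /negbTE uB]; rewrite !inE uA uB orbF /=.
    by case: (boolP (u \in t)) => [/(fsubsetP tA)|]; rewrite ?uA ?orbF.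
  move=> As'; case/negP: At; apply/fsubsetP => u uA.
  by have := fsubsetP As' u uA; rewrite !inE uA /= (negbTE (AB u uA)) orbF.
- move=> s t [Ks Bs|[Gs [[As Ls]|//]] Bs tB Bt]; first by case: (BK s).
  right; split.
    apply: GI Gs => u; rewrite !inE !negb_or => /andP[/andP[_ /negbTE uA] /negbTE uB].
    by rewrite uA uB orbF /=; case: (boolP (u \in t)) => [/(fsubsetP tB)|]; rewrite ?uB ?orbF.
  split; last first.
    apply: LS Ls => u /SAB[/negbTE uA /negbTE uB]; rewrite !inE uA uB orbF /=.
    by case: (boolP (u \in t)) => [/(fsubsetP tB)|]; rewrite ?uB ?orbF.
  move=> Bs'; case/negP: Bt; apply/fsubsetP => u uB.
  have := fsubsetP Bs' u uB; rewrite !inE uB /=.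
  by case: (boolP (u \in A)) => [/AB|]; rewrite ?uB ?orbF.
Qed.

Lemma cone_ball_ext S L dL L' dL' : (forall s, L s <-> L' s) ->
  (forall s, dL s <-> dL' s) -> cone_ball S L dL -> cone_ball S L' dL'.
Proof. by move=> /cpx_ext -> /cpx_ext ->. Qed.

Lemma ball_ext S L dL L' dL' : (forall s, L s <-> L' s) ->
  (forall s, dL s <-> dL' s) -> ball S L dL -> ball S L' dL'.
Proof. by move=> /cpx_ext -> /cpx_ext ->. Qed.

Lemma cylinderU1 S u L : cylinder S L -> cylinder (u |` S) L.
Proof. by move=> LS s t st; apply: LS => v vS; apply: st; rewrite !inE vS orbT. Qed.

Lemma cylinder_notin S u L : cylinder S L ->
  cylinder (u |` S) (fun s => ~ (u \in s) /\ L s).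
Proof.
move=> LS s t st [us Ls]; split; first by rewrite -st // !inE eqxx.
by apply: LS Ls => v vS; apply: st; rewrite !inE vS orbT.
Qed.

Lemma cylinder_or S (L L' : cpx) : cylinder S L -> cylinder S L' ->
  cylinder S (fun s => L s \/ L' s).
Proof. by move=> LS LS' s t st [/(LS _ _ st)|/(LS' _ _ st)] ?; [left|right]. Qed.

Lemma independent_sub (Q Q' : {fset U}) (G : cpx) : {subset Q' <= Q} ->
  independent Q G -> independent Q' G.
Proof.
move=> QQ' GQ s t st; apply: GQ => u uQ; apply: st.
by apply: contra uQ; apply: QQ'.
Qed.

Lemma independent_and (Q : {fset U}) (G G' : cpx) : independent Q G ->
  independent Q G' -> independent Q (fun s => G s /\ G' s).
Proof. by move=> GQ GQ' s t st [/(GQ _ _ st) ? /(GQ' _ _ st)]. Qed.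

Lemma independent_nsub (Q B : {fset U}) : (forall u, u \in B -> u \notin Q) ->
  independent Q (fun s => ~ (B `<=` s)).
Proof.
move=> BQ s t st Bs Bt; apply: Bs; apply/fsubsetP => u uB.
by rewrite st ?BQ //; apply: (fsubsetP Bt).
Qed.

Lemma frame_notin S A B u G : u \notin S -> frame (u |` S) A B G ->
  frame S A B (fun s => G s /\ ~ (u \in s)).
Proof.
move=> uS [Gd Gb GI AB SAB]; split=> //.
- by down_tac.
- by apply: bounded_sub Gb _ => s [].
- apply: independent_and.
    by apply: independent_sub GI => v; rewrite !inE -!orbA orbCA => ->; rewrite !orbT.
  have [uA uB] : u \notin A /\ u \notin B by apply: SAB; rewrite !inE eqxx.
  by move=> s t st; rewrite st // !inE !negb_or uS uA uB.
- by move=> v vS; apply: SAB; rewrite !inE vS orbT.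
Qed.

Lemma frame_addA S A B u G : u \notin S -> frame (u |` S) A B G -> frame S (u |` A) B G.
Proof.
move=> uS [Gd Gb GI AB SAB].
have [uA uB] : u \notin A /\ u \notin B by apply: SAB; rewrite !inE eqxx.
split=> //.
- by apply: independent_sub GI => v; rewrite !inE -!orbA orbCA.
- by move=> v; rewrite !inE => /orP[/eqP ->|/AB].
- move=> v vS; have vS' : v \in u |` S by rewrite !inE vS orbT.
  have [vA vB] := SAB v vS'; split=> //; rewrite !inE negb_or vA andbT.
  by apply: contraNneq uS => <-.
Qed.

Lemma frame_sym S A B G : frame S A B G -> frame S B A G.
Proof.
move=> [Gd Gb GI AB SAB]; split=> //.
- by apply: independent_sub GI => v; rewrite !inE -!orbA [in X in _ || X]orbC.
- by move=> v vB; apply/negP => /AB; rewrite vB.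
- by move=> v /SAB[].
Qed.

Lemma frame_addB S A B u G : u \notin S -> frame (u |` S) A B G -> frame S A (u |` B) G.
Proof. by move=> uS /frame_sym f; apply: frame_sym; apply: frame_addA. Qed.

Lemma frame_nsub S A B G : frame S A B G ->
  frame S A fset0 (fun s => G s /\ ~ (B `<=` s)).
Proof.
move=> [Gd Gb GI AB SAB]; split=> //.
- by down_tac.
- by apply: bounded_sub Gb _ => s [].
- apply: independent_and.
    by apply: independent_sub GI => v; rewrite !inE orbF => ->.
  apply: independent_nsub => u uB; rewrite !inE orbF negb_or.
  by apply/andP; split; apply/negP; [move=> /SAB[_]|move=> /AB]; rewrite uB.
- by move=> v /SAB[-> _]; rewrite inE.
Qed.

Lemma frame_fresh S A G x : x \notin S -> x \notin A -> frame S A fset0 G ->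
  [/\ frame S A [fset x] (fun s => G (s `\ x)),
      frame S fset0 [fset x] (fun s => G (s `\ x) /\ ~ (A `<=` s)) &
      frame S fset0 (x |` A) (fun s => G (s `\ x))].
Proof.
move=> xS xA [Gd Gb GI _ SA].
have Gxd : down (fun s => G (s `\ x)) by exact: down_del.
have Gxb : bounded (fun s => G (s `\ x)) by exact: bounded_del.
have GxI Q : {subset Q <= S `|` A `|` [fset x]} -> independent Q (fun s => G (s `\ x)).
  move=> QS s t st; apply: GI => u; rewrite !inE orbF negb_or => /andP[uS uA].
  have [//|ux] := eqVneq u x; apply: st; apply/negP => /QS.
  by rewrite !inE (negbTE uS) (negbTE uA) (negbTE ux).
have fA : frame S A [fset x] (fun s => G (s `\ x)).
  split=> //; first exact: GxI.
  - by move=> u uA; rewrite inE; apply: contraNneq xA => <-.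
  - move=> u uS; have [uA _] := SA u uS; split=> //.
    by rewrite inE; apply: contraNneq xS => <-.
split=> //; last first.
  split=> //.
  - by apply: GxI => u; rewrite !inE orbF orbCA orbC.
  - move=> u uS; have [uA _] := SA u uS; split; first by rewrite inE.
    by rewrite !inE negb_or uA andbT; apply: contraNneq xS => <-.
split=> //.
- by down_tac.
- by apply: bounded_sub Gxb _ => s [].
- apply: independent_and; first by apply: GxI => u; rewrite !inE orbF => /orP[] ->; rewrite ?orbT.
  apply: independent_nsub => u uA; rewrite !inE orbF negb_or; apply/andP; split.
    by apply/negP => /SA[]; rewrite uA.
  by apply: contraNneq xA => <-.
- move=> u uS; split; first by rewrite inE.
  by rewrite inE; apply: contraNneq xS => <-.
Qed.

Lemma ball_cone S u L dL : u \notin S -> cone_ball S L dL ->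
  ball (u |` S) L (fun s => (~ (u \in s) /\ L s) \/ dL s).
Proof.
move=> uS [[Ld dLd LS dLS dLL] H]; split.
  split; [by []|by down_tac|exact: cylinderU1| |by move=> s; move: (dLL s); atoms].
  by apply: cylinder_or; [exact: cylinder_notin|exact: cylinderU1].
move=> A B G [Gd Gb GI AB SAB] B0.
have [uA uB] : u \notin A /\ u \notin B by apply: SAB; rewrite !inE eqxx.
have fr : frame S (u |` A) B G by exact: frame_addA.
have uA0 : u |` A != fset0 by apply/fset0Pn; exists u; rewrite !inE eqxx.
have := H _ _ _ fr uA0 B0.
rewrite /exchange.
suff -> : rhs (u |` A) G L dL = rhs A G L (fun s => (~ (u \in s) /\ L s) \/ dL s) by [].
apply: cpx_ext => s; rewrite /rhs; move: (dLL s) (subU1P u A s); atoms.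
Qed.

Lemma exchange_push S u L1 dL1 T dT C A B G : u \notin S ->
  bordered S L1 dL1 -> bordered S T dT -> down C ->
  (forall s, dL1 s <-> T s \/ C s) -> (forall s, T s -> C s -> dT s) ->
  frame (u |` S) A B G ->
  exchange L1 dL1 A B (fun s => G s /\ ~ (u \in s)) ->
  exchange T dT A (u |` B) G ->
  exchange (fun s => (~ (u \in s) /\ L1 s) \/ T s)
           (fun s => (~ (u \in s) /\ C s) \/ dT s) A B G.
Proof.
move=> uS [L1d dL1d _ _ dL1L] [Td dTd _ _ dTT] Cd dL1E TC fr ex1 ex2.
have [Gd Gb _ _ _] := fr.
have facts (s : {fset U}) := conj (dL1L s) (conj (dL1E s) (conj (TC s) (conj (dTT s) (subU1P u B s)))).
pose mid s := (G s /\ (~ (B `<=` s) /\ T s)) \/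
  ((G s /\ ~ (u \in s)) /\ ((~ (A `<=` s) /\ L1 s) \/ (T s \/ C s))).
apply: (@PLrel_trans R _ _ mid).
- by rewrite /lhs; down_tac.
- by rewrite /mid; down_tac.
- by rewrite /rhs; down_tac.
- by apply: bounded_sub Gb _ => s [].
- by apply: bounded_sub Gb _ => s [[]|[[]]].
- by apply: bounded_sub Gb _ => s [].
{ apply: (PLrel_step (E := fun s => G s /\ (~ (B `<=` s) /\ T s))) ex1.
  1: by down_tac.
  1: by apply: bounded_sub Gb _ => s [].
  all: by move=> s; move: (facts s); rewrite /lhs /rhs /mid; atoms. }
apply: (PLrel_step (E := fun s => (G s /\ ~ (u \in s)) /\ ((~ (A `<=` s) /\ L1 s) \/ C s))) ex2.
1: by down_tac.
1: by apply: bounded_sub Gb _ => s [[]].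
all: by move=> s; move: (facts s); rewrite /lhs /rhs /mid; atoms.
Qed.

Lemma bordered_push S u L1 dL1 T dT C : bordered S L1 dL1 -> bordered S T dT ->
  down C -> cylinder S C -> (forall s, dL1 s <-> T s \/ C s) ->
  bordered (u |` S) (fun s => (~ (u \in s) /\ L1 s) \/ T s)
           (fun s => (~ (u \in s) /\ C s) \/ dT s).
Proof.
move=> [L1d dL1d L1S dL1S dL1L] [Td dTd TS dTS dTT] Cd CS dL1E; split.
- by down_tac.
- by down_tac.
- by apply: cylinder_or; [exact: cylinder_notin|exact: cylinderU1].
- by apply: cylinder_or; [exact: cylinder_notin|exact: cylinderU1].
by move=> s; move: (dL1L s) (dL1E s) (dTT s); atoms.
Qed.

Lemma cone_ball_push S u L1 dL1 T dT C : u \notin S -> down C -> cylinder S C ->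
  (forall s, dL1 s <-> T s \/ C s) -> (forall s, T s -> C s -> dT s) ->
  cone_ball S L1 dL1 -> cone_ball S T dT ->
  cone_ball (u |` S) (fun s => (~ (u \in s) /\ L1 s) \/ T s)
                     (fun s => (~ (u \in s) /\ C s) \/ dT s).
Proof.
move=> uS Cd CS dE TC [Lb HL] [Tb HT]; split; first exact: bordered_push dE.
move=> A B G fr A0 B0; apply: (@exchange_push S u L1 dL1) => //.
  by apply: HL => //; exact: frame_notin.
apply: HT => //; first exact: frame_addB.
by apply/fset0Pn; exists u; rewrite !inE eqxx.
Qed.

Lemma ball_push S u L1 dL1 T dT C : u \notin S -> down C -> cylinder S C ->
  (forall s, dL1 s <-> T s \/ C s) -> (forall s, T s -> C s -> dT s) ->
  ball S L1 dL1 -> ball S T dT ->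
  ball (u |` S) (fun s => (~ (u \in s) /\ L1 s) \/ T s)
                (fun s => (~ (u \in s) /\ C s) \/ dT s).
Proof.
move=> uS Cd CS dE TC [Lb HL] [Tb HT]; split; first exact: bordered_push dE.
move=> A B G fr B0; apply: (@exchange_push S u L1 dL1) => //.
  by apply: HL => //; exact: frame_notin.
apply: HT => //; first exact: frame_addB.
by apply/fset0Pn; exists u; rewrite !inE eqxx.
Qed.

(* Both sides are filled by the cone over the common boundary with apex a
   scratch vertex [x]. *)
Lemma PLrel_split S A G D1 dD1 Y dY Q : frame S A fset0 G -> A != fset0 ->
  ball S D1 dD1 -> ball S Y dY -> cone_ball S Q dY ->
  (forall s, dD1 s <-> Y s \/ Q s) -> (forall s, Q s -> Y s -> dY s) ->
  PLrel R (fun s => G s /\ ((~ (A `<=` s) /\ Q s) \/ dY s))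
    (fun s => G s /\ Q s)
    (fun s => G s /\ ((~ (A `<=` s) /\ D1 s) \/ Y s)).
Proof.
move=> fr A0 [[D1d dD1d _ _ dD1D] HD] [[Yd dYd _ _ dYY] HY] [[Qd _ _ _ dYQ] HQ] dE QY.
have [Gd Gb _ _ _] := fr.
have [x [xS xA xG]] := fresh_vertex S A Gb.
have [f1 f2 f3] := frame_fresh xS xA fr.
have x0 : [fset x] != fset0 by apply/fset0Pn; exists x; rewrite inE.
have xA0 : x |` A != fset0 by apply/fset0Pn; exists x; rewrite !inE eqxx.
set Gx := fun s => G (s `\ x) in f1 f2 f3.
have GE s : G s <-> Gx s /\ ~ (x \in s).
  split=> [Gs|[Gs xs]].
    by split; [apply: Gd Gs _; exact: fsubD1set|apply/negP; exact: xG].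
  by move: Gs; rewrite /Gx mem_fsetD1 //; apply/negP.
have Gxd : down Gx by exact: down_del.
have Gxb : bounded Gx by exact: bounded_del.
have e1 := HQ _ _ _ f1 A0 x0.
have e2 := HD _ _ _ f2 x0.
have e3 := HY _ _ _ f3 xA0.
have facts (s : {fset U}) := conj (GE s) (conj (dYQ s) (conj (dE s) (conj (dYY s) (conj (dD1D s)
  (conj (QY s) (conj (sub1P x s) (conj (subU1P x A s) (sub0P s)))))))).
pose P1 s := Gx s /\ ((~ (A `<=` s) /\ Q s) \/ dY s).
pose P2 s := (G s /\ Y s) \/ ((Gx s /\ ~ (A `<=` s)) /\ dD1 s).
apply: (@PLrel_trans R _ _ P1); try by [down_tac|rewrite /P1; down_tac].
- by apply: bounded_sub Gb _ => s [].
- by apply: bounded_sub Gxb _ => s [].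
- by apply: bounded_sub Gb _ => s [].
{ apply: (PLrel_step (E := fun=> False)) e1.
  1: by move=> s t.
  1: by exists 0%N.
  all: by move=> s; move: (facts s); rewrite /lhs /rhs /P1 /P2 /Gx; atoms. }
apply: PLrel_sym; apply: (@PLrel_trans R _ _ P2); try by [down_tac|rewrite /P1 /P2; down_tac].
- by apply: bounded_sub Gb _ => s [].
- by apply: bounded_sub (bounded_cup Gb Gxb) _ => s [[]|[[]]]; [left|right].
- by apply: bounded_sub Gxb _ => s [].
{ apply: (PLrel_step (E := fun s => G s /\ Y s)) e2.
  1: by down_tac.
  1: by apply: bounded_sub Gb _ => s [].
  all: by move=> s; move: (facts s); rewrite /lhs /rhs /P1 /P2 /Gx; atoms. }
apply: (PLrel_step (E := fun s => (Gx s /\ ~ (A `<=` s)) /\ Q s)) e3.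
1: by down_tac.
1: by apply: bounded_sub Gxb _ => s [[]].
all: by move=> s; move: (facts s); rewrite /lhs /rhs /P1 /P2 /Gx; atoms.
Qed.

(* [D = M + D1] is a ball whose part [D1] touches the boundary of [D] along [Y].
   Replacing [D1] by the cone over the rest [Q] of its boundary is done by
   attaching cells only, which avoids Newman's theorem on complements. *)
Lemma cone_ball_replace S u D dD D1 dD1 Y dY Q M C : u \notin S ->
  down M -> cylinder S M -> down C -> cylinder S C ->
  (forall s, D s <-> M s \/ D1 s) -> (forall s, dD s <-> Y s \/ C s) ->
  (forall s, dD1 s <-> Y s \/ Q s) ->
  (forall s, M s -> D1 s -> Q s) -> (forall s, C s -> D1 s -> Q s) ->
  (forall s, C s -> Y s -> dY s) -> (forall s, Q s -> Y s -> dY s) ->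
  cone_ball S D dD -> ball S D1 dD1 -> ball S Y dY -> cone_ball S Q dY ->
  cone_ball (u |` S) (fun s => (~ (u \in s) /\ M s) \/ Q s)
                     (fun s => (~ (u \in s) /\ C s) \/ dY s).
Proof.
move=> uS Md MS Cd CS DE dDE dD1E MD1 CD1 CY QY ballD ballD1 ballY ballQ.
have [[Dd dDd DS dDS dDD] HD] := ballD.
have [[D1d dD1d D1S dD1S dD1D] _] := ballD1.
have [[Yd dYd YS dYS dYY] HY] := ballY.
have [[Qd _ QS _ dYQ] _] := ballQ.
split.
  split; try by down_tac.
  - by apply: cylinder_or; [exact: cylinder_notin|exact: cylinderU1].
  - by apply: cylinder_or; [exact: cylinder_notin|exact: cylinderU1].
  by move=> s; move: (DE s) (dDE s) (dYQ s) (dDD s) (MD1 s) (CD1 s); atoms.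
move=> A B G fr A0 B0; have [Gd Gb GI AB SAB] := fr.
have uA0 : u |` A != fset0 by apply/fset0Pn; exists u; rewrite !inE eqxx.
have uB0 : u |` B != fset0 by apply/fset0Pn; exists u; rewrite !inE eqxx.
have facts (s : {fset U}) := conj (DE s) (conj (dDE s) (conj (dD1E s) (conj (MD1 s)
  (conj (CD1 s) (conj (CY s) (conj (QY s) (conj (dDD s) (conj (dD1D s) (conj (dYY s)
  (conj (dYQ s) (conj (subU1P u A s) (subU1P u B s)))))))))))).
have e1 := PLrel_split (frame_nsub (frame_addA uS fr)) uA0 ballD1 ballY ballQ dD1E QY.
have e2 := HD _ _ _ (frame_notin uS fr) A0 B0.
have e3 := HY _ _ _ (frame_addB uS fr) uB0.
have e4 := PLrel_split (frame_nsub (frame_addA uS (frame_sym fr))) uB0 ballD1 ballY ballQ dD1E QY.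
pose m1 s := (G s /\ ~ (B `<=` s)) /\
  ((~ (u \in s) /\ M s) \/ ((~ (u |` A `<=` s) /\ D1 s) \/ Y s)).
pose m2 s := ((G s /\ ~ (B `<=` s)) /\ ((~ (A `<=` s) /\ D1 s) \/ Y s)) \/
  rhs A (fun s => G s /\ ~ (u \in s)) D dD s.
(* The cells [A * d(u |] B) * Y[in]m2[have been exchanged. What is left over]dA[is]d(u |[B) * D1]
   with [u * B * Y], which the split used for [m1], with [A] and [B] interchanged and read
   backwards, closes up to [u * B * Q]. *)
pose m3 s := ((G s /\ ~ (u \in s)) /\ ((~ (A `<=` s) /\ D s) \/ C s)) \/
  (G s /\ ((~ (A `<=` s) /\ (Y s \/ (~ (B `<=` s) /\ D1 s))) \/ dY s)).
apply: (@PLrel_trans R _ _ m1); rewrite /lhs /rhs /m1.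
- by down_tac.
- by down_tac.
- by down_tac.
- by apply: bounded_sub Gb _ => s [].
- by apply: bounded_sub Gb _ => s [[]].
- by apply: bounded_sub Gb _ => s [].
{ apply: (PLrel_step (E := fun s => (G s /\ ~ (B `<=` s)) /\ (~ (u \in s) /\ M s))) e1.
  1: by down_tac.
  1: by apply: bounded_sub Gb _ => s [[]].
  all: by move=> s; move: (facts s); atoms. }
apply: (@PLrel_trans R _ _ m2); rewrite /m2 /rhs.
- by down_tac.
- by down_tac.
- by down_tac.
- by apply: bounded_sub Gb _ => s [[]].
- by apply: bounded_sub Gb _ => s [[[]]|[[]]].
- by apply: bounded_sub Gb _ => s [].
{ apply: (PLrel_step (E := fun s => (G s /\ ~ (B `<=` s)) /\ ((~ (A `<=` s) /\ D1 s) \/ Y s))) e2.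
  1: by down_tac.
  1: by apply: bounded_sub Gb _ => s [[]].
  all: by move=> s; move: (facts s); rewrite /lhs /rhs; atoms. }
apply: (@PLrel_trans R _ _ m3); rewrite /m3.
- by down_tac.
- by down_tac.
- by down_tac.
- by apply: bounded_sub Gb _ => s [[[]]|[[]]].
- by apply: bounded_sub Gb _ => s [[[]]|[]].
- by apply: bounded_sub Gb _ => s [].
{ apply: (PLrel_step (E := fun s =>
     ((G s /\ ~ (u \in s)) /\ ((~ (A `<=` s) /\ D s) \/ C s)) \/
     ((G s /\ ~ (B `<=` s)) /\ (~ (A `<=` s) /\ D1 s)))) e3.
  1: by down_tac.
  1: by apply: bounded_sub Gb _ => s [[[]]|[[]]].
  all: by move=> s; move: (facts s); rewrite /lhs /rhs; atoms. }
apply: (PLrel_step (E := fun s =>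
  ((G s /\ ~ (u \in s)) /\ ((~ (A `<=` s) /\ M s) \/ C s)) \/ (G s /\ dY s))) (PLrel_sym e4).
1: by down_tac.
1: by apply: bounded_sub Gb _ => s [[[]]|[]].
all: by move=> s; move: (facts s); atoms.
Qed.

Lemma exchange_notin u L dL A B G :
  exchange (fun s => L s /\ ~ (u \in s)) (fun s => dL s /\ ~ (u \in s)) A B G =
  exchange L dL A B (fun s => G s /\ ~ (u \in s)).
Proof.
rewrite /exchange.
have -> : lhs B G (fun s => L s /\ ~ (u \in s)) = lhs B (fun s => G s /\ ~ (u \in s)) L.
  by apply: cpx_ext => s; rewrite /lhs; atoms.
have -> : rhs A G (fun s => L s /\ ~ (u \in s)) (fun s => dL s /\ ~ (u \in s)) =
    rhs A (fun s => G s /\ ~ (u \in s)) L dL.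
  by apply: cpx_ext => s; rewrite /rhs; atoms.
by [].
Qed.

Lemma bordered_notin S u L dL : bordered S L dL ->
  bordered (u |` S) (fun s => L s /\ ~ (u \in s)) (fun s => dL s /\ ~ (u \in s)).
Proof.
move=> [Ld dLd LS dLS dLL].
have swap (P : cpx) : (fun s => P s /\ ~ (u \in s)) = (fun s => ~ (u \in s) /\ P s).
  by apply: cpx_ext => s; atoms.
split; try by down_tac.
- by rewrite swap; exact: cylinder_notin.
- by rewrite swap; exact: cylinder_notin.
by move=> s [/dLL].
Qed.

Lemma cone_ball_notin S u L dL : u \notin S -> cone_ball S L dL ->
  cone_ball (u |` S) (fun s => L s /\ ~ (u \in s)) (fun s => dL s /\ ~ (u \in s)).
Proof.
move=> uS [Lb H]; split; first exact: bordered_notin.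
by move=> A B G fr A0 B0; rewrite exchange_notin; apply: H => //; exact: frame_notin.
Qed.

Lemma ball_notin S u L dL : u \notin S -> ball S L dL ->
  ball (u |` S) (fun s => L s /\ ~ (u \in s)) (fun s => dL s /\ ~ (u \in s)).
Proof.
move=> uS [Lb H]; split; first exact: bordered_notin.
by move=> A B G fr B0; rewrite exchange_notin; apply: H => //; exact: frame_notin.
Qed.

End Calculus.

(** * The Novik-Zheng complexes *)

Local Open Scope nat_scope.

Definition facets : Type := {fset U} -> bool.

(* The complex with facets [(n, s) * X], [(n, ~~ s) * Y] and [M]. *)
Definition cone2 (n : nat) (s : bool) (X Y M : facets) : facets := fun F =>
  if (n, s) \in F then X (F `\ (n, s))
  else if (n, ~~ s) \in F then Y (F `\ (n, ~~ s)) else M F.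

Definition noF : facets := fun=> false.

(* The balls [nzB] and spheres [nzZ] of Novik and Zheng on the indices below [n],
   up to the antipode [s].  The facets of [nzB n s l j] have [2 * j + l - 2]
   vertices; [nzZ n s l j] is the boundary of [nzB n s l j] if
   [2 * j + l <= n + 2], and the cross-polytope if [2 * j + l = n + 3].  In
   their notation [j] is [i + 1], and [l] is the excess of the dimension over
   the smallest one for which the construction makes sense. *)
Fixpoint nz (n : nat) : (bool -> nat -> nat -> facets) * (bool -> nat -> nat -> facets) :=
  if n is m.+1 then
    let B := (nz m).1 in
    let Z := (nz m).2 in
    let B' s l j := if j is i.+1 then cone2 m s (B s l j) (B (~~ s) l.+2 i) noF else noF in
    let Z' s l j := cone2 m s (Z s l j) (Z (~~ s) (if j is 0 then l else l.+2) j.-1)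
      (fun F => B s l j F && ~~ B (~~ s) l.+2 j.-1 F) in
    ((fun s l j => if l is k.+1 then B' s k j else
        fun F => [&& 0 < j, Z' s 0 j F & ~~ B' s 1 j.-1 F]),
     (fun s l j => if l is k.+1 then Z' s k j else Z' s 1 j.-1))
  else
    ((fun s l j F => [&& F == fset0, l == 0 & j == 1]),
     (fun s l j F => (F == fset0) && (2 * j + l == 3))).

Definition nzB (n : nat) : bool -> nat -> nat -> facets := (nz n).1.
Definition nzZ (n : nat) : bool -> nat -> nat -> facets := (nz n).2.

Lemma nzB_S n s l j : nzB n.+1 s l.+1 j.+1 =
  cone2 n s (nzB n s l j.+1) (nzB n (~~ s) l.+2 j) noF.
Proof. by []. Qed.

(** Both cones have the same value of [2 * j + l]. For [j = 0] there is no pair with smaller second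
    index, and keeping [l] makes the recursion valid for cross-polytopes too. *)
Lemma nzZ_S n s l j : nzZ n.+1 s l.+1 j =
  cone2 n s (nzZ n s l j) (nzZ n (~~ s) (if j is 0 then l else l.+2) j.-1)
    (fun F => nzB n s l j F && ~~ nzB n (~~ s) l.+2 j.-1 F).
Proof. by []. Qed.

Lemma nzB_j0 n s l F : nzB n s l 0 F = false.
Proof. by case: n => [|n]; [rewrite /nzB /= !andbF|case: l]. Qed.

(** The balls with parameters [(0, j)] and [(2, j.-1)] are complementary in the sphere with
    parameters [(1, j)], so they share their border. *)
Lemma nzZ_0 n s j : nzZ n s 0 j = nzZ n s 2 j.-1.
Proof.
case: n => [|n] //; apply/funext => F; rewrite /nzZ /=; congr (_ && _).
by apply/eqP/eqP; lia.
Qed.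

Lemma nzB_0 n s j F : nzB n s 0 j F = [&& 0 < j, nzZ n s 1 j F & ~~ nzB n s 2 j.-1 F].
Proof.
case: n => [|n] //; rewrite /nzB /nzZ /=.
case: (F == fset0) => /=; last by rewrite andbF.
by rewrite andbT; apply/eqP/andP => [->|[? /eqP ?]] //; lia.
Qed.

Definition on (n : nat) (X : facets) : Prop := forall F, X F -> F `<=` Vn n.

Lemma on_mem n (X : facets) F u : on n X -> X F -> u \in F -> u.1 < n.
Proof. by move=> Xn /Xn /fsubsetP H /H; rewrite in_Vn. Qed.

Lemma on_top n (X : facets) F s : on n X -> (n, s) \in F -> X F = false.
Proof. by move=> Xn nF; apply/negP => /(on_mem Xn) /(_ nF) /=; rewrite ltnn. Qed.

Lemma Vn_S n s : Vn n.+1 = (n, s) |` ((n, ~~ s) |` Vn n).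
Proof.
apply/fsetP => -[i t]; rewrite !inE !in_Vn /= ltnS leq_eqVlt !xpair_eqE.
by case: (i == n) => //=; case: s; case: t.
Qed.

Lemma sub_Vn_S n F : F `<=` Vn n -> F `<=` Vn n.+1.
Proof. by move=> /fsubset_trans; apply; rewrite (Vn_S n true) fsetUA fsubsetUr. Qed.

Lemma on_cone2 n s X Y M : on n X -> on n Y -> on n M -> on n.+1 (cone2 n s X Y M).
Proof.
move=> Xn Yn Mn F; rewrite /cone2; case: ifP => [nF /Xn|_].
  by rewrite (Vn_S n s) fsubDset fsetUCA => /fsubset_trans; apply; rewrite fsubsetUr.
case: ifP => [nF /Yn|_ /Mn /sub_Vn_S //].
by rewrite (Vn_S n s) fsubDset => /fsubset_trans; apply; rewrite fsubsetUr.
Qed.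

Lemma nz_on n : (forall s l j, on n (nzB n s l j)) /\ (forall s l j, on n (nzZ n s l j)).
Proof.
elim: n => [|n [IB IZ]].
  by split=> s l j F => [/and3P[/eqP -> _ _]|/andP[/eqP -> _]]; exact: fsub0set.
have HZ s l j : on n.+1 (nzZ n.+1 s l.+1 j).
  by rewrite nzZ_S; apply: on_cone2 => // F /andP[/IB].
have HZ' s l j : on n.+1 (nzZ n.+1 s l j) by case: l => // ; rewrite nzZ_0.
split=> // s [|l] [|j] F; rewrite ?nzB_j0 //.
  by rewrite nzB_0 => /and3P[_ /HZ'].
rewrite nzB_S; apply: on_cone2 => //.
Qed.

Lemma nzB_on n s l j : on n (nzB n s l j). Proof. exact: (nz_on n).1. Qed.
Lemma nzZ_on n s l j : on n (nzZ n s l j). Proof. exact: (nz_on n).2. Qed.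

Lemma cone2C n s X Y M F : on n X -> on n Y -> cone2 n (~~ s) X Y M F = cone2 n s Y X M F.
Proof.
move=> Xn Yn; rewrite /cone2 negbK; case: ifP => nF; case: ifP => nF' //.
have ss : (s == ~~ s) = false by case: (s).
have -> : X (F `\ (n, ~~ s)) = false.
  by apply: (on_top (s := s) Xn); rewrite !inE nF' andbT xpair_eqE eqxx ss.
apply/esym/(on_top (s := ~~ s) Yn).
by rewrite !inE nF andbT xpair_eqE eqxx eq_sym ss.
Qed.

Lemma cone2_sub n s (X Y M X' Y' M' : facets) F : (forall F, X F -> X' F) ->
  (forall F, Y F -> Y' F) -> (forall F, M F -> M' F) ->
  cone2 n s X Y M F -> cone2 n s X' Y' M' F.
Proof.
move=> XX YY MM; rewrite /cone2; case: ((n, s) \in F); first exact: XX.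
by case: ((n, ~~ s) \in F); [exact: YY|exact: MM].
Qed.

(** For [l = 1] the recursion is the construction of spheres: a ball and its antipode are removed
    and the two holes are coned off. *)
Lemma nzZ_1 n s j F : nzZ n.+1 s 1 j F =
  cone2 n s (nzZ n s 2 j.-1) (nzZ n (~~ s) 2 j.-1)
   (fun F => [&& 0 < j, nzZ n s 1 j F, ~~ nzB n s 2 j.-1 F & ~~ nzB n (~~ s) 2 j.-1 F]) F.
Proof.
rewrite nzZ_S nzZ_0; have -> : nzZ n (~~ s) (if j is 0 then 0 else 2) j.-1 = nzZ n (~~ s) 2 j.-1.
  by case: j => // ; rewrite nzZ_0.
by rewrite /cone2 nzB_0 -!andbA.
Qed.

Record nz_inclusions (n : nat) : Prop := NzInclusions {
  nzB_opp : forall s l j F, nzB n (~~ s) l.+2 j.-1 F -> nzB n s l j F;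
  nzB_Z : forall s l j F, nzB n s l j F -> nzZ n s l.+1 j F;
  nzB2_Z : forall s l j F, nzB n s l.+2 j.-1 F -> nzZ n s l.+1 j F;
  nzB_disjoint : forall s l j F, nzB n s l j F -> nzB n s l.+2 j.-1 F -> False;
  nzZ_sym : forall s j F, nzZ n (~~ s) 1 j F = nzZ n s 1 j F }.

(** The inclusions support each other: [nzB_opp] for [l = 0] concerns the complement of a ball in a
    sphere, so its step needs the symmetry of the sphere and an inclusion of balls already at
    [n.+1]. *)
Lemma nz_inclusionsP n : nz_inclusions n.
Proof.
elim: n => [|n [P3 P2 P2b Pd PS]].
  split=> //.
  - by move=> s l j F /and3P[].
  - by move=> s l j F /and3P[/eqP -> /eqP -> /eqP ->]; rewrite /nzZ /= eqxx.
  - by move=> s l j F /and3P[].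
  - by move=> s l j F _ /and3P[].
have HS s j F : nzZ n.+1 (~~ s) 1 j F = nzZ n.+1 s 1 j F.
  rewrite !nzZ_1 cone2C; try exact: nzZ_on.
  rewrite negbK /cone2; do 2 case: ifP => // _.
  by rewrite PS; do 2 congr (_ && _); rewrite andbC.
have H2b s l j F : nzB n.+1 s l.+2 j.-1 F -> nzZ n.+1 s l.+1 j F.
  case: j => [|[|j]]; rewrite ?nzB_j0 // nzB_S nzZ_S.
  apply: cone2_sub => // {}F; last exact: (P2b _ l.+1 j.+1).
  by case: l => [|l]; [rewrite nzZ_0; exact: P2|exact: (P2b _ l j.+2)].
have Hd s l j F : nzB n.+1 s l j F -> nzB n.+1 s l.+2 j.-1 F -> False.
  case: l => [|l]; first by rewrite nzB_0 => /and3P[_ _ /negP].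
  case: j => [|[|j]]; rewrite ?nzB_j0 // !nzB_S /cone2.
  by case: ifP => _; [exact: Pd|case: ifP => _; [exact: Pd|]].
have H2 s l j F : nzB n.+1 s l j F -> nzZ n.+1 s l.+1 j F.
  case: l => [|l]; first by rewrite nzB_0 => /and3P[].
  case: j => [|j]; rewrite ?nzB_j0 // nzB_S nzZ_S.
  by apply: cone2_sub => // {}F; exact: P2.
split=> // s [|l] j F.
  move=> BF; rewrite nzB_0; apply/and3P; split; first by case: j BF => //; rewrite nzB_j0.
    by rewrite -HS; exact: H2b.
  apply/negP; case: j BF => [|[|j]]; rewrite ?nzB_j0 // => BF; move: BF.
  rewrite /= !nzB_S cone2C; try exact: nzB_on.
  rewrite negbK /cone2; case: ifP => _; first by move=> b1 b2; exact: Pd b2 b1.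
  by case: ifP => _ //; exact: Pd.
case: j => [|[|j]]; rewrite ?nzB_j0 //= !nzB_S cone2C; try exact: nzB_on.
rewrite negbK; apply: cone2_sub => // {}F.
(* Matching the apexes puts excess [l.+4] below excess [l] with the same sign, which takes two
   applications of the induction hypothesis. *)
by move=> BF; apply: (P3 s l j.+2); apply: (P3 (~~ s) l.+2 j.+1); rewrite negbK.
Qed.

Lemma nz_bound n : (forall s l j F, nzB n s l j F -> 2 * j + l <= n.+2) /\
  (forall s l j F, nzZ n s l j F -> 2 * j + l <= n.+3).
Proof.
elim: n => [|n [IB IZ]].
  by split=> s l j F => [/and3P[_ /eqP -> /eqP ->]|/andP[_ /eqP ->]].
have HZ s l j F : nzZ n.+1 s l.+1 j F -> 2 * j + l.+1 <= n.+4.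
  rewrite nzZ_S /cone2; case: ifP => _; first by move/IZ; lia.
  case: ifP => _; first by move/IZ; case: (j) => [|i] /=; lia.
  by move=> /andP[/IB]; lia.
have HZ' s l j F : nzZ n.+1 s l j F -> 2 * j + l <= n.+4.
  case: l => [|l]; last exact: HZ.
  by rewrite nzZ_0 => /HZ; case: (j) => [|i] /=; lia.
split=> // s [|l] [|j] F; rewrite ?nzB_j0 //.
  by rewrite nzB_0 => /and3P[_ /HZ']; lia.
rewrite nzB_S /cone2; case: ifP => _; first by move/IB; lia.
by case: ifP => _ // /IB; lia.
Qed.

Lemma nzB_bound n s l j F : nzB n s l j F -> 2 * j + l <= n.+2.
Proof. exact: (nz_bound n).1. Qed.

Lemma nzZ_bound n s l j F : nzZ n s l j F -> 2 * j + l <= n.+3.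
Proof. exact: (nz_bound n).2. Qed.

(** * Degrees of ridges *)

Fixpoint cross (n : nat) : facets :=
  if n is m.+1 then cone2 m true (cross m) (cross m) noF else fun F => F == fset0.

Lemma cross_on n : on n (cross n).
Proof. by elim: n => [F /eqP ->|n IH]; [exact: fsub0set|exact: on_cone2]. Qed.

(** At this size all balls in the recursion are empty, so each step is a suspension. *)
Lemma nzZ_cross n s l j : 2 * j + l = n.+3 -> nzZ n s l j = cross n.
Proof.
elim: n s l j => [|n IH] s l j E.
  by apply/funext => F; rewrite /nzZ /= E eqxx andbT.
wlog : l j E / exists l', l = l'.+1.
  move=> H; case: l E => [|l] E; last by apply: H => //; exists l.
  by rewrite nzZ_0; apply: H; [lia|exists 1].
move=> [l' lE]; subst l; rewrite nzZ_S.
rewrite !IH; try by case: (j) E => [|i] /=; lia.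
have -> : (fun F => nzB n s l' j F && ~~ nzB n (~~ s) l'.+2 j.-1 F) = noF.
  by apply/funext => F; apply/negP => /andP[/nzB_bound]; lia.
case: s => //=; apply/funext => F.
by rewrite -[false]/(~~ true) cone2C //; exact: cross_on.
Qed.

Lemma nzZ_j0 n s l F : nzZ n s l 0 F -> l = n.+3.
Proof.
elim: n s l F => [|n IH] s l F; first by rewrite /nzZ /= => /andP[_ /eqP]; lia.
case: l => [|l].
  rewrite nzZ_0 nzZ_S /cone2; case: ifP => [_ /IH //|_].
  by case: ifP => [_ /IH //|_]; rewrite nzB_j0.
rewrite nzZ_S /cone2 /=; case: ifP => [_ /IH -> //|_].
by case: ifP => [_ /IH -> //|_]; rewrite nzB_j0.
Qed.

Lemma card_rem (u : U) (F : {fset U}) : u \in F -> #|` F| = #|` F `\ u|.+1.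
Proof. by move=> uF; rewrite (cardfsD1 u) uF. Qed.

Lemma nz_card n :
  (forall s l j F, nzB n s l j F -> #|` F|.+2 = 2 * j + l) /\
  (forall s l j F, nzZ n s l j F -> #|` F|.+3 = 2 * j + l).
Proof.
elim: n => [|n [IB IZ]].
  split=> s l j F; first by move=> /and3P[/eqP -> /eqP -> /eqP ->]; rewrite cardfs0.
  by move=> /andP[/eqP -> /eqP ->]; rewrite cardfs0.
have HZ s l j F : nzZ n.+1 s l.+1 j F -> #|` F|.+3 = 2 * j + l.+1.
  case: j => [|j] /[dup] ZF; rewrite nzZ_S /cone2 /=.
    case: ifP => nF; first by rewrite (card_rem nF) => /IZ ->; lia.
    case: ifP => nF'; first by rewrite (card_rem nF') => /IZ ->; lia.
    by rewrite nzB_j0.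
  case: ifP => nF; first by rewrite (card_rem nF) => /IZ ->; lia.
  case: ifP => nF'; first by rewrite (card_rem nF') => /IZ ->; lia.
  by move=> /andP[/IB E _]; rewrite E; lia.
have HZ' s l j F : nzZ n.+1 s l j F -> #|` F|.+3 = 2 * j + l.
  case: l => [|l]; last exact: HZ.
  rewrite nzZ_0; case: j => [/nzZ_j0 //|j /HZ]; rewrite /=; lia.
split=> // s [|l] [|j] F; rewrite ?nzB_j0 //.
  by rewrite nzB_0 => /and3P[_ /HZ']; lia.
rewrite nzB_S /cone2; case: ifP => nF; first by rewrite (card_rem nF) => /IB ->; lia.
by case: ifP => nF' //; rewrite (card_rem nF') => /IB ->; lia.
Qed.

Lemma nzB_card n s l j F : nzB n s l j F -> #|` F|.+2 = 2 * j + l.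
Proof. exact: (nz_card n).1. Qed.

Lemma nzZ_card n s l j F : nzZ n s l j F -> #|` F|.+3 = 2 * j + l.
Proof. exact: (nz_card n).2. Qed.

Fixpoint vertices (n : nat) : seq U :=
  if n is m.+1 then [:: (m, true), (m, false) & vertices m] else [::].

Lemma mem_vertices n u : (u \in vertices n) = (u.1 < n).
Proof.
elim: n u => [|n IH] [i t] //.
rewrite !inE IH /= [in RHS]ltnS [in RHS]leq_eqVlt !xpair_eqE.
by case: (i == n) => //=; case: t.
Qed.

Lemma uniq_vertices n : uniq (vertices n).
Proof. by elim: n => [|n IH] //=; rewrite IH !inE !mem_vertices /= ltnn xpair_eqE andbF. Qed.

Definition extends (c : facets) (r : {fset U}) (v : U) : bool := (v \notin r) && c (v |` r).

Definition degree (n : nat) (c : facets) (r : {fset U}) : nat := count (extends c r) (vertices n).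

Lemma degree_eq n c c' r : (forall v, v.1 < n -> v \notin r -> c (v |` r) = c' (v |` r)) ->
  degree n c r = degree n c' r.
Proof.
move=> E; apply: eq_in_count => v; rewrite mem_vertices /extends => vn.
by case: (boolP (v \in r)) => //= vr; exact: E.
Qed.

Lemma degreeB n (c c' : facets) r : (forall F, c' F -> c F) ->
  degree n (fun F => c F && ~~ c' F) r = degree n c r - degree n c' r.
Proof.
move=> cc; suff : degree n c r = degree n (fun F => c F && ~~ c' F) r + degree n c' r by move=> ->; rewrite addnK.
rewrite /degree; elim: (vertices n) => //= v s ->.
rewrite /extends; case: (v \in r) => //=; move: (cc (v |` r)).
by case: (c (v |` r)); case: (c' (v |` r)) => //= H; try lia; have := H isT.
Qed.

Lemma cone2_sym n s X Y M : on n X -> on n Y -> cone2 n s X Y M = cone2 n (~~ s) Y X M.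
Proof. by move=> Xn Yn; apply/funext => F; rewrite cone2C. Qed.

Lemma apex_neq n s : ((n, s) == (n, ~~ s) :> U) = false.
Proof. by rewrite xpair_eqE eqxx; case: s. Qed.

Lemma apex_neq' n s : ((n, ~~ s) == (n, s) :> U) = false.
Proof. by rewrite eq_sym apex_neq. Qed.

Lemma apex_fresh n s v : v.1 < n -> ((n, s) == v :> U) = false.
Proof. by move=> vn; apply/eqP => E; rewrite -E ltnn in vn. Qed.

Lemma degree_S n s c r :
  degree n.+1 c r = extends c r (n, s) + extends c r (n, ~~ s) + degree n c r.
Proof. by rewrite /degree /=; case: s => /=; lia. Qed.

Lemma fsetU1D1 (u v : U) (r : {fset U}) : u != v -> (v |` r) `\ u = v |` (r `\ u).
Proof.
move=> uv; apply/fsetP => w; rewrite !inE.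
by have [->|] := eqVneq w v; rewrite ?orbT //= eq_sym uv.
Qed.

Lemma degree_cone2_in n s X Y M r : on n X -> (n, s) \in r ->
  degree n.+1 (cone2 n s X Y M) r = degree n X (r `\ (n, s)).
Proof.
move=> Xn ur; rewrite (degree_S n s) /extends ur /=.
have -> : cone2 n s X Y M ((n, ~~ s) |` r) = false.
  rewrite /cone2 !inE ur orbT; apply: (on_top (s := ~~ s) Xn).
  by rewrite !inE apex_neq' eqxx.
rewrite andbF !add0n; apply: eq_in_count => v; rewrite mem_vertices /extends => vn.
rewrite !inE [v == _]eq_sym apex_fresh //= /cone2 !inE ur orbT fsetU1D1 //.
by rewrite apex_fresh.
Qed.

Lemma degree_cone2_out n s X Y M r : (n, s) \notin r -> (n, ~~ s) \notin r ->
  degree n.+1 (cone2 n s X Y M) r = X r + Y r + degree n M r.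
Proof.
move=> ur ur'; rewrite (degree_S n s) /extends ur ur' /= {1 2}/cone2 !inE !eqxx /=.
rewrite fsetU1K // apex_neq (negbTE ur) /= fsetU1K //; congr (_ + _).
apply: degree_eq => v vn vr; rewrite /cone2 !inE (negbTE ur) (negbTE ur').
by rewrite !apex_fresh.
Qed.

Lemma degree0 n (c : facets) r : (forall F, ~~ c F) -> degree n c r = 0.
Proof.
move=> c0; apply/eqP; rewrite -leqn0 leqNgt -has_count -all_predC; apply/allP => v _ /=.
by rewrite /extends (negbTE (c0 _)) andbF.
Qed.

(** Ridges of degree one form the border. For a ridge without the two apexes, the degree in the next
    sphere is the difference of the degrees in two nested balls plus one for each ball in whose
    border it lies; as the degrees in the balls are at most 2, the total is 0 or 2. *)
Lemma nz_degree n :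
  (forall s l j r, 2 * j + l <= n.+2 ->
     degree n (nzB n s l j) r <= 2 /\ (degree n (nzB n s l j) r == 1) = nzZ n s l j r) /\
  (forall s l j r, degree n (nzZ n s l j) r = 0 \/ degree n (nzZ n s l j) r = 2).
Proof.
elim: n => [|n [IB IZ]].
  split=> s l j r; last by left.
  by move=> jl; split=> //; apply/esym/negP => /andP[_ /eqP]; lia.
have HZ s l j r : degree n.+1 (nzZ n.+1 s l.+1 j) r = 0 \/ degree n.+1 (nzZ n.+1 s l.+1 j) r = 2.
  rewrite nzZ_S; set Q := nzZ n (~~ s) _ _; set M := fun F => _.
  have Qn : on n Q by exact: nzZ_on.
  have Tn : on n (nzZ n s l j) by exact: nzZ_on.
  have IQ r' : degree n Q r' = 0 \/ degree n Q r' = 2 by exact: IZ.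
  case: (boolP ((n, s) \in r)) => ur; first by rewrite degree_cone2_in.
  case: (boolP ((n, ~~ s) \in r)) => ur'; first by rewrite cone2_sym // degree_cone2_in.
  rewrite degree_cone2_out // degreeB; last by move=> F; exact: (nzB_opp (nz_inclusionsP n)).
  case: (leqP (2 * j + l) n.+2) => jl; last first.
    have D0 s' l' j' : 2 * j + l <= 2 * j' + l' -> degree n (nzB n s' l' j') r = 0.
      by move=> le; apply: degree0 => F; apply/negP => /nzB_bound; lia.
    rewrite D0 // sub0n addn0; case: (ltngtP (2 * j + l) n.+3) => E; first lia.
      have -> : nzZ n s l j r = false by apply/negP => /nzZ_bound; lia.
      have -> : Q r = false by apply/negP => /nzZ_bound; case: (j) E => [|i] /=; lia.
      by left.
    rewrite /Q !nzZ_cross //; last by case: (j) E => [|i] /=; lia.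
    by case: (cross n r); [right|left].
  have [D2 D1] := IB s l j r jl.
  case: (posnP j) => [j0|j0].
    subst j; have -> : degree n (nzB n s l 0) r = 0.
      by apply: degree0 => F; rewrite nzB_j0.
    rewrite sub0n /Q; left; have -> : nzZ n s l 0 r = false by apply/negP => /nzZ_j0; lia.
    by have -> : nzZ n (~~ s) l 0 r = false by apply/negP => /nzZ_j0; lia.
  have QE : Q = nzZ n (~~ s) l.+2 j.-1 by rewrite /Q; case: (j) j0.
  have [|D1' D1E] := IB (~~ s) l.+2 j.-1 r; first lia.
  have le : degree n (nzB n (~~ s) l.+2 j.-1) r <= degree n (nzB n s l j) r.
    apply: sub_count => v /andP[vr] /(nzB_opp (nz_inclusionsP n)) H.
    by rewrite /extends vr.
  rewrite QE -D1 -D1E.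
  move: (degree n (nzB n s l j) r) (degree n (nzB n (~~ s) l.+2 j.-1) r) D2 D1' le.
  by move=> [|[|[|d]]] [|[|[|d']]] //= _ _ _; auto.
have HZ' s l j r : degree n.+1 (nzZ n.+1 s l j) r = 0 \/ degree n.+1 (nzZ n.+1 s l j) r = 2.
  by case: l => [|l]; [rewrite nzZ_0|]; exact: HZ.
have HB s l j r : 2 * j + l.+1 <= n.+3 -> degree n.+1 (nzB n.+1 s l.+1 j) r <= 2 /\
    (degree n.+1 (nzB n.+1 s l.+1 j) r == 1) = nzZ n.+1 s l.+1 j r.
  case: j => [|j] jl.
    have -> : degree n.+1 (nzB n.+1 s l.+1 0) r = 0.
      by apply: degree0 => F; rewrite nzB_j0.
    by split=> //; apply/esym/negP => /nzZ_j0; lia.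
  rewrite nzB_S nzZ_S.
  have Xn : on n (nzB n s l j.+1) by exact: nzB_on.
  have Yn : on n (nzB n (~~ s) l.+2 j) by exact: nzB_on.
  case: (boolP ((n, s) \in r)) => ur.
    by rewrite degree_cone2_in // /cone2 ur; apply: IB; lia.
  case: (boolP ((n, ~~ s) \in r)) => ur'.
    by rewrite cone2_sym // degree_cone2_in // /cone2 (negbTE ur) ur'; apply: IB; lia.
  rewrite degree_cone2_out // /cone2 (negbTE ur) (negbTE ur').
  have -> : degree n noF r = 0.
    exact: degree0.
  have := @nzB_opp _ (nz_inclusionsP n) s l j.+1 r; rewrite /=.
  by case: (nzB n s l j.+1 r); case: (nzB n (~~ s) l.+2 j r) => // H; have := H isT.
split=> // s [|l] j r jl; last exact: HB.
case: j jl => [|j] jl.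
  have -> : degree n.+1 (nzB n.+1 s 0 0) r = 0.
    by apply: degree0 => F; rewrite nzB_j0.
  by split=> //; apply/esym/negP => /nzZ_j0; lia.
rewrite nzZ_0 /=.
have [|D2 <-] := HB s 1 j r; first lia.
have -> : degree n.+1 (nzB n.+1 s 0 j.+1) r =
    degree n.+1 (nzZ n.+1 s 1 j.+1) r - degree n.+1 (nzB n.+1 s 2 j) r.
  rewrite -degreeB; last by move=> F; exact: (@nzB2_Z _ (nz_inclusionsP n.+1) s 0 j.+1).
  by apply: degree_eq => v _ _; rewrite nzB_0.
have le : degree n.+1 (nzB n.+1 s 2 j) r <= degree n.+1 (nzZ n.+1 s 1 j.+1) r.
  apply: sub_count => v /andP[vr] H; rewrite /extends vr.
  exact: (@nzB2_Z _ (nz_inclusionsP n.+1) s 0 j.+1).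
move: (HZ' s 1 j.+1 r) D2 le.
move: (degree n.+1 (nzZ n.+1 s 1 j.+1) r) (degree n.+1 (nzB n.+1 s 2 j) r).
by move=> d [|[|[|d']]] // [->|->].
Qed.

(** * Normality *)

Lemma count_unique (T : eqType) (a : pred T) (s : seq T) x : uniq s -> x \in s -> a x ->
  (forall y, y \in s -> a y -> y = x) -> count a s = 1.
Proof.
move=> us xs ax ux; rewrite -[RHS]/(nat_of_bool true) -xs -count_uniq_mem //.
by apply: eq_in_count => y ys /=; apply/idP/eqP => [/ux ->|->].
Qed.

Lemma count_geq (T : eqType) (a : pred T) (s t : seq T) : uniq t -> {subset t <= s} -> all a t ->
  size t <= count a s.
Proof.
move=> ut ts /allP at_; rewrite -size_filter; apply: uniq_leq_size => // x xt.
by rewrite mem_filter at_ // ts.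
Qed.

Lemma extends_vertices n c r v : on n c -> extends c r v -> v \in vertices n.
Proof. by move=> cn /andP[_ cv]; rewrite mem_vertices; apply: (on_mem cn cv); rewrite !inE eqxx. Qed.

Lemma degree1P n c r : on n c -> degree n c r = 1 <->
  exists2 v, extends c r v & forall w, extends c r w -> w = v.
Proof.
move=> cn; split=> [d1|[v cv vu]]; last first.
  apply: (count_unique (uniq_vertices n) (extends_vertices cn cv) cv).
  by move=> y _; exact: vu.
have /hasP[v vn cv] : has (extends c r) (vertices n) by rewrite has_count -/(degree n c r) d1.
exists v => // w cw; apply/eqP; apply: contraTT isT => wv.
suff : 2 <= degree n c r by rewrite d1.
apply: (@count_geq _ _ _ [:: w; v]); rewrite /= ?inE ?wv ?cv ?cw //.
by move=> x; rewrite !inE => /orP[] /eqP ->; [exact: extends_vertices cw|exact: extends_vertices cv].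
Qed.

Lemma degree2P n c r v w x : on n c -> degree n c r <= 2 -> v != w ->
  extends c r v -> extends c r w -> extends c r x -> x = v \/ x = w.
Proof.
move=> cn d2 vw cv cw cx; have [->|xv] := eqVneq x v; first by left.
have [->|xw] := eqVneq x w; first by right.
suff : 3 <= degree n c r by move=> /leq_trans /(_ d2).
apply: (@count_geq _ _ _ [:: x; v; w]); rewrite /= ?inE ?negb_or ?xv ?xw ?vw ?cv ?cw ?cx //.
by move=> y; rewrite !inE => /or3P[] /eqP ->; [exact: extends_vertices cx|exact: extends_vertices cv|exact: extends_vertices cw].
Qed.

Lemma nzB_border n s l j r : 2 * j + l <= n.+2 -> nzZ n s l j r <->
  exists2 v, extends (nzB n s l j) r v & forall w, extends (nzB n s l j) r w -> w = v.
Proof.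
move=> jl; rewrite -degree1P; last exact: nzB_on.
by have [_ <-] := (nz_degree n).1 s l j r jl; split=> [/eqP|->].
Qed.

Lemma nzB_ridge n s l j r v w x : v != w -> extends (nzB n s l j) r v ->
  extends (nzB n s l j) r w -> extends (nzB n s l j) r x -> x = v \/ x = w.
Proof.
move=> vw ev; apply: (@degree2P n); [exact: nzB_on| |by []|by []].
by case: ((nz_degree n).1 s l j r) => //; case/andP: ev => _ /nzB_bound.
Qed.

Lemma nzZ_ridge n s l j r v w x : v != w -> extends (nzZ n s l j) r v ->
  extends (nzZ n s l j) r w -> extends (nzZ n s l j) r x -> x = v \/ x = w.
Proof.
move=> vw ev; apply: (@degree2P n) => //; first exact: nzZ_on.
by case: ((nz_degree n).2 s l j r) => ->.
Qed.

(** A ridge across which the smaller ball is left has degree one in it and degree two in the larger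
    ball. *)
Lemma nzB_crossing n s l j r v w : extends (nzB n s l j) r v ->
  ~~ nzB n (~~ s) l.+2 j.-1 (v |` r) -> extends (nzB n (~~ s) l.+2 j.-1) r w ->
  nzZ n (~~ s) l.+2 j.-1 r /\ ~~ nzZ n s l j r.
Proof.
move=> ev nv ew.
have sub x : extends (nzB n (~~ s) l.+2 j.-1) r x -> extends (nzB n s l j) r x.
  by move=> /andP[xr Hx]; rewrite /extends xr (nzB_opp (nz_inclusionsP n)).
have vw : v != w by apply: contraNneq nv => ->; case/andP: ew.
have b : 2 * j + l <= n.+2 by case/andP: ev => _ /nzB_bound.
have b' : 2 * j.-1 + l.+2 <= n.+2 by case/andP: ew => _ /nzB_bound.
split.
  apply/nzB_border => //; exists w => // x ex.
  have [xv|//] := nzB_ridge vw ev (sub w ew) (sub x ex).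
  by case/andP: ex; rewrite xv (negbTE nv).
apply/negP => /nzB_border => /(_ b) [x _ ux].
by case/eqP: vw; rewrite (ux v ev) (ux w (sub w ew)).
Qed.

(** Connectedness is expressed by propagating a predicate across ridges, so that no paths have to be
    handled. *)
Definition walk_closed (c : facets) (s : {fset U}) (P : {fset U} -> Prop) : Prop :=
  forall r v w, s `<=` r -> extends c r v -> extends c r w -> P (v |` r) -> P (w |` r).

(* The facets containing any given face are connected through ridges containing it. *)
Definition normal (c : facets) : Prop := forall s P, walk_closed c s P ->
  forall F G, c F -> c G -> s `<=` F -> s `<=` G -> P F -> P G.

Lemma cone2_top n s X Y M E : E `<=` Vn n -> cone2 n s X Y M ((n, s) |` E) = X E.
Proof.
move=> En; rewrite /cone2 !inE eqxx /= fsetU1K //.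
by apply/negP => /(fsubsetP En); rewrite in_Vn /= ltnn.
Qed.

Lemma cone2_bottom n s X Y M E : E `<=` Vn n -> cone2 n s X Y M ((n, ~~ s) |` E) = Y E.
Proof.
move=> En; have nE t : (n, t) \notin E by apply/negP => /(fsubsetP En); rewrite in_Vn /= ltnn.
by rewrite /cone2 !inE apex_neq eqxx (negbTE (nE s)) /= fsetU1K.
Qed.

Lemma cone2_mid n s X Y M E : E `<=` Vn n -> cone2 n s X Y M E = M E.
Proof.
move=> En; have nE t : (n, t) \notin E by apply/negP => /(fsubsetP En); rewrite in_Vn /= ltnn.
by rewrite /cone2 !(negbTE (nE _)).
Qed.

Lemma Vn_notin n (E : {fset U}) t : E `<=` Vn n -> (n, t) \notin E.
Proof. by move=> En; apply/negP => /(fsubsetP En); rewrite in_Vn /= ltnn. Qed.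

Lemma cone2P n s X Y M F : cone2 n s X Y M F ->
  [\/ exists2 E, X E & F = (n, s) |` E, exists2 E, Y E & F = (n, ~~ s) |` E |
      [/\ M F, (n, s) \notin F & (n, ~~ s) \notin F]].
Proof.
rewrite /cone2; case: (boolP (_ \in F)) => [uF XF|uF].
  by apply: Or31; exists (F `\ (n, s)) => //; rewrite fsetD1K.
case: (boolP (_ \in F)) => [uF' YF|uF' MF]; last exact: Or33.
by apply: Or32; exists (F `\ (n, ~~ s)) => //; rewrite fsetD1K.
Qed.

Lemma walk_cone2 n s X Y M (t : {fset U}) P : on n X ->
  walk_closed (cone2 n s X Y M) t P ->
  walk_closed X (t `\ (n, s)) (fun E => P ((n, s) |` E)).
Proof.
move=> Xn cP r v w tr /andP[vr Xv] /andP[wr Xw].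
rewrite [(n, s) |` (v |` r)]fsetUCA [(n, s) |` (w |` r)]fsetUCA; apply: cP.
- by rewrite -fsubDset.
- apply/andP; split; last by rewrite fsetUCA cone2_top // ; exact: Xn.
  by rewrite !inE negb_or vr eq_sym apex_fresh // (on_mem Xn Xv) // !inE eqxx.
- apply/andP; split; last by rewrite fsetUCA cone2_top // ; exact: Xn.
  by rewrite !inE negb_or wr eq_sym apex_fresh // (on_mem Xn Xw) // !inE eqxx.
Qed.

Lemma normal_cone2_apex n s X Y M (t : {fset U}) P F G : on n X -> normal X ->
  walk_closed (cone2 n s X Y M) t P -> X F -> X G ->
  t `<=` (n, s) |` F -> t `<=` (n, s) |` G -> P ((n, s) |` F) -> P ((n, s) |` G).
Proof.
move=> Xn NX cP XF XG; rewrite -!fsubDset => tF tG.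
exact: (NX _ _ (walk_cone2 Xn cP)).
Qed.

(** A walk in [D] is turned into one in the new complex by a detour through the cone over [Q]
    whenever it enters [D1]; the first condition puts the entrance in [Q]. The other two attach the
    facets of the upper cone to the rest and tie those of [Q] to [D1]. *)
Lemma normal_cone2 n s (T Q D D1 : facets) : on n T -> on n Q -> on n D ->
  (forall F, D1 F -> D F) ->
  (forall r v w, extends D r v -> ~~ D1 (v |` r) -> extends D1 r w -> Q r) ->
  (forall E, T E -> Q E \/ exists2 v, extends D E v & ~~ D1 (v |` E)) ->
  (forall E, Q E -> (exists v, extends D1 E v) \/ forall F, ~~ D F) ->
  normal T -> normal Q -> normal D ->
  normal (cone2 n s T Q (fun F => D F && ~~ D1 F)).
Proof.
move=> Tn Qn Dn DD c1 c2 c3 NT NQ ND t P cP.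
set c := cone2 _ _ _ _ _ in cP *; set u : U := (n, s); set u' : U := (n, ~~ s).
have csym : c = cone2 n (~~ s) Q T (fun F => D F && ~~ D1 F) by rewrite /c cone2_sym.
have cP' : walk_closed (cone2 n (~~ s) Q T (fun F => D F && ~~ D1 F)) t P by rewrite -csym.
case: (boolP (u \in t)) => ut F G cF cG tF tG.
  have top H : c H -> t `<=` H -> exists2 E, T E & H = u |` E.
    move=> cH /fsubsetP /(_ _ ut) uH; exists (H `\ u); last by rewrite fsetD1K.
    by move: cH; rewrite /c /cone2 uH.
  have [F' TF E] := top _ cF tF; rewrite {}E in tF *; have [G' TG E] := top _ cG tG; rewrite {}E in tG *.
  exact: (normal_cone2_apex Tn NT cP).
case: (boolP (u' \in t)) => ut'.
  have bot H : c H -> t `<=` H -> exists2 E, Q E & H = u' |` E.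
    move=> cH /fsubsetP /(_ _ ut') uH; exists (H `\ u'); last by rewrite fsetD1K.
    by move: cH; rewrite csym /cone2 uH.
  have [F' QF E] := bot _ cF tF; rewrite {}E in tF *; have [G' QG E] := bot _ cG tG; rewrite {}E in tG *.
  exact: (normal_cone2_apex Qn NQ cP').
have nsub x (E : {fset U}) : x \notin t -> (t `<=` x |` E) = (t `<=` E).
  by move=> xt; rewrite -fsubDset; congr (_ `<=` _); apply/fsetDidPl; rewrite fdisjointX1.
have csub c' E v : extends c' E v -> t `<=` E -> t `<=` v |` E.
  by move=> _ /fsubset_trans; apply; exact: fsubsetUr.
have Dc E v : D (v |` E) -> ~~ D1 (v |` E) -> c (v |` E).
  by move=> Dv D1v; rewrite /c cone2_mid ?Dv //; exact: Dn.
have exM E v : extends D E v -> ~~ D1 (v |` E) -> extends c E v.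
  by move=> /andP[vE Dv] D1v; rewrite /extends vE Dc.
have Tc E : T E -> extends c E u.
  by move=> TE; rewrite /extends Vn_notin ?/c ?cone2_top //; exact: Tn.
have Qc E : Q E -> extends c E u'.
  by move=> QE; rewrite /extends Vn_notin ?/c ?cone2_bottom //; exact: Qn.
(* [Z] is the common truth value of [P] on all facets containing [t]. *)
suff [Z HZ] : exists Z, forall H, c H -> t `<=` H -> P H <-> Z.
  by move=> PF; apply/(HZ G cG tG)/(HZ F cF tF).
have tail Z : (forall E, Q E -> t `<=` E -> P (u' |` E) <-> Z) ->
    (forall E, D E -> ~~ D1 E -> t `<=` E -> P E <-> Z) ->
    forall H, c H -> t `<=` H -> P H <-> Z.
  move=> HQ HD H /cone2P[[E TE ->]|[E QE ->]|[/andP[DE D1E] _ _]]; last exact: HD.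
    rewrite nsub // => tE.
    case: (c2 E TE) => [QE|[v ev D1v]].
      rewrite -(HQ E QE tE); split; apply: cP => //; by [exact: Tc|exact: Qc].
    have /andP[vE Dv] := ev; rewrite -(HD _ Dv D1v); last exact: csub ev _.
    by split; apply: cP => //; by [exact: Tc|exact: exM].
  by rewrite nsub //; exact: HQ.
have QQ E E' : Q E -> Q E' -> t `<=` E -> t `<=` E' -> P (u' |` E) -> P (u' |` E').
  by move=> QE QE' tE tE'; apply: (normal_cone2_apex Qn NQ cP') => //; rewrite nsub.
case: (pselect (exists2 E1, D1 E1 & t `<=` E1)) => [[E1 D1E1 tE1]|noD1]; last first.
  case: (pselect (exists E, D E)) => [[E0 DE0]|noD].
    exists (exists2 E, [/\ D E, ~~ D1 E & t `<=` E] & P E); apply: tail.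
      move=> E QE tE; case: (c3 E QE) => [[v ev]|/(_ E0)]; last by rewrite DE0.
      by case: noD1; exists (v |` E); [case/andP: ev|exact: csub ev _].
    move=> E DE D1E tE; split=> [PE|[E' [DE' D1E' tE'] PE']]; first by exists E.
    apply: (ND t P) PE' => // r v w tr ev ew.
    have nD1 x : ~~ D1 (x |` r).
      by apply/negP => D1x; apply: noD1; exists (x |` r) => //; apply: fsubset_trans tr (fsubsetUr _ _).
    by apply: cP => //; exact: exM.
  exists (exists2 E, Q E /\ t `<=` E & P (u' |` E)); apply: tail.
    by move=> E QE tE; split=> [PE|[E' [QE' tE'] PE']]; [exists E|exact: QQ PE'].
  by move=> E DE; case: noD; exists E.
pose Z := exists2 E, Q E /\ t `<=` E & P (u' |` E).
have ZQ E : Q E -> t `<=` E -> P (u' |` E) <-> Z.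
  by move=> QE tE; split=> [PE|[E' [QE' tE'] PE']]; [exists E|exact: QQ PE'].
exists Z; apply: tail => // E DE D1E tE.
(* While a walk in [D] is inside [D1], the predicate keeps the value [Z] taken on the cone over
   [Q]. *)
have close : walk_closed D t (fun E => if D1 E then Z else P E).
  move=> r v w tr ev ew.
  case: (boolP (D1 (v |` r))) => D1v; case: (boolP (D1 (w |` r))) => D1w //.
  - have e1 : extends D1 r v by case/andP: ev => vr _; rewrite /extends vr.
    have Qr := c1 _ _ _ ew D1w e1.
    rewrite -(ZQ r Qr tr); apply: cP => //; by [exact: Qc|exact: exM].
  - have e1 : extends D1 r w by case/andP: ew => wr _; rewrite /extends wr.
    have Qr := c1 _ _ _ ev D1v e1.
    rewrite -(ZQ r Qr tr); apply: cP => //; by [exact: Qc|exact: exM].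
  - by apply: cP => //; exact: exM.
have := ND t _ close E E1 DE (DD _ D1E1) tE tE1; have := ND t _ close E1 E (DD _ D1E1) DE tE1 tE.
by rewrite D1E1 (negbTE D1E).
Qed.

(* The two parts of the sphere [nzZ n s l.+1 j] complementary to balls in it. *)
Definition nzC n s l j : facets := fun F => nzZ n s l.+1 j F && ~~ nzB n s l j F.
Definition nzD n s l j : facets := fun F => nzZ n s l.+1 j F && ~~ nzB n s l.+2 j.-1 F.

Lemma nzB_SE n s l j : nzB n.+1 s l.+1 j =
  cone2 n s (nzB n s l j) (nzB n (~~ s) l.+2 j.-1) noF.
Proof.
case: j => [|j]; last by rewrite nzB_S.
by apply/funext => F; rewrite /cone2 !nzB_j0; case: (_ \in _) => //; case: (_ \in _).
Qed.

Lemma cone2D n s X Y M X' Y' F : cone2 n s X Y M F && ~~ cone2 n s X' Y' noF F =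
  cone2 n s (fun F => X F && ~~ X' F) (fun F => Y F && ~~ Y' F) M F.
Proof. by rewrite /cone2; case: ifP => // _; case: ifP => // _; rewrite andbT. Qed.

Lemma nzC_S n s l j : nzC n.+1 s l.+1 j.+1 =
  cone2 n s (nzC n s l j.+1) (nzC n (~~ s) l.+2 j)
    (fun F => nzB n s l.+1 j.+1 F && ~~ nzB n (~~ s) l.+3 j F).
Proof. by apply/funext => F; rewrite /nzC nzZ_S nzB_SE cone2D. Qed.

Lemma nzD_S n s l j : nzD n.+1 s l j.+1 =
  cone2 n s (fun F => nzZ n s l j.+1 F && ~~ nzB n s l.+1 j F) (nzD n (~~ s) l.+1 j)
    (fun F => nzB n s l j.+1 F && ~~ nzB n (~~ s) l.+2 j F).
Proof. by apply/funext => F; rewrite /nzD nzZ_S nzB_SE cone2D. Qed.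

Lemma nzC_0 n s j : nzC n s 0 j.+1 = nzB n s 2 j.
Proof.
apply/funext => F; rewrite /nzC nzB_0 /=; apply/andP/idP => [[-> /=]|BF]; first by rewrite negbK.
have -> := @nzB2_Z _ (nz_inclusionsP n) s 0 j.+1 F BF.
by rewrite BF.
Qed.

Lemma nzB_D n s j : nzB n s 0 j.+1 = nzD n s 0 j.+1.
Proof. by apply/funext => F; rewrite nzB_0. Qed.

Lemma normal_empty (c : facets) : (forall F, ~~ c F) -> normal c.
Proof. by move=> c0 t P _ F G cF; have := c0 F; rewrite cF. Qed.

Lemma normal_set0 (c : facets) : (forall F, c F -> F = fset0) -> normal c.
Proof. by move=> c0 t P _ F G /c0 -> /c0 ->. Qed.

Lemma normal_suspension n s (X Y : facets) : on n X -> on n Y -> (forall F, X F -> Y F) ->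
  normal X -> normal Y -> normal (cone2 n s X Y noF).
Proof.
move=> Xn Yn XY NX NY; rewrite (_ : noF = fun F => noF F && ~~ noF F) //.
apply: normal_cone2 => //.
- by move=> r v w /andP[].
- by move=> E /XY; left.
- by move=> E _; right.
Qed.

Lemma normal_cross n : normal (cross n).
Proof.
elim: n => [|n IH]; first by apply: normal_set0 => F /eqP.
by apply: normal_suspension => //; exact: cross_on.
Qed.

Lemma normal_nzZ_j0 n s l : normal (nzZ n s l 0).
Proof.
case: (pselect (exists F, nzZ n s l 0 F)) => [[F /nzZ_j0 E]|N0].
  by rewrite nzZ_cross ?E //; exact: normal_cross.
by apply: normal_empty => F; apply/negP => ZF; apply: N0; exists F.
Qed.

(** The common form of the recursions for [nzZ], [nzC] and [nzD]: [YT] and [YQ] are the balls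
    deleted from the two spheres being coned, both empty for [nzZ]. *)
Lemma normal_step n s l j (YT YQ : facets) :
  (forall F, YQ F -> YT F) -> (forall F, YT F -> nzZ n s l j.+1 F) ->
  normal (fun F => nzZ n s l j.+1 F && ~~ YT F) ->
  normal (fun F => nzZ n (~~ s) l.+2 j F && ~~ YQ F) ->
  normal (nzB n s l j.+1) ->
  normal (cone2 n s (fun F => nzZ n s l j.+1 F && ~~ YT F)
    (fun F => nzZ n (~~ s) l.+2 j F && ~~ YQ F)
    (fun F => nzB n s l j.+1 F && ~~ nzB n (~~ s) l.+2 j F)).
Proof.
move=> YQT YTZ NT NQ ND.
have sub x r : extends (nzB n (~~ s) l.+2 j) r x -> extends (nzB n s l j.+1) r x.
  by move=> /andP[xr Hx]; rewrite /extends xr (@nzB_opp _ (nz_inclusionsP n) s l j.+1).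
apply: normal_cone2 => //.
- by move=> F /andP[/nzZ_on].
- by move=> F /andP[/nzZ_on].
- exact: nzB_on.
- exact: (@nzB_opp _ (nz_inclusionsP n) s l j.+1).
- move=> r v w ev nv ew.
  have [-> nZ] := @nzB_crossing n s l j.+1 r v w ev nv ew.
  by apply: contra nZ => /YQT /YTZ.
- move=> E /andP[ZE nYT]; have nYQ : ~~ YQ E by apply: contra nYT => /YQT.
  rewrite nYQ andbT; case: (leqP (2 * j.+1 + l) n.+2) => jl; last first.
    have := nzZ_bound ZE; left; move: ZE; rewrite !nzZ_cross //; lia.
  have /(nzB_border _ _ jl)[v ev uv] := ZE.
  case: (boolP (nzB n (~~ s) l.+2 j (v |` E))) => B1; last by right; exists v.
  left; apply/nzB_border; first lia.
  exists v => [|w /sub /uv //].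
  by case/andP: ev => vE _; rewrite /extends vE.
- move=> E /andP[QE _]; case: (leqP (2 * j.+1 + l) n.+2) => jl; last first.
    by right=> F; apply/negP => /nzB_bound; lia.
  have /nzB_border[|v ev _] := QE; first lia.
  by left; exists v.
Qed.

Lemma andb_noF (c : facets) : c = (fun F => c F && ~~ noF F).
Proof. by apply/funext => F; rewrite andbT. Qed.

(** The complements have to be included: [nzB] with [l = 0] is [nzD], and in the recursion for [nzD]
    with [l = 0] one of the two links is an [nzC]. *)
Lemma nz_normal n : (forall s l j, normal (nzB n s l j)) /\ (forall s l j, normal (nzZ n s l j)) /\
  (forall s l j, normal (nzC n s l j)) /\ (forall s l j, normal (nzD n s l j)).
Proof.
elim: n => [|n [IB [IZ [IC ID]]]].
  by split; [|split; [|split]] => s l j; apply: normal_set0 => F;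
    [case/and3P=> /eqP|case/andP=> /eqP|case/andP=> /andP[/eqP]|case/andP=> /andP[/eqP]].
have PB := nz_inclusionsP n.
have HZ s l j : normal (nzZ n.+1 s l j).
  case: j => [|j]; first exact: normal_nzZ_j0.
  wlog : l j / exists l', l = l'.+1.
    move=> H; case: l => [|l]; last by apply: H; exists l.
    rewrite nzZ_0 /=; case: j => [|j]; first exact: normal_nzZ_j0.
    by apply: H; exists 1.
  move=> [l' ->]; rewrite nzZ_S /= (andb_noF (nzZ n s l' j.+1)) (andb_noF (nzZ n (~~ s) l'.+2 j)).
  by apply: normal_step => //; rewrite -andb_noF.
have HB s l j : normal (nzB n.+1 s l.+1 j).
  rewrite nzB_SE cone2_sym; try exact: nzB_on.
  by apply: normal_suspension; try exact: nzB_on; [exact: nzB_opp|exact: IB|exact: IB].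
have HC s l j : normal (nzC n.+1 s l j).
  case: j => [|j].
    rewrite (_ : nzC _ _ _ _ = nzZ n.+1 s l.+1 0); first exact: normal_nzZ_j0.
    by apply/funext => F; rewrite /nzC nzB_j0 andbT.
  case: l => [|l]; first by rewrite nzC_0.
  rewrite nzC_S; apply: normal_step.
  - exact: (@nzB_opp _ PB s l j.+1).
  - exact: (@nzB_Z _ PB s l j.+1).
  - exact: (IC s l j.+1).
  - exact: (IC (~~ s) l.+2 j).
  - exact: IB.
have HD s l j : normal (nzD n.+1 s l j).
  case: j => [|j].
    rewrite (_ : nzD _ _ _ _ = nzZ n.+1 s l.+1 0); first exact: normal_nzZ_j0.
    by apply/funext => F; rewrite /nzD nzB_j0 andbT.
  rewrite nzD_S; apply: normal_step => //.
  - exact: (@nzB_opp _ PB s l.+1 j).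
  - case: l => [|l] F; last exact: (@nzB2_Z _ PB s l j.+1).
    by rewrite nzZ_0; exact: (@nzB_Z _ PB s 1 j).
  - case: l => [|l]; last exact: (ID s l j.+1).
    by rewrite nzZ_0; exact: (IC s 1 j).
  - exact: (ID (~~ s) l.+1 j).
split; last by split; [|split].
move=> s [|l] j //; case: j => [|j]; last by rewrite nzB_D.
by apply: normal_empty => F; rewrite nzB_j0.
Qed.

Lemma nzB_normal n s l j : normal (nzB n s l j).
Proof. exact: (nz_normal n).1. Qed.

Lemma nzZ_normal n s l j : normal (nzZ n s l j).
Proof. exact: (nz_normal n).2.1. Qed.

(** * Neighborliness *)

Definition cl (c : facets) : cpx := fun t => exists2 F, c F & t `<=` F.

Lemma cl_sub (c c' : facets) t : (forall F, c F -> c' F) -> cl c t -> cl c' t.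
Proof. by move=> cc [F /cc cF tF]; exists F. Qed.

Lemma down_cl c : down (cl c).
Proof. by move=> s t [F cF sF] ts; exists F => //; exact: fsubset_trans sF. Qed.

(** A walk around [t] from [A] to its complement leaves [A] through some ridge. The sphere has only
    two facets there, so [A] has exactly one. *)
Lemma nzZ_frontier n s l j (A : facets) t : (forall F, A F -> nzZ n s l j F) ->
  cl A t -> cl (fun F => nzZ n s l j F && ~~ A F) t ->
  exists2 r, t `<=` r & exists2 v, extends A r v & forall w, extends A r w -> w = v.
Proof.
move=> AZ [F AF tF] [G /andP[ZG AG] tG]; apply: contrapT => no.
have := @nzZ_normal n s l j t (fun F => A F) _ F G (AZ _ AF) ZG tF tG AF.
rewrite (negbTE AG) => H; suff : false by []; apply: H => r v w tr ev ew Av.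
apply: contrapT => /negP Aw; case: no; exists r => //; exists v.
  by case/andP: ev => vr _; rewrite /extends vr.
move=> x /andP[xr Ax]; have ex : extends (nzZ n s l j) r x by rewrite /extends xr AZ.
have vw : v != w by apply: contraNneq Aw => <-.
by case: (nzZ_ridge vw ev ew ex) => // xw; rewrite xw (negbTE Aw) in Ax.
Qed.

Lemma nzB_frontier n s l j s' l' j' t : 2 * j' + l' <= n.+2 ->
  (forall F, nzB n s' l' j' F -> nzZ n s l j F) -> cl (nzB n s' l' j') t ->
  cl (fun F => nzZ n s l j F && ~~ nzB n s' l' j' F) t -> cl (nzZ n s' l' j') t.
Proof.
move=> b AZ cA cZ; have [r tr Hr] := nzZ_frontier AZ cA cZ.
by exists r => //; apply/nzB_border.
Qed.

Definition unpaired (t : {fset U}) : Prop := forall i s, (i, s) \in t -> (i, ~~ s) \notin t.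

Lemma unpaired_sub t t' : unpaired t -> t' `<=` t -> unpaired t'.
Proof. by move=> ft /fsubsetP tt i s /tt /ft; apply: contra => /tt. Qed.

Lemma unpairedU1 n s (E : {fset U}) : E `<=` Vn n -> unpaired E -> unpaired ((n, s) |` E).
Proof.
move=> En fE i t; rewrite !inE !xpair_eqE => /orP[/andP[/eqP -> /eqP ->]|itE].
  by rewrite eqxx (negbTE (Vn_notin _ En)) orbF /=; case: s.
have : i < n by have := fsubsetP En _ itE; rewrite in_Vn.
by move=> lt; rewrite (ltn_eqF lt) /= fE.
Qed.

Lemma unpaired_cone2 n s (X Y M : facets) : on n X -> on n Y -> (forall F, X F -> unpaired F) ->
  (forall F, Y F -> unpaired F) -> (forall F, M F -> unpaired F) ->
  forall F, cone2 n s X Y M F -> unpaired F.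
Proof.
move=> Xn Yn fX fY fM F /cone2P[[E XE ->]|[E YE ->]|[/fM //]].
  by apply: unpairedU1; [exact: Xn|exact: fX].
by apply: unpairedU1; [exact: Yn|exact: fY].
Qed.

Lemma nz_unpaired n : (forall s l j F, nzB n s l j F -> unpaired F) /\
  (forall s l j F, nzZ n s l j F -> unpaired F).
Proof.
elim: n => [|n [IB IZ]].
  by split=> s l j F => [/and3P[/eqP -> _ _]|/andP[/eqP -> _]] i t; rewrite inE.
have HZ s l j F : nzZ n.+1 s l.+1 j F -> unpaired F.
  rewrite nzZ_S; apply: unpaired_cone2; try exact: nzZ_on; try exact: IZ.
  by move=> {}F /andP[/IB].
have HZ' s l j F : nzZ n.+1 s l j F -> unpaired F by case: l => [|l]; rewrite ?nzZ_0; exact: HZ.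
split=> // s [|l] j F; first by rewrite nzB_0 => /and3P[_ /HZ'].
by rewrite nzB_SE; apply: unpaired_cone2; try exact: nzB_on; try exact: IB.
Qed.

Lemma cl_top n s X Y M t : on n X -> (n, s) \in t ->
  cl X (t `\ (n, s)) -> cl (cone2 n s X Y M) t.
Proof.
move=> Xn ut [F XF tF]; exists ((n, s) |` F); last by rewrite -fsubDset.
by rewrite cone2_top //; exact: Xn.
Qed.

Lemma cl_bottom n s X Y M t : on n Y -> (n, ~~ s) \in t ->
  cl Y (t `\ (n, ~~ s)) -> cl (cone2 n s X Y M) t.
Proof.
move=> Yn ut [F YF tF]; exists ((n, ~~ s) |` F); last by rewrite -fsubDset.
by rewrite cone2_bottom //; exact: Yn.
Qed.

Lemma cl_below_top n s X Y M t : on n X -> cl X t -> cl (cone2 n s X Y M) t.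
Proof.
move=> Xn [F XF tF]; exists ((n, s) |` F); last exact: fsubset_trans (fsubsetUr _ _).
by rewrite cone2_top //; exact: Xn.
Qed.

Lemma cl_below_bottom n s X Y M t : on n Y -> cl Y t -> cl (cone2 n s X Y M) t.
Proof.
move=> Yn [F YF tF]; exists ((n, ~~ s) |` F); last exact: fsubset_trans (fsubsetUr _ _).
by rewrite cone2_bottom //; exact: Yn.
Qed.

Lemma cl_mid n s X Y (M : facets) t : on n M -> cl M t -> cl (cone2 n s X Y M) t.
Proof. by move=> Mn [F MF tF]; exists F => //; rewrite cone2_mid //; exact: Mn. Qed.

Lemma cl_cone2_in n s X Y M t : (n, s) \in t ->
  cl (cone2 n s X Y M) t -> cl X (t `\ (n, s)).
Proof.
move=> ut [F cF tF]; have uF := fsubsetP tF _ ut.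
by exists (F `\ (n, s)); [move: cF; rewrite /cone2 uF|exact: fsetSD].
Qed.

Lemma cl_cone2_out n s X Y M t : (n, s) \notin t -> (n, ~~ s) \notin t ->
  cl (cone2 n s X Y M) t -> [\/ cl X t, cl Y t | cl M t].
Proof.
move=> ut ut' [F /cone2P[[E XE ->]|[E YE ->]|[MF _ _]] tF].
- by apply: Or31; exists E => //; move: tF; rewrite -fsubDset mem_fsetD1.
- by apply: Or32; exists E => //; move: tF; rewrite -fsubDset mem_fsetD1.
- by apply: Or33; exists F.
Qed.

Lemma Vn_drop n s t : t `<=` Vn n.+1 -> (n, ~~ s) \notin t -> t `\ (n, s) `<=` Vn n.
Proof.
move=> tn ut; apply/fsubsetP => -[i b]; rewrite !inE => /andP[ne it].
have := fsubsetP tn _ it; rewrite !in_Vn /= ltnS leq_eqVlt => /orP[/eqP E|//].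
by move: ne it; rewrite E xpair_eqE eqxx /=; case: b (s) ut => -[] //= /negbTE ->.
Qed.

Lemma Vn_drop2 n s t : t `<=` Vn n.+1 -> (n, s) \notin t -> (n, ~~ s) \notin t -> t `<=` Vn n.
Proof. by move=> tn us us'; rewrite -(mem_fsetD1 us); exact: Vn_drop. Qed.

Lemma cross_unpaired n F : cross n F -> unpaired F.
Proof.
elim: n F => [|n IH] F; first by move=> /eqP -> i b; rewrite inE.
by apply: unpaired_cone2 => //; exact: cross_on.
Qed.

Lemma cross_full n t : t `<=` Vn n -> unpaired t -> cl (cross n) t.
Proof.
elim: n t => [|n IH] t tn ft.
  by exists fset0 => //; apply: fsubset_trans tn _; apply/fsubsetP => u; rewrite in_Vn.
have ft' u : unpaired (t `\ u) by apply: unpaired_sub ft _; exact: fsubD1set.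
case: (boolP ((n, true) \in t)) => ut.
  by apply: cl_top => //; [exact: cross_on|apply: IH => //; apply: Vn_drop => //; exact: ft].
case: (boolP ((n, false) \in t)) => ut'.
  by apply: cl_bottom => //; [exact: cross_on|apply: IH => //; apply: Vn_drop => //; exact: ft].
by apply: cl_below_top; [exact: cross_on|apply: IH => //; exact: Vn_drop2 ut ut'].
Qed.

Ltac ulia := change (Choice.sort U) with (nat * bool)%type in *; lia.
Ltac card_lia ut ts := rewrite -ltnS -(card_rem ut); ulia.

(** The second half says that small faces of a ball already lie in its border. This is why coning
    the border in place of the ball loses no small face, and the two halves need each other. *)
Lemma nz_neighborly n :
  (forall s l j t, 2 * j + l <= n.+2 -> t `<=` Vn n -> unpaired t -> #|` t| < j -> cl (nzB n s l j) t) /\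
  (forall s l j t, cl (nzB n s l j) t -> #|` t|.+2 <= j + l -> cl (nzZ n s l j) t).
Proof.
elim: n => [|n [IN IS]].
  split=> s l j t; last by move=> [F /and3P[_ /eqP -> /eqP ->]].
  move=> jl; rewrite (_ : Vn 0 = fset0); last by apply/fsetP => u; rewrite in_Vn inE.
  rewrite fsubset0 => /eqP -> _; rewrite cardfs0 => j0; exists fset0 => //.
  by apply/and3P; split=> //; apply/eqP; ulia.
have P := nz_inclusionsP n; have PS := nz_inclusionsP n.+1.
have S1 s l j t : cl (nzB n.+1 s l.+1 j) t -> #|` t|.+2 <= j + l.+1 -> cl (nzZ n.+1 s l.+1 j) t.
  case: j => [|j]; first by move=> [F]; rewrite nzB_j0.
  rewrite nzB_S nzZ_S /= => ct ts.
  have Xn : on n (nzB n s l j.+1) by exact: nzB_on.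
  have Yn : on n (nzB n (~~ s) l.+2 j) by exact: nzB_on.
  case: (boolP ((n, s) \in t)) => ut.
    apply: cl_top => //; first exact: nzZ_on.
    by apply: IS; [exact: cl_cone2_in ct|card_lia ut ts].
  case: (boolP ((n, ~~ s) \in t)) => ut'.
    apply: cl_bottom => //; first exact: nzZ_on.
    apply: IS; last by card_lia ut' ts.
    by move: ct; rewrite cone2_sym //; exact: cl_cone2_in.
  have cX : cl (nzB n s l j.+1) t.
    case: (cl_cone2_out ut ut' ct) => // [cY|[]//].
    by apply: cl_sub cY; exact: (@nzB_opp _ P s l j.+1).
  (* A face of the smaller ball lies in its border and hence in the second cone. Otherwise any facet
     of the larger ball that contains it survives in the middle part. *)
  case: (pselect (cl (nzB n (~~ s) l.+2 j) t)) => [cY|ncY].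
    by apply: cl_below_bottom; [exact: nzZ_on|apply: IS cY _; ulia].
  apply: cl_mid; first by move=> F /andP[/nzB_on].
  case: cX => F XF tF; exists F => //; rewrite XF /=; apply/negP => YF.
  by apply: ncY; exists F.
have N1 s l j t : 2 * j + l.+1 <= n.+3 -> t `<=` Vn n.+1 -> unpaired t -> #|` t| < j ->
    cl (nzB n.+1 s l.+1 j) t.
  case: j => [//|j] jl tn ft ts; rewrite nzB_S.
  have Xn : on n (nzB n s l j.+1) by exact: nzB_on.
  have Yn : on n (nzB n (~~ s) l.+2 j) by exact: nzB_on.
  case: (boolP ((n, s) \in t)) => ut.
    apply: cl_top => //; apply: IN; first ulia.
    - by apply: Vn_drop => //; exact: ft.
    - by apply: unpaired_sub ft _; exact: fsubD1set.
    - by apply: leq_ltn_trans ts; apply: fsubset_leq_card; exact: fsubD1set.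
  case: (boolP ((n, ~~ s) \in t)) => ut'.
    apply: cl_bottom => //; apply: IN; first ulia.
    - by apply: Vn_drop => //; exact: ft.
    - by apply: unpaired_sub ft _; exact: fsubD1set.
    - by card_lia ut' ts.
  apply: cl_below_top => //; apply: IN => //; first ulia.
  exact: Vn_drop2 ut ut'.
have Z1 s j t : 2 * j <= n.+3 -> t `<=` Vn n.+1 -> unpaired t -> #|` t| < j -> cl (nzZ n.+1 s 1 j) t.
  case: j => [//|j] jl tn ft ts.
  have link b t' : 2 * j.+1 <= n.+2 -> cl (nzB n b 2 j) t' -> #|` t'| <= j -> cl (nzZ n b 2 j) t'.
    by move=> _ ct ts'; apply: IS => //; ulia.
  have lnk b t' : t' `<=` Vn n -> unpaired t' -> #|` t'| < j -> cl (nzZ n b 2 j) t'.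
    move=> tn' ft' ts'; case: (leqP (2 * j.+1) n.+2) => jn.
      by apply: IS; [apply: IN => //; ulia|ulia].
    rewrite nzZ_cross; last ulia.
    exact: cross_full.
  case: (boolP ((n, s) \in t)) => ut.
    rewrite nzZ_S nzZ_0; apply: cl_top => //; first exact: nzZ_on.
    apply: lnk.
    - by apply: Vn_drop => //; exact: ft.
    - by apply: unpaired_sub ft _; exact: fsubD1set.
    - by card_lia ut ts.
  case: (boolP ((n, ~~ s) \in t)) => ut'.
    rewrite nzZ_S; apply: cl_bottom => //; first exact: nzZ_on.
    apply: lnk.
    - by apply: Vn_drop => //; exact: ft.
    - by apply: unpaired_sub ft _; exact: fsubD1set.
    - by card_lia ut' ts.
  have {}tn : t `<=` Vn n by exact: Vn_drop2 ut ut'.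
  case: (leqP (2 * j.+1) n.+2) => jn; last first.
    by rewrite nzZ_cross; [apply: cross_full => //; exact: sub_Vn_S|ulia].
  have [F BF tF] : cl (nzB n s 0 j.+1) t by apply: IN => //; ulia.
  rewrite nzZ_S; case: (boolP (nzB n (~~ s) 2 j F)) => YF.
    by apply: cl_below_bottom; [exact: nzZ_on|apply: IS; [exists F|ulia]].
  by apply: cl_mid; [move=> G /andP[/nzB_on]|exists F => //; rewrite BF].
have N s l j t : 2 * j + l <= n.+3 -> t `<=` Vn n.+1 -> unpaired t -> #|` t| < j -> cl (nzB n.+1 s l j) t.
  case: l => [|l]; last exact: N1.
  case: j => [//|j] jl tn ft ts.
  have [F ZF tF] : cl (nzZ n.+1 s 1 j.+1) t by apply: Z1 => //; ulia.
  case: (boolP (nzB n.+1 s 2 j F)) => BF; last by exists F => //; rewrite nzB_0 ZF.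
  (* If the facet found lies in the complementary ball, then [t] lies in the border common to both
     balls, so some facet of the wanted ball contains it. *)
  have [||r Zr tr] := S1 s 1 j t; [by exists F|ulia|].
  have /nzB_border[|v /andP[_ Bv] _] : nzZ n.+1 s 0 j.+1 r by rewrite nzZ_0.
    by ulia.
  by exists (v |` r) => //; apply: fsubset_trans tr (fsubsetUr _ _).
split=> // s [|l] j t ct ts; last exact: S1.
case: j ct ts => [|j] ct ts; first ulia.
rewrite nzZ_0; have [F BF tF] := ct; apply: S1; last ulia.
apply: N; last ulia.
- by have := nzB_bound BF; ulia.
- exact: fsubset_trans tF (nzB_on BF).
- by apply: unpaired_sub tF; exact: (nz_unpaired n.+1).1 BF.
Qed.

Lemma nzB_neighborly n s l j t : 2 * j + l <= n.+2 -> t `<=` Vn n -> unpaired t ->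
  #|` t| < j -> cl (nzB n s l j) t.
Proof. exact: (nz_neighborly n).1. Qed.

(** * The Novik-Zheng complexes are balls *)

(* Faces are only tested on the vertices below [n], as [cylinder] requires. *)
Definition CL (n : nat) (c : facets) : cpx := fun t => cl c (t `&` Vn n).

Lemma CL_down n c : down (CL n c).
Proof. by move=> s t cs ts; apply: down_cl cs _; exact: fsetSI. Qed.

Lemma CL_cylinder n c : cylinder (Vn n) (CL n c).
Proof.
move=> s t st; rewrite /CL; suff -> : s `&` Vn n = t `&` Vn n by [].
by apply/fsetP => u; rewrite !inE; case: (boolP (u \in Vn n)) => [/st ->|]; rewrite ?andbF.
Qed.

Lemma CL_sub n (c c' : facets) t : (forall F, c F -> c' F) -> CL n c t -> CL n c' t.
Proof. exact: cl_sub. Qed.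

Lemma cl_or (c a b : facets) t : (forall F, c F <-> a F \/ b F) -> cl c t <-> cl a t \/ cl b t.
Proof.
move=> cab; split=> [[F /cab[aF|bF] tF]|[[F aF tF]|[F bF tF]]].
- by left; exists F.
- by right; exists F.
- by exists F => //; apply/cab; left.
- by exists F => //; apply/cab; right.
Qed.

Lemma capS_top n s (t E : {fset U}) : E `<=` Vn n ->
  (t `&` Vn n.+1 `<=` (n, s) |` E) = ((n, ~~ s) \notin t) && (t `&` Vn n `<=` E).
Proof.
move=> En; apply/fsubsetP/andP => [H|[us /fsubsetP H] v].
  split.
    apply/negP => ut; have : (n, ~~ s) \in t `&` Vn n.+1 by rewrite !inE ut in_Vn /=.
    by move/H; rewrite !inE apex_neq' (negbTE (Vn_notin _ En)).
  apply/fsubsetP => v; rewrite !inE in_Vn => /andP[vt vn].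
  have : v \in t `&` Vn n.+1 by rewrite !inE vt in_Vn /= leqW.
  by move/H; rewrite !inE eq_sym apex_fresh.
rewrite !inE (Vn_S n s) !inE => /andP[vt /or3P[->//|/eqP E'|vn]].
  by rewrite E' (negbTE us) in vt.
by rewrite H ?orbT // !inE vt.
Qed.

Lemma capS n s (t E : {fset U}) : E `<=` Vn n ->
  (t `&` Vn n.+1 `<=` E) = [&& (n, s) \notin t, (n, ~~ s) \notin t & t `&` Vn n `<=` E].
Proof.
move=> En; apply/fsubsetP/and3P => [H|[us us' /fsubsetP H] v].
  have nt b : (n, b) \notin t.
    apply/negP => ut; have : (n, b) \in t `&` Vn n.+1 by rewrite !inE ut in_Vn /=.
    by move/H; rewrite (negbTE (Vn_notin _ En)).
  split=> //; apply/fsubsetP => v; rewrite !inE in_Vn => /andP[vt vn].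
  by apply: H; rewrite !inE vt in_Vn /= leqW.
rewrite !inE (Vn_S n s) !inE => /andP[vt /or3P[/eqP E'|/eqP E'|vn]].
- by rewrite E' (negbTE us) in vt.
- by rewrite E' (negbTE us') in vt.
by rewrite H // !inE vt.
Qed.

Definition apex (n : nat) (s : bool) : U := (n, s).

Lemma CL_cone2 n s (X Y M : facets) t : on n X -> on n Y -> on n M ->
  CL n.+1 (cone2 n s X Y M) t <->
  (~ (apex n (~~ s) \in t) /\ CL n X t) \/ (~ (apex n s \in t) /\ CL n Y t) \/
  ((~ (apex n s \in t) /\ ~ (apex n (~~ s) \in t)) /\ CL n M t).
Proof.
move=> Xn Yn Mn; split.
  move=> [F /cone2P[[E XE ->]|[E YE ->]|[MF us us']]].
  - by rewrite capS_top ?Xn // => /andP[/negP us tE]; left; split=> //; exists E.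
  - by rewrite capS_top ?Yn // negbK => /andP[/negP us tE]; right; left; split=> //; exists E.
  - have Fn : F `<=` Vn n by exact: Mn.
    rewrite (capS s) // => /and3P[/negP ? /negP ? tE]; right; right; split=> //; exists F => //.
move=> [[/negP us [E XE tE]]|[[/negP us [E YE tE]]|[[/negP us /negP us'] [E ME tE]]]].
- by exists ((n, s) |` E); rewrite ?cone2_top ?Xn // capS_top ?Xn // us.
- by exists ((n, ~~ s) |` E); rewrite ?cone2_bottom ?Yn // capS_top ?Yn // negbK us.
- by exists E; rewrite ?cone2_mid ?Mn // (capS s) ?Mn // us us'.
Qed.

Lemma apex_notin n s : apex n s \notin Vn n.
Proof. by rewrite in_Vn /= ltnn. Qed.

Lemma apex_notin2 n s : apex n s \notin apex n (~~ s) |` Vn n.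
Proof. by rewrite !inE /apex apex_neq (negbTE (apex_notin _ _)). Qed.

Section Balls.
Variable R : realType.

(* [YT] and [YQ] are the parts removed from the boundaries of [nzB n s l j.+1] and
   of [nzB n (~~ s) l.+2 j]; the first apex replaces the second ball by means of
   [cone_ball_replace], the second apex is then pushed onto [T]. *)
Lemma cone_ball_step n s l j (YT YQ dYT dYQ : facets) :
  2 * j.+1 + l <= n.+3 -> on n dYT -> on n dYQ ->
  let T := fun F => nzZ n s l j.+1 F && ~~ YT F in
  let Q := fun F => nzZ n (~~ s) l.+2 j F && ~~ YQ F in
  (forall F, YQ F -> YT F) -> (forall F, YT F -> nzZ n s l j.+1 F) ->
  (forall F, YQ F -> nzZ n (~~ s) l.+2 j F) ->
  (forall t, cl YT t -> cl T t -> cl dYT t) ->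
  (forall t, cl YQ t -> cl (fun F => nzZ n s l j.+1 F && ~~ YQ F) t -> cl dYQ t) ->
  (forall t, cl YQ t -> cl Q t -> cl dYQ t) ->
  (2 * j.+1 + l <= n.+2 ->
     cone_ball R (Vn n) (CL n (nzB n s l j.+1)) (CL n (nzZ n s l j.+1))) ->
  (2 * j + l.+2 <= n.+2 ->
     ball R (Vn n) (CL n (nzB n (~~ s) l.+2 j)) (CL n (nzZ n (~~ s) l.+2 j))) ->
  ball R (Vn n) (CL n YQ) (CL n dYQ) ->
  cone_ball R (Vn n) (CL n Q) (CL n dYQ) ->
  cone_ball R (Vn n) (CL n T) (CL n dYT) ->
  cone_ball R (Vn n.+1)
    (CL n.+1 (cone2 n s T Q (fun F => nzB n s l j.+1 F && ~~ nzB n (~~ s) l.+2 j F)))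
    (CL n.+1 (cone2 n s dYT dYQ (fun F => YT F && ~~ YQ F))).
Proof.
move=> jl dYTn dYQn T Q YQT YTZ YQZ RT RQ RQ' bD bD1 bYQ bQ bT.
have P := nz_inclusionsP n.
set M := fun F => nzB n s l j.+1 F && ~~ nzB n (~~ s) l.+2 j F.
set W := fun F => nzZ n s l j.+1 F && ~~ YQ F.
have D1D F : nzB n (~~ s) l.+2 j F -> nzB n s l j.+1 F by exact: (@nzB_opp _ P s l j.+1).
have Tn : on n T by move=> F /andP[/nzZ_on].
have Qn : on n Q by move=> F /andP[/nzZ_on].
have Mn : on n M by move=> F /andP[/nzB_on].
have Yn : on n (fun F => YT F && ~~ YQ F) by move=> F /andP[/YTZ /nzZ_on].
have dYQ_sub t : CL n dYQ t -> CL n YQ t by case: bYQ => -[_ _ _ _ H] _; exact: H.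
have dYQ_Q t : CL n dYQ t -> CL n Q t by case: bQ => -[_ _ _ _ H] _; exact: H.
(* Walking in the larger ball from [M] to the smaller one crosses a ridge of the border of the
   smaller ball that is interior to the larger one, hence not in [YQ]. *)
have M_D1 t : cl M t -> cl (nzB n (~~ s) l.+2 j) t -> cl Q t.
  move=> [F MF tF] [G D1G tG]; have /andP[DF D1F] := MF; apply: contrapT => nQ.
  have := @nzB_normal n s l j.+1 t M _ F G DF (D1D _ D1G) tF tG MF.
  rewrite /M D1G andbF => H; suff : false by []; apply: H => r v w tr ev ew /andP[_ D1v].
  apply/andP; split; first by case/andP: ew.
  apply/negP => D1w; apply: nQ; have ew1 : extends (nzB n (~~ s) l.+2 j) r w.
    by case/andP: ew => wr _; rewrite /extends wr.
  have [Zr nZr] := @nzB_crossing n s l j.+1 r v w ev D1v ew1.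
  by exists r => //; rewrite /Q Zr; apply: contra nZr => /YQT /YTZ.
have W_D1 t : 2 * j.+1 + l <= n.+2 -> cl W t -> cl (nzB n (~~ s) l.+2 j) t -> cl Q t.
  move=> b [r /andP[Zr nYr] tr] cD1; have /(nzB_border _ _ b)[v ev uv] := Zr.
  case: (boolP (nzB n (~~ s) l.+2 j (v |` r))) => D1v; last first.
    apply: M_D1 cD1; exists (v |` r); last exact: fsubset_trans tr (fsubsetUr _ _).
    by case/andP: ev => _ Dv; rewrite /M Dv.
  exists r => //; rewrite /Q nYr andbT; apply/nzB_border; first lia.
  exists v; first by case/andP: ev => vr _; rewrite /extends vr.
  move=> w /andP[wr /D1D Dw]; apply: uv; by rewrite /extends wr.
have WE t : CL n W t <-> CL n T t \/ CL n (fun F => YT F && ~~ YQ F) t.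
  apply: cl_or => F; rewrite /W /T; split=> [/andP[-> nYQ]|[/andP[-> nYT]|/andP[/YTZ -> //]]].
    by case: (boolP (YT F)) => YF /=; [right|left].
  by apply: contra nYT => /YQT.
(* In the extreme case [2 * j.+1 + l = n.+3] the two balls are empty and both borders are the
   cross-polytope; the replacement degenerates to the cone over [Q]. *)
have step1 : cone_ball R (apex n (~~ s) |` Vn n)
    (fun t => (~ (apex n (~~ s) \in t) /\ CL n M t) \/ CL n Q t)
    (fun t => (~ (apex n (~~ s) \in t) /\ CL n W t) \/ CL n dYQ t).
  case: (leqP (2 * j.+1 + l) n.+2) => b.
    have b1 : 2 * j + l.+2 <= n.+2 by lia.
    refine (@cone_ball_replace R (Vn n) (apex n (~~ s)) _ _ _ _ _ _ _ (CL n M) (CL n W) (apex_notin n (~~ s))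
      (@CL_down n M) (@CL_cylinder n M) (@CL_down n W) (@CL_cylinder n W) _ _ _ _ _ _ _ (bD b) (bD1 b1) bYQ bQ).
    - move=> t; apply: cl_or => F; rewrite /M; split=> [DF|[/andP[] //|/D1D //]].
      by rewrite DF; case: (boolP (nzB n (~~ s) l.+2 j F)); [right|left].
    - move=> t; apply: cl_or => F; rewrite /W; split=> [ZF|[/YQT /YTZ //|/andP[]//]].
      by rewrite ZF; case: (boolP (YQ F)); [left|right].
    - move=> t; apply: cl_or => F; rewrite /Q; split=> [ZF|[/YQZ //|/andP[]//]].
      by rewrite ZF; case: (boolP (YQ F)); [left|right].
    - by move=> t; exact: M_D1.
    - by move=> t; exact: W_D1.
    - by move=> t Wt YQt; exact: RQ.
    - by move=> t Qt YQt; exact: RQ'.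
  have E : 2 * j.+1 + l = n.+3 by lia.
  have WQ : W = Q by rewrite /W /Q !nzZ_cross //; lia.
  have M0 t : ~ CL n M t by move=> [F /andP[/nzB_bound]]; lia.
  rewrite WQ; apply: cone_ball_ext (ball_cone_ball (ball_cone (apex_notin n (~~ s)) bQ)) => t.
    by move: (M0 t); atoms.
  by atoms.
have cQ : cylinder (apex n (~~ s) |` Vn n) (fun t =>
    (~ (apex n (~~ s) \in t) /\ CL n (fun F => YT F && ~~ YQ F) t) \/ CL n dYQ t).
  apply: cylinder_or; first by apply: cylinder_notin; exact: CL_cylinder.
  by apply: cylinderU1; exact: CL_cylinder.
have dQ : down (fun t =>
    (~ (apex n (~~ s) \in t) /\ CL n (fun F => YT F && ~~ YQ F) t) \/ CL n dYQ t).
  by down_tac; exact: CL_down.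
have cT := cone_ball_notin (apex_notin n (~~ s)) bT.
have RT1 t : CL n T t -> CL n (fun F => YT F && ~~ YQ F) t -> CL n dYT t.
  by move=> Tt Yt; apply: RT => //; apply: cl_sub Yt => F /andP[].
have RT2 t : CL n T t -> CL n dYQ t -> CL n dYT t.
  by move=> Tt /dYQ_sub Yt; apply: RT => //; exact: cl_sub Yt.
have := cone_ball_push (apex_notin2 n s) dQ cQ _ _ step1 cT.
rewrite (Vn_S n s : _ = apex n s |` (apex n (~~ s) |` Vn n)); move=> H; apply: cone_ball_ext (H _ _) => t.
- by rewrite CL_cone2 //; atoms.
- by rewrite CL_cone2 //; atoms.
- by move: (WE t) (RT1 t) (dYQ_Q t); atoms.
- by move: (RT1 t) (RT2 t); atoms.
Qed.

(** The cone over [X] is a ball although [X] is only assumed to be a [cone_ball]. Its border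
    contains [X] and therefore [Y], onto which the second cone is glued. *)
Lemma ball_suspension n s (X dX Y dY : facets) :
  on n X -> on n dX -> on n Y -> on n dY -> (forall F, Y F -> X F) ->
  (forall t, cl Y t -> cl (fun F => X F && ~~ Y F) t -> cl dY t) ->
  (forall t, cl Y t -> cl dX t -> cl dY t) ->
  cone_ball R (Vn n) (CL n X) (CL n dX) -> ball R (Vn n) (CL n Y) (CL n dY) ->
  ball R (Vn n.+1) (CL n.+1 (cone2 n s X Y noF))
    (CL n.+1 (cone2 n s dX dY (fun F => X F && ~~ Y F))).
Proof.
move=> Xn dXn Yn dYn YX XY YdX bX bY.
have Wn : on n (fun F => X F && ~~ Y F) by move=> F /andP[/Xn].
have dX_X t : CL n dX t -> CL n X t by case: bX => -[_ _ _ _ H] _; exact: H.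
have dY_Y t : CL n dY t -> CL n Y t by case: bY => -[_ _ _ _ H] _; exact: H.
have XE t : CL n X t <-> CL n Y t \/ CL n (fun F => X F && ~~ Y F) t.
  apply: cl_or => F; split=> [XF|[/YX //|/andP[//]]].
  by rewrite XF; case: (boolP (Y F)); [left|right].
have N0 t : ~ CL n noF t by move=> [].
have u_notin : apex n (~~ s) \notin apex n s |` Vn n.
  by rewrite !inE /apex apex_neq' (negbTE (apex_notin _ _)).
have b1 := ball_cone (apex_notin n s) bX.
have b2 := ball_notin (apex_notin n s) bY.
have cC : cylinder (apex n s |` Vn n) (fun t =>
    (~ (apex n s \in t) /\ CL n (fun F => X F && ~~ Y F) t) \/ CL n dX t).
  apply: cylinder_or; first by apply: cylinder_notin; exact: CL_cylinder.
  by apply: cylinderU1; exact: CL_cylinder.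
have dC : down (fun t =>
    (~ (apex n s \in t) /\ CL n (fun F => X F && ~~ Y F) t) \/ CL n dX t).
  by down_tac; exact: CL_down.
have := ball_push u_notin dC cC _ _ b1 b2.
rewrite (Vn_S n s : _ = apex n s |` (apex n (~~ s) |` Vn n)) fsetUCA; move=> H.
have XYt t : CL n Y t -> CL n (fun F => X F && ~~ Y F) t -> CL n dY t by exact: XY.
have YdXt t : CL n Y t -> CL n dX t -> CL n dY t by exact: YdX.
apply: ball_ext (H _ _) => t.
- by rewrite CL_cone2 //; move: (N0 t) (XE t); atoms.
- by rewrite CL_cone2 //; atoms.
- by move: (XE t) (dX_X t); atoms.
- by move: (XYt t) (YdXt t); atoms.
Qed.

Lemma ball_empty S (L dL : cpx) : (forall t, ~ L t) -> (forall t, ~ dL t) -> ball R S L dL.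
Proof.
move=> L0 dL0.
have -> : L = (fun=> False) by apply: cpx_ext => t; move: (L0 t); atoms.
have -> : dL = (fun=> False) by apply: cpx_ext => t; move: (dL0 t); atoms.
split; first by split.
move=> A B G [Gd Gb _ _ _] _ K Kd Kb _ _.
have -> : lhs B G (fun=> False) = rhs A G (fun=> False) (fun=> False).
  by apply: cpx_ext => t; rewrite /lhs /rhs; atoms.
apply: PLh_refl; first by apply: down_cup => //; rewrite /rhs; down_tac.
by apply: bounded_cup => //; apply: bounded_sub Gb _ => t [].
Qed.

Lemma cone_ball_CL n c dc : (forall F, ~~ dc F) -> cone_ball R (Vn n) (CL n c) (CL n dc).
Proof.
move=> dc0; have -> : CL n dc = (fun=> False).
  by apply: cpx_ext => t; split=> // -[F]; rewrite (negbTE (dc0 F)).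
by apply: cone_ball_closed; [exact: CL_down|exact: CL_cylinder].
Qed.

Lemma ball_CL0 n (c dc : facets) : (forall F, ~~ c F) -> (forall F, ~~ dc F) ->
  ball R (Vn n) (CL n c) (CL n dc).
Proof. by move=> c0 d0; apply: ball_empty => t [F]; rewrite ?(negbTE (c0 F)) ?(negbTE (d0 F)). Qed.

(** For positive excess the complexes are suspensions and the full exchange property is obtained.
    For excess 0 they are complements of balls in spheres, where [cone_ball_step] yields the weaker
    property; that is enough for the next suspension. *)
Lemma nz_balls n :
  (forall s l j, 2 * j + l <= n.+2 -> cone_ball R (Vn n) (CL n (nzB n s l j)) (CL n (nzZ n s l j))) /\
  (forall s l j, 2 * j + l.+1 <= n.+2 -> ball R (Vn n) (CL n (nzB n s l.+1 j)) (CL n (nzZ n s l.+1 j))) /\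
  (forall s l j, 2 * j + l <= n.+2 -> cone_ball R (Vn n) (CL n (nzC n s l j)) (CL n (nzZ n s l j))) /\
  (forall s l j, 2 * j.+1 + l <= n.+2 ->
     cone_ball R (Vn n) (CL n (nzD n s l j.+1)) (CL n (nzZ n s l.+2 j))).
Proof.
have Z0 m s l : l <= m.+2 -> forall F, ~~ nzZ m s l 0 F.
  by move=> lm F; apply/negP => /nzZ_j0; lia.
have B0 m s l F : ~~ nzB m s l 0 F by rewrite nzB_j0.
elim: n => [|n [IA [IB [IC ID]]]].
  have E s l j : 2 * j + l <= 2 -> forall F, ~~ nzZ 0 s l j F.
    by move=> jl F; apply/negP => /andP[_ /eqP]; lia.
  split; [|split; [|split]] => s l j jl.
  - by apply: cone_ball_CL; exact: E.
  - apply: ball_CL0; last exact: E.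
    by move=> F; apply/negP => /and3P[].
  - by apply: cone_ball_CL; exact: E.
  - by apply: cone_ball_CL; apply: E; lia.
have P := nz_inclusionsP n.
have HB s l j : 2 * j + l.+1 <= n.+3 ->
    ball R (Vn n.+1) (CL n.+1 (nzB n.+1 s l.+1 j)) (CL n.+1 (nzZ n.+1 s l.+1 j)).
  case: j => [|j] jl; first by apply: ball_CL0 => //; exact: Z0.
  rewrite nzB_S nzZ_S.
  have D1D F : nzB n (~~ s) l.+2 j F -> nzB n s l j.+1 F by exact: (@nzB_opp _ P s l j.+1).
  have cross_dY t : cl (nzB n (~~ s) l.+2 j) t ->
      cl (fun F => nzB n s l j.+1 F && ~~ nzB n (~~ s) l.+2 j F) t -> cl (nzZ n (~~ s) l.+2 j) t.
    move=> [G D1G tG] [F MF tF]; apply: contrapT => nQ; have /andP[DF D1F] := MF.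
    have := @nzB_normal n s l j.+1 t (fun F => ~~ nzB n (~~ s) l.+2 j F) _ F G DF (D1D _ D1G) tF tG D1F.
    rewrite D1G => H; suff : false by []; apply: H => r v w tr ev ew D1v.
    apply/negP => D1w; apply: nQ; have ew1 : extends (nzB n (~~ s) l.+2 j) r w.
      by case/andP: ew => wr _; rewrite /extends wr.
    by have [Zr _] := @nzB_crossing n s l j.+1 r v w ev D1v ew1; exists r.
  apply: ball_suspension => //; try exact: nzB_on; try exact: nzZ_on.
  - move=> t cY [r Zr tr]; have /nzB_border[|v ev uv] := Zr; first lia.
    have tvr : t `<=` v |` r by exact: fsubset_trans tr (fsubsetUr _ _).
    case: (boolP (nzB n (~~ s) l.+2 j (v |` r))) => Yv; last first.
      by apply: cross_dY => //; exists (v |` r) => //; case/andP: ev => _ ->.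
    exists r => //; apply/nzB_border; first lia.
    exists v; first by case/andP: ev => vr _; rewrite /extends vr.
    by move=> w /andP[wr /D1D Dw]; apply: uv; rewrite /extends wr.
  - by apply: IA; lia.
  - by apply: IB; lia.
have HD s l j : 2 * j.+1 + l <= n.+3 ->
    cone_ball R (Vn n.+1) (CL n.+1 (nzD n.+1 s l j.+1)) (CL n.+1 (nzZ n.+1 s l.+2 j)).
  move=> jl; rewrite nzD_S.
  have YTZ F : nzB n s l.+1 j F -> nzZ n s l j.+1 F.
    case: l {jl} => [|l]; last exact: (@nzB2_Z _ P s l j.+1).
    by rewrite nzZ_0; exact: (@nzB_Z _ P s 1 j).
  (* For [j = 0] the deleted ball is empty and gets an empty border. This agrees with the recursion,
     as [nzZ] with second index 0 vanishes for these sizes. *)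
  pose dYQ := if j is i.+1 then nzZ n (~~ s) l.+3 i else noF.
  have -> : nzZ n.+1 s l.+2 j = cone2 n s (nzZ n s l.+1 j) dYQ
      (fun F => nzB n s l.+1 j F && ~~ nzB n (~~ s) l.+3 j.-1 F).
    rewrite /dYQ; case: (j) jl => [|i] jl; last by rewrite nzZ_S.
    apply/funext => F; rewrite (negbTE (Z0 _ _ _ _ _)); last lia.
    rewrite /cone2 nzB_j0 (negbTE (Z0 _ _ _ _ _)); last lia.
    by case: ((n, s) \in F); case: ((n, ~~ s) \in F).
  have dYQn : on n dYQ by rewrite /dYQ; case: (j) => [//|i]; exact: nzZ_on.
  have YQT F : nzB n (~~ s) l.+3 j.-1 F -> nzB n s l.+1 j F by exact: (@nzB_opp _ P s l.+1 j).
  have YQZ F : nzB n (~~ s) l.+3 j.-1 F -> nzZ n (~~ s) l.+2 j F.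
    by exact: (@nzB2_Z _ P (~~ s) l.+1 j).
  have frQ s' l' j' t : (forall F, nzB n (~~ s) l.+3 j.-1 F -> nzZ n s' l' j' F) ->
      cl (nzB n (~~ s) l.+3 j.-1) t ->
      cl (fun F => nzZ n s' l' j' F && ~~ nzB n (~~ s) l.+3 j.-1 F) t -> cl dYQ t.
    rewrite /dYQ; case: (j) jl => [|i] jl sub; first by move=> [F]; rewrite nzB_j0.
    by apply: nzB_frontier => //; lia.
  apply: cone_ball_step => //; try exact: nzZ_on.
  - by move=> t; apply: nzB_frontier => //; lia.
  - by move=> t; apply: frQ => F /YQT /YTZ.
  - by move=> t; exact: frQ.
  - by move=> b; apply: IA.
  - by move=> b; apply: IB.
  - rewrite /dYQ; case: (j) jl => [|i] jl; last by apply: IB; lia.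
    by apply: ball_CL0 => // F; rewrite nzB_j0.
  - rewrite /dYQ; case: (j) jl => [|i] jl; last by apply: ID; lia.
    exact: cone_ball_CL.
  - case: (l) jl => [|l'] jl; last by apply: (ID s l' j); lia.
    by rewrite nzZ_0; apply: (IC s 1 j); lia.
split; [|split; [|split]] => // s l j jl.
- case: l jl => [|l] jl; last by apply: ball_cone_ball; exact: HB.
  case: j jl => [|j] jl; first by apply: cone_ball_CL; exact: Z0.
  by rewrite nzB_D nzZ_0; exact: HD.
- case: j jl => [|j] jl; first by apply: cone_ball_CL; apply: Z0; lia.
  case: l jl => [|l] jl.
    by rewrite nzC_0 nzZ_0; apply: ball_cone_ball; apply: HB; lia.
  rewrite nzC_S nzZ_S.
  apply: cone_ball_step => //; try exact: nzZ_on; try lia.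
  - exact: (@nzB_opp _ P s l j.+1).
  - exact: (@nzB_Z _ P s l j.+1).
  - exact: (@nzB_Z _ P (~~ s) l.+2 j).
  - by move=> t; apply: nzB_frontier; [lia|exact: (@nzB_Z _ P s l j.+1)].
  - move=> t; apply: nzB_frontier; [lia|move=> F YF; apply: (@nzB_Z _ P s l j.+1)].
    exact: (@nzB_opp _ P s l j.+1).
  - by move=> t; apply: nzB_frontier; [lia|exact: (@nzB_Z _ P (~~ s) l.+2 j)].
  - by move=> b; apply: IA.
  - by move=> b; apply: IB; lia.
  - by apply: IB; lia.
  - by apply: (IC (~~ s) l.+2 j); lia.
  - by apply: (IC s l j.+1); lia.
Qed.

Lemma nzB_ball n s l j : 2 * j + l.+1 <= n.+2 ->
  ball R (Vn n) (CL n (nzB n s l.+1 j)) (CL n (nzZ n s l.+1 j)).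
Proof. exact: (nz_balls n).2.1. Qed.

End Balls.

(** * Spheres *)

Section Sphere.
Variable R : realType.

Lemma PLrel_PLh b X Y : PLrel R b X Y -> PLh R X Y.
Proof.
have E Z : cup (fun=> False) Z = Z by apply: cpx_ext => s; rewrite /cup; tauto.
move=> XY; rewrite -(E X) -(E Y); apply: XY => //.
by exists 0 => s.
Qed.

Definition proper_faces (B : {fset U}) : cpx := fun s => s `<=` B /\ ~ (B `<=` s).

(* The join of the boundary of the simplex [B] with the cross-polytope on the indices [I]. *)
Definition simplex_cross (B : {fset U}) (I : seq nat) : cpx := fun s =>
  [/\ forall u, u \in s -> u \in B \/ u.1 \in I, ~ (B `<=` s) &
      forall i, i \in I -> (i, true) \in s -> (i, false) \notin s].

Lemma down_simplex_cross B I : down (simplex_cross B I).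
Proof.
move=> s t [s1 s2 s3] /fsubsetP ts; split.
- by move=> u /ts /s1.
- by move=> Bt; apply: s2; apply: fsubset_trans Bt _; exact/fsubsetP.
- by move=> i iI /ts /(s3 i iI); apply: contra => /ts.
Qed.

Lemma bounded_simplex_cross B I : bounded (simplex_cross B I).
Proof.
have [m Bm] := fset_bound B; exists (maxn m (\max_(i <- I) i).+1) => s [s1 _ _] u /s1 [/Bm|uI]; first lia.
rewrite leq_max ltnS; apply/orP; right.
exact: (@leq_bigmax_seq _ I xpredT id).
Qed.

(** The suspension of [dB] with poles [(i, true)] and [(i, false)] becomes the boundary of one
    larger simplex when the star of [(i, true)] is flattened to [B]. *)
Lemma simplex_cross_flip B i I : B != fset0 -> i \notin I -> (forall u, u \in B -> u.1 \notin i :: I) ->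
  PLh R (simplex_cross B (i :: I)) (simplex_cross ((i, false) |` B) I).
Proof.
move=> B0 iI BI.
have Bi b : (i, b) \notin B by apply/negP => /BI; rewrite inE eqxx.
have BU u j b : u \in B -> j \in i :: I -> ((j, b) == u :> U) = false.
  by move=> uB jI; apply/eqP => E; have := BI u uB; rewrite -E jI.
apply: (@PLh_flip R [fset ((i, true) : U)] B) => //; try exact: down_simplex_cross;
  try exact: bounded_simplex_cross.
- by apply/fset0Pn; exists (i, true); rewrite inE.
- by rewrite fdisjoint1X Bi.
- by move=> s [_ /negP].
- move=> s [s1 _ _]; rewrite fsub1set; apply/negP => /s1 /=.
  rewrite !inE (negbTE (Bi true)) orbF (negbTE iI) => -[|//].
  by rewrite xpair_eqE andbF.
- move=> s [s1 s2 s3]; rewrite fsub1set => it; split.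
  + move=> -[j b] js; case: (s1 _ js) => [uB|]; first by left; rewrite !inE uB orbT.
    rewrite /= !inE => /orP[/eqP E|]; last by right.
    by left; move: js it; rewrite E; case: b => [-> //|_ _]; rewrite eqxx.
  + by rewrite fsubUset => /andP[_].
  + by move=> j jI; apply: s3; rewrite inE jI orbT.
- move=> s [s1 s2 s3] /negP nB; split=> //.
  + move=> u /s1; rewrite !inE => -[/orP[/eqP ->|->]|->]; rewrite /= ?eqxx ?orbT; by [left|right].
  + move=> j; rewrite inE => /orP[/eqP ->|/s3 //] /s1.
    by rewrite !inE xpair_eqE andbF (negbTE (Bi true)) /= (negbTE iI) => -[].
- move=> s t [s1 s2 s3]; rewrite fsub1set => is1 tA At.
  have t0 : t = fset0.
    by move: tA; rewrite fsubset1 => /orP[/eqP tE|/eqP //]; rewrite tE fsubset_refl in At.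
  have if0 : (i, false) \notin s by apply: s3 => //; rewrite inE eqxx.
  rewrite t0 fsetU0; split.
  + move=> -[j b]; rewrite !inE => /orP[/andP[jb /s1 /= [jB|]]|->]; rewrite ?orbT; try by left.
      by left; rewrite jB orbT.
    rewrite inE => /orP[/eqP E|]; last by right.
    by left; move: jb; rewrite E !xpair_eqE eqxx; case: b.
  + rewrite fsubUset fsub1set !inE => /andP[/orP[/andP[_]|]].
      by rewrite (negbTE if0).
    by rewrite (negbTE (Bi false)).
  + move=> j jI; have jI' : j \in i :: I by rewrite inE jI orbT.
    have nB b : (j, b) \notin B by apply/negP => /BI; rewrite jI'.
    rewrite !inE !(negbTE (nB _)) !orbF => /andP[_ /s3 H].
    by rewrite (negbTE (H jI')) andbF.
- move=> s t [s1 s2 s3] Bs tB Bt.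
  have if0 : (i, false) \notin s.
    by apply/negP => is0; apply: s2; rewrite fsubUset fsub1set is0 Bs.
  split.
  + move=> u; rewrite !inE -orbA => /or3P[/andP[uB /s1]|/(fsubsetP tB) ->|/eqP ->]; try by left.
      rewrite !inE (negbTE uB) orbF => -[/eqP ->|->]; right=> /=; by rewrite ?eqxx ?orbT.
    by right; rewrite /= eqxx.
  + move=> /fsubsetP H; case/negP: Bt; apply/fsubsetP => u uB.
    have := H u uB; rewrite !inE uB /= => /orP[//|/eqP E].
    by move: (Bi true); rewrite -E uB.
  + move=> j jI; have nB b : (j, b) \notin B by apply/negP => /BI; rewrite jI.
    have nt b : (j, b) \notin t by apply: contra (nB b); exact: (fsubsetP tB).
    rewrite !inE !xpair_eqE !(negbTE (nB _)) !(negbTE (nt _)) /= andbF !orbF.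
    have [-> _ //|ji] := eqVneq j i; rewrite orbF; apply: s3.
    by move: jI; rewrite inE (negbTE ji).
Qed.

Lemma simplex_cross_simplex I B : uniq I -> B != fset0 -> (forall u, u \in B -> u.1 \notin I) ->
  exists2 B', #|` B'| = #|` B| + size I & PLh R (simplex_cross B I) (proper_faces B').
Proof.
elim: I B => [|i I IH] B.
  move=> _ _ _; exists B; first by rewrite addn0.
  rewrite (_ : simplex_cross B [::] = proper_faces B).
    apply: PLh_refl; first by move=> s t [sB nB] ts; split; [exact: fsubset_trans ts sB|
      move=> Bt; apply: nB; exact: fsubset_trans ts].
    have [m Bm] := fset_bound B; exists m => s [sB _] u us; apply: Bm; exact: (fsubsetP sB).
  apply: cpx_ext => s; split=> [[s1 s2 _]|[/fsubsetP s1 s2]]; split=> //; last by move=> u /s1; left.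
  by apply/fsubsetP => u /s1 [].
move=> /= /andP[iI uI] B0 BI; have [||B' cB' H] := IH ((i, false) |` B) uI.
- by apply/fset0Pn; exists (i, false); rewrite !inE eqxx.
- move=> u; rewrite !inE => /orP[/eqP -> //|/BI]; by rewrite inE negb_or => /andP[].
exists B'.
  rewrite cB' cardfsU1 (_ : (i, false) \notin B) ?addSnnS //.
  by apply/negP => /BI; rewrite inE eqxx.
apply: PLh_trans (simplex_cross_flip B0 iI BI) H; try exact: down_simplex_cross.
move=> s t [sB nB] ts; split; first exact: fsubset_trans ts sB.
by move=> Bt; apply: nB; exact: fsubset_trans ts.
Qed.

Lemma PL_simplex_boundary n d X B : down X -> bounded_by n X -> #|` B| = d.+1 ->
  PLh R X (proper_faces B) -> PL_homeomorphic R (carrier n X) (simplex_boundary d).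
Proof.
move=> Xd Xn cB [m [Xm Bm XB]].
have Pd : down (proper_faces B).
  move=> s t [sB nB] ts; split; first exact: fsubset_trans ts sB.
  by move=> Bt; apply: nB; exact: fsubset_trans ts.
have [m' Bm'] := fset_bound B; pose M := maxn (maxn m n) m'.
have Xn_M : PL_homeomorphic R (carrier n X) (carrier M X) by apply: PL_carrier => //; rewrite /M; lia.
apply: (PL_homeomorphic_trans Xn_M).
have XB' : PL_homeomorphic R (carrier M X) (carrier M (proper_faces B)).
  by apply: PL_carrier2 XB => //; rewrite /M; lia.
apply: (PL_homeomorphic_trans XB'); apply: PL_homeomorphic_sym.
have BE : face_of (trace M B) = B by apply: face_of_trace => u /Bm' ?; rewrite /M; lia.
have cT : #|trace M B| = d.+1.
  rewrite -cB -[in RHS]BE card_in_imfset; last by move=> ? ? _ _; exact: vertex_inj.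
  by rewrite cardE.
pose phi (i : 'I_d.+1) : V M := enum_val (cast_ord (esym cT) i).
have phiI : injective phi by move=> i j /enum_val_inj /cast_ord_inj.
have phiT : phi @: setT = trace M B.
  apply/eqP; rewrite eqEcard card_imset // cardsT card_ord cT leqnn andbT.
  by apply/subsetP => v /imsetP[i _ ->]; exact: enum_valP.
apply: (@PL_relabel R _ _ phi) => //.
  move=> s t; rewrite !inE => sp ts; exact: sub_proper_trans ts sp.
move=> s; rewrite in_carrier; apply/asboolP/existsP.
  move=> [sB nB]; exists (phi @^-1: s).
  have sT : s \subset trace M B by rewrite -face_of_sub BE.
  have sE : s = phi @: (phi @^-1: s).
    apply/setP => v; apply/idP/imsetP => [vs|[i]]; last by rewrite inE => ? ->.
    have : v \in phi @: setT by rewrite phiT (subsetP sT).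
    by move=> /imsetP[i _ vE]; exists i => //; rewrite inE -vE.
  rewrite -sE eqxx andbT inE properT; apply/negP => /eqP sT'.
  by apply: nB; rewrite sE sT' phiT BE.
move=> [t /andP[]]; rewrite inE properT => tT /eqP ->.
have tB : phi @: t \subset trace M B by rewrite -phiT imsetS // subsetT.
split; first by rewrite -BE face_of_sub.
rewrite -BE face_of_sub -phiT => H; case/negP: tT; rewrite eqEsubset subsetT /=.
by apply/subsetP => i _; have := subsetP H _ (imset_f phi (in_setT i)); rewrite mem_imset.
Qed.

End Sphere.

(** * The join of a sphere with the 4-cycle *)

Section Join.
Variable R : realType.
Variables N r : nat.

(* Faces whose vertices of index below [N] lie in [Q], the other ones forming a
   face of the 4-cycle on the indices [N] and [N.+1]. *)
Definition ambient (Q : {fset U}) : cpx := fun s =>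
  (forall v, v \in s -> v \in Q \/ N <= v.1 < N.+2) /\
  (forall i, N <= i -> (i, true) \in s -> (i, false) \notin s).

Definition joined (m : nat) : cpx := fun s =>
  ambient (Vn m) s /\ CL m (nzZ m false 1 r.+1) s.

Lemma down_ambient Q : down (ambient Q).
Proof.
move=> s t [s1 s2] /fsubsetP ts; split; first by move=> v /ts /s1.
by move=> i Ni /ts /(s2 i Ni); apply: contra => /ts.
Qed.

Lemma bounded_ambient Q : Q `<=` Vn N -> bounded (ambient Q).
Proof.
move=> QN; exists N.+2 => s [s1 _] v /s1 [/(fsubsetP QN)|/andP[] //].
by rewrite in_Vn; lia.
Qed.

Lemma ambient_independent Q : Q `<=` Vn N -> independent Q (ambient Q).
Proof.
move=> QN s t st [s1 s2]; split.
  move=> v vt; case: (boolP (v \in Q)) => vQ; first by left.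
  by have := s1 v; rewrite (negbTE vQ) st // => /(_ vt).
move=> i Ni; have iQ b : (i, b) \notin Q.
  by apply/negP => /(fsubsetP QN); rewrite in_Vn /=; lia.
by rewrite -!st //; exact: s2.
Qed.

Lemma ambientU1 Q (u : U) s : u.1 < N -> u \notin Q ->
  ambient Q s <-> ambient (u |` Q) s /\ ~ (u \in s).
Proof.
move=> uN uQ; split=> [[s1 s2]|[[s1 s2] us]].
  split; first by split=> // v /s1 [vQ|]; [left; rewrite inE vQ orbT|right].
  by move/s1 => [|]; [rewrite (negbTE uQ)|lia].
split=> // v vs; case: (s1 v vs); last by right.
by rewrite !inE => /orP[/eqP E|]; [rewrite E in vs|left].
Qed.

Lemma frame_ambient Q S (u : U) : Q `<=` Vn N -> Q = u |` S -> u \notin S ->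
  frame S fset0 [fset u] (ambient Q).
Proof.
move=> QN QE uS; split.
- exact: down_ambient.
- exact: bounded_ambient.
- by move=> s t st; apply: ambient_independent => // v vQ; apply: st; move: vQ; rewrite QE !inE orbF orbC.
- by [].
- by move=> v vS; split=> //; rewrite inE; apply: contraNneq uS => <-.
Qed.

Lemma down_joined m : down (joined m).
Proof. by move=> s t [s1 s2] ts; split; [exact: down_ambient ts|exact: CL_down ts]. Qed.

Lemma bounded_joined m : m <= N -> bounded (joined m).
Proof.
move=> mN; apply: (@bounded_sub _ (ambient (Vn m))) => [|s []//].
apply: bounded_ambient; apply/fsubsetP => v; rewrite !in_Vn; lia.
Qed.

(** Passing from index bound [m] to [m.+1] replaces two antipodal balls by cones. Each replacement
    is the exchange of a ball with [A] empty, [B] the new apex and the 4-cycle as part of [G]. *)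
Lemma joined_step m : 2 * r <= m -> m < N -> PLh R (joined m) (joined m.+1).
Proof.
move=> rm mN; have P := nz_inclusionsP m.
pose X := nzZ m false 1 r.+1.
pose B b := nzB m b 2 r; pose dB b := nzZ m b 2 r.
pose u := apex m false; pose u' := apex m true.
have Bn b : on m (B b) by exact: nzB_on.
have dBn b : on m (dB b) by exact: nzZ_on.
have BX b F : B b F -> X F.
  move=> BF; have := @nzB2_Z _ P b 0 r.+1 F BF.
  by rewrite /X; case: b BF => // _; rewrite -(nzZ_sym P).
have B12 F : B true F -> B false F -> False.
  move=> B1; apply: (@nzB_disjoint _ P false 0 r.+1 F).
  exact: (@nzB_opp _ P false 0 r.+1).
have ball_B b : ball R (Vn m) (CL m (B b)) (CL m (dB b)) by apply: nzB_ball; lia.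
have dB_B b t : CL m (dB b) t -> CL m (B b) t by case: (ball_B b) => -[_ _ _ _ H] _; exact: H.
have fr b t : CL m (fun F => X F && ~~ B b F) t -> CL m (B b) t -> CL m (dB b) t.
  by move=> cX cB; apply: (nzB_frontier _ _ cB cX); [lia|exact: BX].
pose W := fun F => [&& X F, ~~ B false F & ~~ B true F].
have Wn : on m W by move=> F /and3P[/nzZ_on].
have XE t : CL m X t <-> CL m (B false) t \/ CL m (fun F => X F && ~~ B false F) t.
  apply: cl_or => F; split=> [XF|[/BX //|/andP[//]]].
  by rewrite XF; case: (boolP (B false F)); [left|right].
have X1E t : CL m (fun F => X F && ~~ B false F) t <-> CL m (B true) t \/ CL m W t.
  apply: cl_or => F; rewrite /W; split=> [/andP[-> ->]|[B1|/and3P[-> -> //]]].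
    by case: (boolP (B true F)) => BF; [left|right].
  by rewrite (BX _ _ B1); apply/negP; exact: B12 B1.
have WX t b : CL m W t -> CL m (fun F => X F && ~~ B b F) t.
  by apply: CL_sub => F /and3P[-> BF1 BF2]; case: b.
have B1X t : CL m (B false) t -> CL m (fun F => X F && ~~ B true F) t.
  by apply: CL_sub => F BF; rewrite (BX _ _ BF); apply/negP => /B12; exact.
have ZE t : CL m.+1 (nzZ m.+1 false 1 r.+1) t <->
    (~ (u' \in t) /\ CL m (dB false) t) \/ (~ (u \in t) /\ CL m (dB true) t) \/
    ((~ (u \in t) /\ ~ (u' \in t)) /\ CL m W t).
  rewrite -(@CL_cone2 m false (dB false) (dB true) W t) //.
  suff -> : nzZ m.+1 false 1 r.+1 = cone2 m false (dB false) (dB true) W by [].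
  by apply/funext => F; rewrite nzZ_1.
have uV : u \notin Vn m by exact: apex_notin.
have uV' : u' \notin Vn m by exact: apex_notin.
have uu' : u \notin u' |` Vn m by exact: (apex_notin2 m false).
have uu : u' \notin u |` Vn m by exact: (apex_notin2 m true).
have VS : Vn m.+1 = u |` (u' |` Vn m) by exact: (Vn_S m false).
have VSN : Vn m.+1 `<=` Vn N by apply/fsubsetP => v; rewrite !in_Vn; lia.
pose GA := ambient (Vn m.+1).
have G1 t : ambient (u |` Vn m) t <-> GA t /\ ~ (u' \in t).
  by rewrite (@ambientU1 _ u') // /GA VS fsetUCA.
have G2 t : ambient (u' |` Vn m) t <-> GA t /\ ~ (u \in t).
  by rewrite (@ambientU1 _ u) // /GA VS.
have G0 t : ambient (Vn m) t <-> (GA t /\ ~ (u \in t)) /\ ~ (u' \in t).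
  by rewrite (@ambientU1 _ u') // G2.
have f1 : frame (Vn m) fset0 [fset u] (ambient (u |` Vn m)).
  apply: frame_ambient => //; apply: fsubset_trans VSN; rewrite VS fsetUCA; exact: fsubsetUr.
have f2 : frame (Vn m) fset0 [fset u'] (ambient (u' |` Vn m)).
  apply: frame_ambient => //; apply: fsubset_trans VSN; rewrite VS; exact: fsubsetUr.
have e1 := (ball_B false).2 _ _ _ f1; have e2 := (ball_B true).2 _ _ _ f2.
have facts1 t := conj (G1 t) (conj (G0 t) (conj (XE t) (conj (fr false t)
  (conj (dB_B false t) (conj (sub1P u t) (sub0P t)))))).
have facts2 t := conj (G2 t) (conj (ZE t) (conj (X1E t) (conj (fr true t) (conj (WX t true)
  (conj (B1X t) (conj (dB_B false t) (conj (dB_B true t) (conj (sub1P u' t) (sub0P t))))))))).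
have GAd : down GA by exact: down_ambient.
have GAb : bounded GA by exact: bounded_ambient.
have cld c : down (CL m c) by exact: CL_down.
(* The intermediate complex: the ball of one sign is coned off, the other one is still in place. *)
pose K t := GA t /\ ((~ (u' \in t) /\ CL m (dB false) t) \/
  ((~ (u \in t) /\ ~ (u' \in t)) /\ CL m (fun F => X F && ~~ B false F) t)).
apply: (@PLh_trans R _ K); try exact: down_joined.
- by rewrite /K; down_tac.
{ apply: (@PLrel_PLh R (fun=> False)).
  apply: (PLrel_step (E := fun t => ((GA t /\ ~ (u \in t)) /\ ~ (u' \in t)) /\
     CL m (fun F => X F && ~~ B false F) t)) (e1 _).
  1: by down_tac.
  1: by apply: bounded_sub GAb _ => s [[[]]].
  7: by apply/fset0Pn; exists u; rewrite inE.
  all: by move=> t; move: (facts1 t); rewrite /joined /lhs /rhs /K -/X; atoms. }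
apply: (@PLrel_PLh R (fun=> False)).
apply: (PLrel_step (E := fun t => (GA t /\ ~ (u' \in t)) /\
   (CL m (dB false) t \/ (~ (u \in t) /\ CL m W t)))) (e2 _).
1: by down_tac.
1: by apply: bounded_sub GAb _ => s [[]].
7: by apply/fset0Pn; exists u'; rewrite inE.
all: by move=> t; move: (facts2 t); rewrite /joined /lhs /rhs /K -/GA; atoms.
Qed.

Lemma joined_sphere : 0 < r -> 2 * r <= N -> exists2 B, #|` B| = 2 * r.+1 + 1 &
  PLh R (joined N) (proper_faces B).
Proof.
move=> r0 rN.
have Pd B : down (proper_faces B).
  move=> s t [sB nB] ts; split; first exact: fsubset_trans ts sB.
  by move=> Bt; apply: nB; exact: fsubset_trans ts.
suff [B cB H] : exists2 B, #|` B| = 2 * r.+1 + 1 & PLh R (joined (2 * r)) (proper_faces B).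
  exists B => //; have : 2 * r <= N by [].
  have gen m : 2 * r <= m <= N -> PLh R (joined m) (proper_faces B).
    elim: m => [|m IH] /andP[rm mN]; first by move: H; rewrite (_ : 2 * r = 0) //; lia.
    have [E|rm'] := eqVneq (2 * r) m.+1; first by rewrite -E.
    apply: (@PLh_trans R _ (joined m)); try exact: down_joined; try exact: Pd.
      by apply: PLh_sym; apply: joined_step; lia.
    by apply: IH; lia.
  by move=> _; apply: gen; rewrite rN leqnn.
(* For [m = 2 * r] the sphere is a cross-polytope, and so is its join with the 4-cycle. The two
   vertices of index [N] serve as the boundary of the first simplex, and the other [2 * r + 1]
   indices enlarge it one at a time. *)
pose B0 := [fset ((N, true) : U); (N, false)].
have [||| B cB H] := @simplex_cross_simplex R (N.+1 :: iota 0 (2 * r)) B0.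
- by rewrite /= iota_uniq andbT mem_iota; lia.
- by apply/fset0Pn; exists (N, true); rewrite !inE eqxx.
- by move=> v; rewrite !inE => /orP[] /eqP -> /=; rewrite mem_iota; lia.
exists B.
  rewrite cB cardfs2 xpair_eqE andbF /= size_iota; lia.
suff -> : joined (2 * r) = simplex_cross B0 (N.+1 :: iota 0 (2 * r)) by [].
apply: cpx_ext => s; rewrite /joined nzZ_cross; last lia.
split=> [[[s1 s2] [F cF sF]]|[s1 s2 s3]].
  split.
  - move=> v vs; have := s1 v vs; rewrite in_Vn !inE mem_iota -!pair_eqE.
    by move: v {vs} => [i b] /=; case: b; rewrite ?andbT ?andbF ?orbF /= => -[]; [right; lia|lia|right; lia|lia].
  - move=> /fsubsetP H0; have h b : (N, b) \in s by apply: H0; rewrite !inE; case: b; rewrite eqxx ?orbT.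
    by have := s2 N (leqnn _) (h true); rewrite h.
  - move=> i; rewrite inE mem_iota => /orP[/eqP ->|ir]; first by apply: s2; lia.
    move=> it; apply/negP => if_; have fF := cross_unpaired cF.
    have inF b : (i, b) \in s -> (i, b) \in F.
      by move=> ib; apply: (fsubsetP sF); rewrite inE ib in_Vn /=; lia.
    by have := fF i true (inF _ it); rewrite inF.
have sB b : (N, b) \in B0 by rewrite !inE; case: b; rewrite eqxx ?orbT.
split.
  split.
    move=> v /s1 []; first by rewrite !inE => /orP[] /eqP ->; right=> /=; lia.
    by rewrite in_Vn inE mem_iota => /orP[/eqP ->|]; [right; lia|left; lia].
  move=> i Ni it; apply/negP => if_; have [E|iN] := eqVneq i N.
    by apply: s2; apply/fsubsetP => v; rewrite !inE -E => /orP[] /eqP ->.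
  have : i \in N.+1 :: iota 0 (2 * r).
    case: (s1 _ it) => //; rewrite !inE !xpair_eqE (negbTE iN) //=.
  by move=> /s3 /(_ it); rewrite if_.
apply: cross_full; first exact: fsubsetIr.
move=> i b; rewrite !inE !in_Vn /= => /andP[ib ir]; rewrite ir andbT.
have /s3 H' : i \in N.+1 :: iota 0 (2 * r) by rewrite inE mem_iota; lia.
case: b ib => ib; first exact: H'.
by apply/negP => /H'; rewrite ib.
Qed.

End Join.

(** * Antipodes, facets and missing faces *)

Definition antipode (u : U) : U := (u.1, ~~ u.2).

Definition opp_face (t : {fset U}) : {fset U} := [fset antipode u | u in t].

Lemma antipodeK : involutive antipode.
Proof. by move=> [i b]; rewrite /antipode /= negbK. Qed.

Lemma in_opp_face u t : (u \in opp_face t) = (antipode u \in t).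
Proof. by rewrite -{1}(antipodeK u) mem_imfset //; exact: (can_inj antipodeK). Qed.

Lemma opp_faceK : involutive opp_face.
Proof. by move=> t; apply/fsetP => u; rewrite !in_opp_face antipodeK. Qed.

Lemma opp_face_sub s t : (opp_face s `<=` opp_face t) = (s `<=` t).
Proof.
apply/fsubsetP/fsubsetP => H u; last by rewrite !in_opp_face => /H.
by move=> us; have := H (antipode u); rewrite !in_opp_face antipodeK; exact.
Qed.

Lemma opp_faceD1 t n s : opp_face t `\ (n, s) = opp_face (t `\ (n, ~~ s)).
Proof.
apply/fsetP => -[i b]; rewrite !(inE, in_opp_face) /antipode /= !xpair_eqE.
by congr (~~ (_ && _) && _); case: b; case: s.
Qed.

Lemma cone2_opp n s (X Y M X' Y' M' : facets) F :
  (forall F, X (opp_face F) = X' F) -> (forall F, Y (opp_face F) = Y' F) -> (forall F, M (opp_face F) = M' F) ->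
  cone2 n s X Y M (opp_face F) = cone2 n (~~ s) X' Y' M' F.
Proof. by move=> XX YY MM; rewrite /cone2 !in_opp_face /antipode /= !opp_faceD1 XX YY MM negbK. Qed.

Lemma opp_face0 : opp_face fset0 = fset0.
Proof. by apply/fsetP => u; rewrite in_opp_face !inE. Qed.

Lemma nz_opp n : (forall s l j F, nzB n s l j (opp_face F) = nzB n (~~ s) l j F) /\
  (forall s l j F, nzZ n s l j (opp_face F) = nzZ n (~~ s) l j F).
Proof.
elim: n => [|n [IB IZ]].
  have E F : (opp_face F == fset0) = (F == fset0) by rewrite -{1}opp_face0 (inj_eq (can_inj opp_faceK)).
  by split=> s l j F; rewrite /nzB /nzZ /= E.
have HZ s l j F : nzZ n.+1 s l.+1 j (opp_face F) = nzZ n.+1 (~~ s) l.+1 j F.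
  by rewrite !nzZ_S; apply: cone2_opp => // {}F; rewrite !IB.
have HZ' s l j F : nzZ n.+1 s l j (opp_face F) = nzZ n.+1 (~~ s) l j F.
  by case: l => [|l]; rewrite ?nzZ_0; exact: HZ.
have HB s l j F : nzB n.+1 s l.+1 j (opp_face F) = nzB n.+1 (~~ s) l.+1 j F.
  by rewrite !nzB_SE; apply: cone2_opp.
by split=> // s [|l] j F //; rewrite !nzB_0 HZ' HB.
Qed.

Lemma nzZ_opp n s j F : nzZ n s 1 j (opp_face F) = nzZ n s 1 j F.
Proof. by rewrite (nz_opp n).2 (nzZ_sym (nz_inclusionsP n)). Qed.

(** A facet without the latest index is in no ball of positive excess; it therefore survives the
    replacements made in later spheres. *)
Lemma nzB_top n s l j F : nzB n s l.+1 j F -> exists t, (n.-1, t) \in F.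
Proof.
case: n => [|n]; first by move=> /and3P[].
rewrite nzB_SE /cone2; case: ifP => [? _|_]; first by exists s.
by case: ifP => [? _|]; first by exists (~~ s).
Qed.

(* [F] stays a facet of the spheres [nzZ n s 1 j] for all [n >= p]. *)
Definition stable (s : bool) (j p : nat) (F : {fset U}) : Prop :=
  forall n, p <= n -> nzZ n s 1 j F.

Lemma stable_empty s : stable s 1 0 fset0.
Proof.
elim=> [|n IH] _; first by rewrite /nzZ /= eqxx.
by rewrite nzZ_1 /cone2 !inE IH ?nzB_j0.
Qed.

(** [F] avoids the latest index, so it belongs to the ball of excess 0, and adding [i] gives a facet
    of a ball of excess 1. Skipping [i.+1] leaves this facet in the border of the next ball, which
    is coned by [i.+2]. From then on the facet avoids the balls being replaced. *)
Lemma stable_pair s j p i F : stable s j p F -> p <= i -> F `<=` Vn i.-1 ->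
  stable s j.+1 i.+3 ((i, s) |` ((i.+2, s) |` F)).
Proof.
move=> SF ip Fi.
have Fn n t : i.-1 <= n -> (n, t) \notin F.
  by move=> le; apply/negP => /(fsubsetP Fi); rewrite in_Vn /=; lia.
have j0 : 0 < j by case: j SF => // /(_ i ip) /nzZ_j0.
have B0 l' s' j' : nzB i s' l'.+1 j' F = false.
  by apply/negP => /nzB_top[t]; rewrite (negbTE (Fn _ _ _)).
pose G := (i, s) |` F.
have Gn n t : i < n -> (n, t) \notin G.
  by move=> lt; rewrite !inE negb_or Fn ?xpair_eqE; lia.
have GB l' s' j' : nzB i.+2 s' l'.+1 j' G = false.
  by apply/negP => /nzB_top[t]; rewrite (negbTE (Gn _ _ _)).
have nn (a b : nat) (t t' : bool) : a != b -> ((a, t) == (b, t') :> U) = false.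
  by move=> /negbTE ab; rewrite xpair_eqE ab.
have EG : ((i, s) |` ((i.+2, s) |` F)) `\ (i.+2, s) = G.
  rewrite fsetU1D1 ?fsetU1K ?Fn //; last by rewrite nn; lia.
  by lia.
have top : (i.+2, s) \in (i, s) |` ((i.+2, s) |` F) by rewrite !inE eqxx orbT.
have ZG : nzZ i.+2 s 2 j G.
  rewrite nzZ_S cone2_mid; last by apply/fsubsetP => -[a b]; rewrite in_Vn /=; move: (Gn a b); case: (ltnP i a) => // ia /(_ isT) /negbTE ->.
  rewrite !nzB_SE {1}/cone2 fset1U1 fsetU1K ?Fn ?leq_pred // nzB_0 j0 SF // B0 /=.
  rewrite cone2_sym; try exact: nzB_on.
  by rewrite negbK /cone2 fset1U1 fsetU1K ?Fn ?leq_pred // B0.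
elim=> // n IH; rewrite leq_eqVlt => /orP[/eqP [<-]|lt].
  by rewrite nzZ_1 /cone2 top EG.
have nF t : (n, t) \notin (i, s) |` ((i.+2, s) |` F).
  by rewrite !inE !negb_or Fn ?nn; lia.
rewrite nzZ_1 /cone2 !(negbTE (nF _)) IH //=.
suff H s' : nzB n s' 2 j ((i, s) |` ((i.+2, s) |` F)) = false by rewrite !H.
move: lt; rewrite ltnS leq_eqVlt => /orP[/eqP <-|lt].
  case: (eqVneq s' s) => [->|ss]; first by rewrite nzB_SE /cone2 top EG GB.
  have -> : s' = ~~ s by move: ss; case: (s'); case: (s).
  rewrite nzB_SE cone2_sym; try exact: nzB_on.
  by rewrite negbK /cone2 top EG GB.
apply/negP => /nzB_top[t]; rewrite !inE !nn ?(negbTE (Fn _ _ _)) //; lia.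
Qed.

(** * Facets and missing faces in progressions of step 2 *)

Definition path2 (c : nat) (s : bool) (I : seq nat) : {fset U} := [fset (c + 2 * i, s) | i in I].

Lemma in_path2 c s I i t : (c + 2 * i, t) \in path2 c s I = (t == s) && (i \in I).
Proof.
apply/imfsetP/andP => [[k /= kI [E ->]]|[/eqP -> iI]]; last by exists i.
by split=> //; rewrite (_ : i = k) //; lia.
Qed.

Lemma path2P c s I u : reflect (exists2 i, i \in I & u = (c + 2 * i, s)) (u \in path2 c s I).
Proof. exact: imfsetP. Qed.

Lemma path2_cons2 c s a b I : path2 c s [:: a, b & I] =
  (c + 2 * a, s) |` ((c + 2 * b, s) |` path2 c s I).
Proof.
apply/fsetP => u; rewrite !inE; apply/path2P/or3P.
  by move=> [i]; rewrite !inE => /or3P[/eqP ->|/eqP ->|iI] ->;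
    [apply: Or31|apply: Or32|apply: Or33; rewrite in_path2 eqxx].
case=> [/eqP ->|/eqP ->|/path2P[i iI ->]]; [exists a|exists b|exists i]; rewrite // !inE ?eqxx ?orbT //.
by rewrite iI !orbT.
Qed.

Lemma path2_Vn c s I p : (forall i, i \in I -> c + 2 * i < p) -> path2 c s I `<=` Vn p.
Proof. by move=> H; apply/fsubsetP => u /path2P[i /H lt ->]; rewrite in_Vn. Qed.

Lemma path2_ext c s I I' : I =i I' -> path2 c s I = path2 c s I'.
Proof.
by move=> E; apply/fsetP => u; apply/path2P/path2P => -[i iI ->]; exists i; rewrite // ?E // -E.
Qed.

Lemma stable_prefix c s m : exists2 p, p <= c + 4 * m & stable s m.+1 p (path2 c s (iota 0 (2 * m))).
Proof.
elim: m => [|m [p pm Sm]].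
  exists 0 => //; rewrite (_ : path2 c s _ = fset0); first exact: stable_empty.
  by apply/fsetP => u; rewrite inE; apply/path2P => -[].
exists (c + 2 * (2 * m)).+3; first lia.
rewrite (@path2_ext _ _ _ [:: 2 * m, (2 * m).+1 & iota 0 (2 * m)]).
  rewrite path2_cons2 (_ : c + 2 * (2 * m).+1 = (c + 2 * (2 * m)).+2); last lia.
  apply: stable_pair Sm _ _; first lia.
  by apply: path2_Vn => i; rewrite mem_iota; lia.
by move=> /= i; rewrite !inE !mem_iota /=; lia.
Qed.

(** Omitting an element of even position splits the rest of the progression into pairs at distance
    2, to each of which [stable_pair] applies. *)
Lemma stable_skip c s m q : exists2 p, p <= c + 4 * m + 4 * q + 2 &
  stable s (m + q).+1 p (path2 c s (iota 0 (2 * m) ++ iota (2 * m).+1 (2 * q))).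
Proof.
elim: q => [|q [p pm Sm]].
  have [p pm Sm] := stable_prefix c s m; exists p; first lia.
  by rewrite cats0 addn0.
exists (c + 2 * (2 * m + 2 * q).+1).+3; first lia.
rewrite (@path2_ext _ _ _ [:: (2 * m + 2 * q).+1, (2 * m + 2 * q).+2 & iota 0 (2 * m) ++ iota (2 * m).+1 (2 * q)]).
  rewrite path2_cons2 (_ : c + 2 * (2 * m + 2 * q).+2 = (c + 2 * (2 * m + 2 * q).+1).+2); last lia.
  rewrite addnS; apply: stable_pair Sm _ _; first lia.
  by apply: path2_Vn => i; rewrite mem_cat !mem_iota; lia.
by move=> i; rewrite !inE !mem_cat !mem_iota /=; lia.
Qed.

Lemma nzZ_1E n s j : nzZ n.+1 s 1 j =
  cone2 n s (nzZ n s 2 j.-1) (nzZ n (~~ s) 2 j.-1)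
   (fun F => [&& 0 < j, nzZ n s 1 j F, ~~ nzB n s 2 j.-1 F & ~~ nzB n (~~ s) 2 j.-1 F]).
Proof. by apply/funext => F; exact: nzZ_1. Qed.

(** Coning creates no new face on the old indices: the bases of the cones are borders of balls that
    already lie in the old sphere. *)
Lemma cl_nzZ_restrict n s j t : 2 * j <= n.+2 -> t `<=` Vn n ->
  cl (nzZ n.+1 s 1 j) t -> cl (nzZ n s 1 j) t.
Proof.
have P := nz_inclusionsP n.
move=> jn tn; have tnn b : (n, b) \notin t by exact: Vn_notin.
rewrite nzZ_1E.
have bd b : cl (nzZ n b 2 j.-1) t -> cl (nzZ n b 1 j) t.
  case: j jn => [|j] jn; first by move=> [F /nzZ_j0].
  move=> [r Zr tr]; have /nzB_border[|v /andP[_ Bv] _] := Zr; first lia.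
  exists (v |` r); last exact: fsubset_trans tr (fsubsetUr _ _).
  exact: (@nzB2_Z _ P b 0 j.+1).
move=> /(cl_cone2_out (tnn s) (tnn _))[/bd //|/bd|].
  by apply: cl_sub => F; rewrite (nzZ_sym P).
by apply: cl_sub => F /and4P[].
Qed.

(** After restriction to the sphere in which [i.+2] is the last index, its link is the border of a
    ball. The faces of this border on indices below [i] already lie in the sphere two dimensions
    lower. *)
Lemma cl_nzZ_drop_top i n s j t : i.+2 < n -> 2 * j <= i.+2 -> (i.+2, s) \in t ->
  t `\ (i.+2, s) `<=` Vn i -> cl (nzZ n s 1 j.+1) t -> cl (nzZ i s 1 j) (t `\ (i.+2, s)).
Proof.
move=> ltn ji it tV; have tVn : t `<=` Vn i.+3.
  apply/fsubsetP => u ut; have [->|ne] := eqVneq u (i.+2, s); first by rewrite in_Vn /=.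
  have : u \in Vn i by apply: (fsubsetP tV); rewrite !inE ne.
  by rewrite !in_Vn => H; apply: leq_trans H _; lia.
have {ltn} : exists q, n = q + i.+3 by exists (n - i.+3); lia.
move=> [q ->]; elim: q => [|q IH]; last first.
  rewrite addSn => ct; apply: IH; apply: cl_nzZ_restrict ct; first lia.
  by apply: fsubset_trans tVn _; apply/fsubsetP => u; rewrite !in_Vn => H; apply: leq_trans H _; lia.
rewrite add0n nzZ_1E.
move=> /(cl_cone2_in it) /=; move: (t `\ (i.+2, s)) tV => {it tVn} {}t tV.
have tVi1 : t `<=` Vn i.+1 by exact: sub_Vn_S.
have P := nz_inclusionsP i; have P1 := nz_inclusionsP i.+1.
have B1 : cl (nzB i.+1 s 1 j) t -> cl (nzZ i s 1 j) t.
  rewrite nzB_SE => /(cl_cone2_out (Vn_notin s tV) (Vn_notin _ tV))[||[]//].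
    by apply: cl_sub => F; exact: (@nzB_Z _ P s 0 j).
  by apply: cl_sub => F; rewrite -(nzZ_sym P); exact: (@nzB2_Z _ P (~~ s) 0 j).
rewrite nzZ_S => /(cl_cone2_out (Vn_notin s tVi1) (Vn_notin _ tVi1))[||[F /andP[BF _] tF]].
- by apply: cl_nzZ_restrict.
- case: j ji B1 => [|j] ji B1; first by move=> [F /nzZ_j0]; lia.
  move=> [r Zr tr]; apply: B1; have /nzB_border[|v /andP[_ Bv] _] := Zr; first lia.
  exists (v |` r); last exact: fsubset_trans tr (fsubsetUr _ _).
  exact: (@nzB_opp _ P1 s 1 j.+1).
- by apply: B1; exists F.
Qed.

(** Removing the largest element lowers [m] by one, because gaps of 4 leave room for
    [cl_nzZ_drop_top]. The descent ends with a vertex in the sphere whose only possible facet is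
    empty. *)
Lemma evens_sparse m c s n : c + 4 * m < n ->
  ~ cl (nzZ n s 1 m.+1) (path2 c s [seq 2 * i | i <- iota 0 m.+1]).
Proof.
elim: m n => [|m IH] n lt.
  move=> [F /nzZ_card cF /fsubsetP H].
  have : (c + 2 * 0, s) \in F by apply: H; rewrite in_path2 eqxx.
  suff -> : F = fset0 by rewrite inE.
  by apply: cardfs0_eq; lia.
move=> ct; pose i := c + 4 * m + 2.
have iE : (i.+2, s) = (c + 2 * (2 * m.+1), s) :> U by rewrite /i; congr (_, _); lia.
have tE : path2 c s [seq 2 * i | i <- iota 0 m.+2] `\ (i.+2, s) = path2 c s [seq 2 * i | i <- iota 0 m.+1].
  apply/fsetP => u; rewrite !inE iE; apply/andP/path2P.
    move=> [ne /path2P[x /mapP[y]]]; rewrite mem_iota => ym xE uE; exists x => //.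
    apply/mapP; exists y => //; rewrite mem_iota; have [E|] := eqVneq y m.+1; last lia.
    by rewrite uE xE E eqxx in ne.
  move=> [x /mapP[y]]; rewrite mem_iota => ym -> ->; split.
    by rewrite xpair_eqE eqxx andbT; lia.
  by rewrite in_path2 eqxx; apply/mapP; exists y => //; rewrite mem_iota; lia.
apply: (IH i); first by rewrite /i; lia.
rewrite -tE; apply: cl_nzZ_drop_top ct; rewrite ?tE.
- by rewrite /i; lia.
- by rewrite /i; lia.
- by rewrite iE in_path2 eqxx; apply/mapP; exists m.+1 => //; rewrite mem_iota; lia.
- apply: path2_Vn => x /mapP[y]; rewrite mem_iota /i => ? ->; lia.
Qed.

(** * Independent flips *)

Section Flips.
Variables (R : realType) (I : eqType) (H : cpx) (A B : I -> {fset U}) (d : nat).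
Hypothesis Hd : down H.
Hypothesis Hb : bounded H.
Hypothesis A0 : forall i, A i != fset0.
Hypothesis B0 : forall i, B i != fset0.
Hypothesis AB : forall i, [disjoint A i & B i].
Hypothesis HB : forall i, ~ H (B i).
Hypothesis Hbd : forall i b, b \in B i -> H ((A i `|` B i) `\ b).
Hypothesis Hstar : forall i s, H s -> A i `<=` s -> s `<=` A i `|` B i.
Hypothesis Asep : forall i j, i != j -> ~~ (A i `<=` A j `|` B j).
Hypothesis Bsep : forall i j, i != j -> ~~ (B i `<=` A j `|` B j).

(** The result of performing all flips in [l], in a form that does not depend on their order. By
    [Asep] and [Bsep] no flip creates or destroys the simplices used by another. *)
Definition flipped (l : seq I) : cpx := fun s =>
  (H s /\ forall i, i \in l -> ~~ (A i `<=` s)) \/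
  (exists2 i, i \in l & s `<=` A i `|` B i /\ ~~ (A i `<=` s)).

Lemma flipped_down l : down (flipped l).
Proof.
move=> s t [[Hs As]|[i il [si Ai]]] ts.
  left; split; first exact: Hd Hs ts.
  by move=> i /As; apply: contra => /fsubset_trans; apply.
right; exists i => //; split; first exact: fsubset_trans ts si.
by apply: contra Ai => /fsubset_trans; apply.
Qed.

Lemma flipped_bounded l : bounded (flipped l).
Proof.
have [m Hm] := Hb.
have [q ql] : exists q, forall i, i \in l -> forall u, u \in A i `|` B i -> u.1 < q.
  elim: l => [|i l [q ql]]; first by exists 0.
  have [p pP] := fset_bound (A i `|` B i); exists (maxn p q) => j; rewrite inE => /orP[/eqP ->|jl] u uj.
    by apply: leq_trans (pP u uj) _; rewrite leq_maxl.
  by apply: leq_trans (ql j jl u uj) _; rewrite leq_maxr.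
exists (maxn m q) => s [[/Hm sm _] u /sm lt|[i il [si _]] u /(fsubsetP si) ui].
  by apply: leq_trans lt _; rewrite leq_maxl.
by apply: leq_trans (ql i il u ui) _; rewrite leq_maxr.
Qed.

Section Step.
Variables (i : I) (l : seq I).
Hypothesis il : i \notin l.

Let ne j : j \in l -> j != i. Proof. by move=> jl; apply: contraNneq il => <-. Qed.
Let ne_sym j : j \in l -> i != j. Proof. by move=> jl; rewrite eq_sym ne. Qed.

Lemma flipped_no_B s : flipped l s -> ~~ (B i `<=` s).
Proof.
case=> [[Hs _]|[j jl [sj _]]]; apply/negP => Bs.
  by apply: (@HB i); exact: Hd Hs Bs.
by case/negP: (Bsep (ne_sym jl)); exact: fsubset_trans Bs sj.
Qed.

Lemma flipped_no_A s : flipped (i :: l) s -> ~~ (A i `<=` s).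
Proof.
case=> [[_ As]|[j]]; first by apply: As; rewrite inE eqxx.
rewrite inE => /orP[/eqP -> [] //|jl [sj _]]; apply/negP => As.
by case/negP: (Asep (ne_sym jl)); exact: fsubset_trans As sj.
Qed.

Lemma flipped_cons s : flipped l s -> ~~ (A i `<=` s) -> flipped (i :: l) s.
Proof.
move=> [[Hs As]|[j jl sj]] nA; last by right; exists j; rewrite // inE jl orbT.
by left; split=> // j; rewrite inE => /orP[/eqP ->|/As].
Qed.

Lemma flipped_boundary b : b \in B i -> flipped l ((A i `|` B i) `\ b).
Proof.
move=> bB; left; split; first exact: Hbd.
move=> j jl; apply/negP => /fsubset_trans /(_ (fsubD1set _ _)).
by apply/negP; exact: Asep (ne jl).
Qed.

Lemma flipped_uncons s : flipped (i :: l) s -> ~~ (B i `<=` s) -> flipped l s.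
Proof.
move=> [[Hs As] _|[j]].
  by left; split=> // j jl; apply: As; rewrite inE jl orbT.
rewrite inE => /orP[/eqP -> [si _] nB|jl sj _]; last by right; exists j.
have /fsubsetPn[b bB bs] := nB.
apply: flipped_down (flipped_boundary bB) _.
by apply/fsubsetP => u us; rewrite inE (fsubsetP si) // andbT inE; apply: contraNneq bs => <-.
Qed.

Lemma flipped_B s : flipped (i :: l) s -> B i `<=` s -> s `<=` A i `|` B i.
Proof.
case=> [[Hs _] Bs|[j]].
  by case: (@HB i); exact: Hd Hs Bs.
rewrite inE => /orP[/eqP -> [//]|jl [sj _] Bs].
by case/negP: (Bsep (ne_sym jl)); exact: fsubset_trans Bs sj.
Qed.

Lemma flipped_A s : flipped l s -> A i `<=` s -> s `<=` A i `|` B i.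
Proof.
case=> [[Hs _]|[j jl [sj _]]] As; first exact: Hstar.
by case/negP: (Asep (ne_sym jl)); exact: fsubset_trans As sj.
Qed.

Lemma PLh_flipped : PLh R (flipped l) (flipped (i :: l)).
Proof.
apply: (@PLh_flip R (A i) (B i)); try exact: flipped_down; try exact: flipped_bounded.
- exact: A0.
- exact: B0.
- exact: AB.
- exact: flipped_no_B.
- exact: flipped_no_A.
- exact: flipped_cons.
- exact: flipped_uncons.
- move=> s t Xs As tA At; have sAB := flipped_A Xs As.
  right; exists i; first by rewrite inE eqxx.
  split; first by rewrite !fsubUset fsubsetUr (fsubset_trans (fsubsetDl _ _) sAB) (fsubset_trans tA) // fsubsetUl.
  have /fsubsetPn[a aA at_] := At; apply/fsubsetPn; exists a => //.
  rewrite !inE aA (negbTE at_) /=.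
  by have /fdisjointP /(_ a aA) := AB i.
- move=> s t Ys Bs tB Bt; have sAB := flipped_B Ys Bs.
  have /fsubsetPn[b bB bt] := Bt; apply: flipped_down (flipped_boundary bB) _.
  apply/fsubsetP => u; rewrite !inE; have [->|ub] /= := eqVneq u b.
    rewrite bB (negbTE bt) /= => bA; have /fdisjointP /(_ b bA) := AB i.
    by rewrite bB.
  move=> /orP[/orP[/andP[uB /(fsubsetP sAB)]|/(fsubsetP tB) ->]|->]; rewrite ?orbT //.
  by rewrite !inE.
Qed.

(* No codimension-one face lies in three faces of dimension [d - 1]. *)
Definition thin (X : cpx) : Prop := forall (r : {fset U}) x y z, #|` r|.+1 = d ->
  x \notin r -> y \notin r -> z \notin r -> X (x |` r) -> X (y |` r) -> X (z |` r) ->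
  [\/ x = y, y = z | x = z].

Hypothesis cardAB : #|` A i `|` B i| = d.+1.

(** A new facet through [r] lies in [A i] and [B i], whose union has exactly two vertices outside
    [r]. If [x] is not in [B i], all three facets contain [B i] and these two vertices are the only
    candidates. *)
Lemma thin_flipped_aux r x y z : thin (flipped l) -> #|` r|.+1 = d ->
  x \notin r -> y \notin r -> z \notin r ->
  flipped (i :: l) (x |` r) -> flipped (i :: l) (y |` r) -> flipped (i :: l) (z |` r) ->
  B i `<=` x |` r -> [\/ x = y, y = z | x = z].
Proof.
move=> thinX rd xr yr zr Yx Yy Yz Bx; have xAB := flipped_B Yx Bx.
have rAB : r `<=` A i `|` B i by apply: fsubset_trans xAB; exact: fsubsetUr.
have cD : #|` (A i `|` B i) `\` r| = 2.
  by rewrite cardfsDS // cardAB -rd -addn2 addnC addnK.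
case: (boolP (x \in B i)) => xB; last first.
  have Br : B i `<=` r.
    by apply/fsubsetP => b bB; have := fsubsetP Bx b bB; rewrite !inE => /orP[/eqP bx|//]; rewrite -bx bB in xB.
  have inD v : v \notin r -> flipped (i :: l) (v |` r) -> v \in (A i `|` B i) `\` r.
    move=> vr Yv; rewrite inE vr; apply: (fsubsetP (flipped_B Yv _)); last by rewrite !inE eqxx.
    exact: fsubset_trans Br (fsubsetUr _ _).
  have [xy|xy] := eqVneq x y; first exact: Or31.
  have [yz|yz] := eqVneq y z; first exact: Or32.
  have [xz|xz] := eqVneq x z; first exact: Or33.
  have : x |` [fset y; z] `<=` (A i `|` B i) `\` r.
    by apply/fsubsetP => v /fset1UP[->|/fset2P[->|->]]; exact: inD.
  by move/fsubset_leq_card; rewrite cD cardfsU1 cardfs2 !inE negb_or xy xz yz.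
have [xy|xy] := eqVneq x y; first exact: Or31.
have [xz|xz] := eqVneq x z; first exact: Or33.
(* Exchanging [x] for the other missing vertex [a] gives a facet of the old complex, removed by the
   flip. It takes the place of [x] when thinness of the old complex is applied. *)
have [a aE] : exists2 a, a != x & (A i `|` B i) `\` r = [fset x; a].
  have xD : x \in (A i `|` B i) `\` r by rewrite !inE xr xB orbT.
  have : #|` ((A i `|` B i) `\` r) `\ x| = 1 by apply/eqP; rewrite -eqSS -(card_rem xD) cD.
  move/eqP/cardfs1P => [a aE]; exists a; first by have : a \in [fset a] by [rewrite inE]; rewrite -aE !inE => /andP[].
  by rewrite -aE fsetD1K.
move=> DE; have ar : a \notin r.
  by have : a \in [fset x; a] by [rewrite !inE eqxx orbT]; rewrite -DE inE => /andP[].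
have arE : a |` r = (A i `|` B i) `\ x.
  apply/fsetP => u; rewrite !inE; have := congr1 (fun D : {fset U} => u \in D) DE.
  rewrite !inE; case: (boolP (u \in r)) => /= ur; last first.
    by move=> ->; rewrite orbF; have [->|] := eqVneq u x; rewrite ?(eq_sym x) ?(negbTE aE) ?orbF.
  move=> _; rewrite orbT; have := fsubsetP rAB u ur; rewrite inE => ->.
  by rewrite andbT; apply/esym; apply: contraNneq xr => <-.
have Xa : flipped l (a |` r) by rewrite arE; exact: flipped_boundary.
have xA : x \notin A i by apply/negP => xA; have /fdisjointP /(_ x xA) := AB i; rewrite xB.
have noa v : flipped (i :: l) (v |` r) -> a != v.
  move=> /flipped_no_A; apply: contraNneq => <-; rewrite arE.
  by apply/fsubsetP => u uA; rewrite !inE uA andbT; apply: contraNneq xA => <-.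
have Xv v : x != v -> flipped (i :: l) (v |` r) -> flipped l (v |` r).
  move=> xv Yv; apply: flipped_uncons => //; apply/negP => /fsubsetP /(_ x xB).
  by rewrite !inE (negbTE xv) (negbTE xr).
have := thinX r a y z rd ar yr zr Xa (Xv y xy Yy) (Xv z xz Yz).
by case=> [E|->|E]; [move: (noa y Yy); rewrite E eqxx|exact: Or32|move: (noa z Yz); rewrite E eqxx].
Qed.

Lemma thin_flipped : thin (flipped l) -> thin (flipped (i :: l)).
Proof.
move=> thinX r x y z rd xr yr zr Yx Yy Yz.
case: (boolP (B i `<=` x |` r)) => Bx; first exact: thin_flipped_aux Bx.
case: (boolP (B i `<=` y |` r)) => By.
  by have [->|->|->] := thin_flipped_aux thinX rd yr xr zr Yy Yx Yz By; [exact: Or31|exact: Or33|exact: Or32].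
case: (boolP (B i `<=` z |` r)) => Bz.
  by have [->|->|->] := thin_flipped_aux thinX rd zr xr yr Yz Yx Yy Bz; [exact: Or33|exact: Or31|exact: Or32].
exact: thinX rd xr yr zr (flipped_uncons Yx Bx) (flipped_uncons Yy By) (flipped_uncons Yz Bz).
Qed.

End Step.

Lemma PLh_flipped_all l : uniq l -> PLh R H (flipped l).
Proof.
elim: l => [_|i l IH /= /andP[il ul]].
  rewrite (_ : flipped [::] = H); first exact: PLh_refl.
  by apply: cpx_ext => s; split=> [[[]|[]]//|Hs]; left.
apply: (@PLh_trans R _ (flipped l)) (IH ul) (PLh_flipped il) => //; exact: flipped_down.
Qed.

Lemma thin_flipped_all l : (forall i, #|` A i `|` B i| = d.+1) -> thin H ->
  uniq l -> thin (flipped l).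
Proof.
move=> cAB tH; elim: l => [_|i l IH /= /andP[il ul]].
  rewrite (_ : flipped [::] = H) //.
  by apply: cpx_ext => s; split=> [[[]|[]]//|Hs]; left.
by apply: thin_flipped => //; exact: IH.
Qed.

End Flips.

(** * The simplices to be flipped and their stars *)

Section ConcreteFlips.
Variables N r : nat.

Definition link_facets : facets := nzZ N false 1 r.+1.

Definition join_facets : facets :=
  cone2 N.+1 true (cone2 N true link_facets link_facets noF) (cone2 N true link_facets link_facets noF) noF.

Lemma link_on : on N link_facets. Proof. exact: nzZ_on. Qed.

Lemma join_on1 : on N.+1 (cone2 N true link_facets link_facets noF).
Proof. by apply: on_cone2 => //; exact: link_on. Qed.

Lemma join_on : on N.+2 join_facets.
Proof. by apply: on_cone2 => //; exact: join_on1. Qed.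

Lemma joinedE s : joined N r N s <-> cl join_facets s.
Proof.
have C1 t : CL N.+1 (cone2 N true link_facets link_facets noF) t <->
    ~ (apex N true \in t /\ apex N false \in t) /\ CL N link_facets t.
  rewrite CL_cone2 //; try exact: link_on.
  have N0 : ~ CL N noF t by move=> [].
  by move: N0; rewrite -[~~ true]/false; atoms.
have C2 : CL N.+2 join_facets s <->
    ~ (apex N.+1 true \in s /\ apex N.+1 false \in s) /\
    CL N.+1 (cone2 N true link_facets link_facets noF) s.
  rewrite /join_facets (@CL_cone2 N.+1) //; try exact: join_on1.
  have N0 : ~ CL N.+1 noF s by move=> [].
  by move: N0; rewrite -[~~ true]/false; atoms.
split.
  move=> [[s1 s2] cs]; have sN : s `<=` Vn N.+2.
    by apply/fsubsetP => u /s1; rewrite !in_Vn => -[lt|/andP[]//]; apply: leq_trans lt _; lia.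
  suff : CL N.+2 join_facets s by rewrite /CL (fsetIidPl sN).
  apply/C2; split; first by move=> [h1 h2]; have /negP := s2 N.+1 (leqnSn N) h1; apply.
  by apply/C1; split=> //; move=> [h1 h2]; have /negP := s2 N (leqnn N) h1; apply.
move=> cs; have sN : s `<=` Vn N.+2 by case: cs => F /join_on Fn sF; exact: fsubset_trans Fn.
have {cs} /C2[n1 /C1[n0 cs]] : CL N.+2 join_facets s by rewrite /CL (fsetIidPl sN).
split=> //; split.
  by move=> v /(fsubsetP sN); rewrite !in_Vn => lt; have [H|H] := ltnP v.1 N; [by left|by right; rewrite /= lt].
move=> i Ni it; apply/negP => if_; have : i < N.+2 by have := fsubsetP sN _ it; rewrite in_Vn.
rewrite ltnS leq_eqVlt => /orP[/eqP E|]; first by apply: n1; rewrite -E.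
by rewrite ltnS => iN; apply: n0; rewrite (_ : N = i) //; lia.
Qed.

Lemma card_cone2 n s (X Y : facets) m F : (forall F, X F -> #|` F| = m) -> (forall F, Y F -> #|` F| = m) ->
  cone2 n s X Y noF F -> #|` F| = m.+1.
Proof.
move=> Xm Ym; rewrite /cone2; case: ifP => uF; first by rewrite (card_rem uF) => /Xm ->.
by case: ifP => uF' //; rewrite (card_rem uF') => /Ym ->.
Qed.

Lemma card_join F : join_facets F -> #|` F| = 2 * r.+1.
Proof.
have cS G : link_facets G -> #|` G| = 2 * r.
  move=> /nzZ_card E; suff : #|` G|.+3 = (2 * r).+3 by case.
  by rewrite E; lia.
have -> : 2 * r.+1 = (2 * r).+2 by lia.
by apply: card_cone2 => G; apply: card_cone2.
Qed.

Lemma degree_suspension n s (X : facets) t : on n X -> (forall t, degree n X t <= 2) ->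
  degree n.+1 (cone2 n s X X noF) t <= 2.
Proof.
move=> Xn dX; case: (boolP ((n, s) \in t)) => us; first by rewrite degree_cone2_in.
case: (boolP ((n, ~~ s) \in t)) => us'; first by rewrite cone2_sym // degree_cone2_in.
by rewrite degree_cone2_out // degree0 //; case: (X t).
Qed.

Lemma joined_thin : thin (2 * r.+1) (joined N r N).
Proof.
have facet F : joined N r N F -> #|` F| = 2 * r.+1 -> join_facets F.
  move=> /joinedE[G JG FG] cF; suff -> : F = G by [].
  by apply/eqP; rewrite eqEfcard FG cF (card_join JG) leqnn.
have deg t : degree N.+2 join_facets t <= 2.
  apply: degree_suspension => [|{}t]; first exact: join_on1.
  apply: degree_suspension => [|{}t]; first exact: link_on.
  by case: ((nz_degree N).2 false 1 r.+1 t) => ->.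
move=> t x y z ct xt yt zt Jx Jy Jz.
have ex v : v \notin t -> joined N r N (v |` t) -> extends join_facets t v.
  by move=> vt Jv; rewrite /extends vt; apply: facet => //; rewrite cardfsU1 vt -ct.
have [xy|xy] := eqVneq x y; first exact: Or31.
by have [->|->] := degree2P join_on (deg t) xy (ex x xt Jx) (ex y yt Jy) (ex z zt Jz);
  [exact: Or33|exact: Or32].
Qed.

Lemma link_sym s F : nzZ N s 1 r.+1 F = link_facets F.
Proof. by case: s => //; rewrite /link_facets -(nzZ_sym (nz_inclusionsP N)). Qed.

(** The parity is that of the position in the progression [c, c + 2, ..., c + 4 * r], not of the
    index itself. *)
Definition evens (c : nat) (s : bool) : {fset U} := path2 c s [seq 2 * i | i <- iota 0 r.+1].
Definition odds (c : nat) (s : bool) : {fset U} := path2 c s [seq (2 * i).+1 | i <- iota 0 r].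

Lemma path2_map c s (f : nat -> nat) q u :
  reflect (exists2 i, i < q & u = (c + 2 * f i, s)) (u \in path2 c s [seq f i | i <- iota 0 q]).
Proof.
apply: (iffP (path2P _ _ _ _)) => [[x /mapP[y]]|[i iq ->]].
  by rewrite mem_iota => yq -> ->; exists y.
by exists (f i) => //; apply/mapP; exists i; rewrite ?mem_iota.
Qed.

Lemma odds_evens c s : odds c s `|` evens c s = path2 c s (iota 0 (2 * r).+1).
Proof.
apply/fsetP => u; rewrite inE; apply/orP/path2P.
  by case=> /path2_map[i ir ->]; [exists (2 * i).+1|exists (2 * i)]; rewrite ?mem_iota //; lia.
move=> [i]; rewrite mem_iota => ir ->; case: (boolP (odd i)) => oi; [left|right].
  have [k iE] : exists k, i = (2 * k).+1.
    by exists i./2; rewrite mul2n -[LHS]odd_double_half oi.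
  by apply/path2_map; exists k; rewrite -?iE //; lia.
have [k iE] : exists k, i = 2 * k.
  by exists i./2; rewrite mul2n -[LHS]odd_double_half (negbTE oi).
by apply/path2_map; exists k; rewrite -?iE //; lia.
Qed.

Lemma odds_evens_Vn c s p : c + 4 * r < p -> odds c s `|` evens c s `<=` Vn p.
Proof. by move=> cp; rewrite odds_evens; apply: path2_Vn => i; rewrite mem_iota; lia. Qed.

Lemma card_path2 c s I : uniq I -> #|` path2 c s I| = size I.
Proof.
elim: I => [|i I IH] /=.
  by move=> _; rewrite (_ : path2 c s _ = fset0) ?cardfs0 //; apply/fsetP => u; rewrite inE; apply/path2P => -[].
move=> /andP[iI uI]; rewrite (_ : path2 c s _ = (c + 2 * i, s) |` path2 c s I).
  by rewrite cardfsU1 in_path2 eqxx (negbTE iI) IH.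
apply/fsetP => u; rewrite !inE; apply/path2P/orP.
  by move=> [j]; rewrite inE => /orP[/eqP ->|jI] ->; [left|right; rewrite in_path2 eqxx].
by case=> [/eqP ->|/path2P[j jI ->]]; [exists i|exists j]; rewrite // inE ?eqxx ?jI ?orbT.
Qed.

Lemma odds_evens_facet c s b : c + 4 * r + 2 <= N -> b \in evens c s ->
  link_facets ((odds c s `|` evens c s) `\ b).
Proof.
move=> cN /path2_map[m mr ->]; rewrite -(link_sym s) odds_evens.
have [p pm] := stable_skip c s m (r - m).
rewrite (_ : m + (r - m) = r); last lia.
move=> /(_ N); rewrite (_ : path2 c s (iota 0 (2 * r).+1) `\ _ = path2 c s (iota 0 (2 * m) ++ iota (2 * m).+1 (2 * (r - m)))).
  by apply; lia.
apply/fsetP => u; rewrite !inE; apply/andP/path2P.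
  move=> [ne /path2P[i]]; rewrite mem_iota => ir uE; exists i => //.
  rewrite mem_cat !mem_iota; have [E|] := eqVneq i (2 * m); last lia.
  by rewrite uE E eqxx in ne.
move=> [i]; rewrite mem_cat !mem_iota => im ->; split; first by rewrite xpair_eqE eqxx andbT; lia.
by rewrite in_path2 eqxx mem_iota; lia.
Qed.

Lemma evens_not_face c s : c + 4 * r + 2 <= N -> ~ cl link_facets (evens c s).
Proof.
move=> cN ce; apply: (@evens_sparse r c s N); first lia.
by apply: cl_sub ce => F; rewrite link_sym.
Qed.

(** The link of the odd positions contains the boundary of the simplex of even positions. Both have
    the same dimension, and as ridges lie in two facets no walk around the odd positions leaves that
    boundary; normality gives equality. *)
Lemma odds_star c s F : c + 4 * r + 2 <= N -> link_facets F -> odds c s `<=` F ->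
  F `<=` odds c s `|` evens c s.
Proof.
move=> cN LF oF; set J := odds c s `|` evens c s.
have b0 : (c + 2 * (2 * 0), s) \in evens c s by apply/path2_map; exists 0.
have odd_even u : u \in odds c s -> u \notin evens c s.
  move=> /path2_map[i ir ->]; apply/negP => /path2_map[k kr /eqP].
  by rewrite xpair_eqE => /andP[/eqP E _]; lia.
have sub b : b \in evens c s -> odds c s `<=` J `\ b.
  move=> be; apply/fsubsetP => u uo; rewrite !inE uo andbT.
  by apply: contraTneq be => <-; exact: odd_even.
apply: (@nzZ_normal N false 1 r.+1 (odds c s) (fun F => F `<=` J) _ ((J `\ (c + 2 * (2 * 0), s))) F) => //.
- move=> t v w ot /andP[vt Lv] /andP[wt Lw] vJ.
  have cJ : #|` J| = (2 * r).+1 by rewrite /J odds_evens card_path2 ?size_iota // iota_uniq.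
  have cS G : link_facets G -> #|` G| = 2 * r.
    move=> /nzZ_card E; suff : #|` G|.+3 = (2 * r).+3 by case.
    by rewrite E; lia.
  have cD : #|` J `\` (v |` t)| = 1 by rewrite cardfsDS // cJ cS // subSnn.
  have /cardfs1P[b bE] : #|` J `\` (v |` t)| == 1 by rewrite cD.
  have : b \in J `\` (v |` t) by rewrite bE inE.
  rewrite inE => /andP[bvt bJ].
  have be : b \in evens c s.
    move: bJ; rewrite inE => /orP[/(fsubsetP ot) bt|//].
    by move: bvt; rewrite !inE bt orbT.
  have vJ' : v \in J by apply: (fsubsetP vJ); rewrite !inE eqxx.
  have ve : v \in evens c s.
    by move: vJ'; rewrite inE => /orP[/(fsubsetP ot)|//]; rewrite (negbTE vt).
  have bt : b \notin t by apply: contra bvt => bt; rewrite !inE bt orbT.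
  have bv : b != v by apply: contraNneq bvt => ->; rewrite !inE eqxx.
  have tJ : t `<=` J by apply: fsubset_trans vJ; exact: fsubsetUr.
  have JE : J = b |` (v |` t).
    by rewrite -(fsetID (v |` t) J) (fsetIidPr vJ) bE fsetUC.
  have btE : b |` t = J `\ v.
    rewrite JE fsetUCA fsetU1K // !inE negb_or vt andbT eq_sym //.
  have eb : extends link_facets t b by rewrite /extends bt btE odds_evens_facet.
  have ev : extends link_facets t v by apply/andP.
  have ew : extends link_facets t w by apply/andP.
  by have [->|->] := nzZ_ridge bv eb ev ew; rewrite fsubUset fsub1set ?bJ ?vJ'.
- exact: odds_evens_facet.
- exact: sub.
- exact: fsubD1set.
Qed.

End ConcreteFlips.

(** * The family of spheres *)

Section Family.
Variables N r m : nat.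

(* The numbers congruent to 0 or 1 modulo 4: the other residues would make
   consecutive flips interfere. *)
Definition start (i : nat) : nat := 4 * i./2 + odd i.

(** The exclusive or with the sign makes the edge attached to the antipodal flip the antipodal
    edge. *)
Definition edge (k : bool * bool) (s : bool) : {fset U} := [fset (N, s (+) k.1); (N.+1, s (+) k.2)].

Definition side (k : bool * bool) (p : 'I_m * bool) : {fset U} := edge k p.2 `|` odds r (start p.1) p.2.
Definition coside (p : 'I_m * bool) : {fset U} := evens r (start p.1) p.2.

Lemma edge_fst k s u : u \in edge k s -> N <= u.1 < N.+2.
Proof. by rewrite !inE => /orP[] /eqP -> /=; lia. Qed.

Lemma edge_unpaired k s i b : (i, b) \in edge k s -> (i, ~~ b) \notin edge k s.
Proof.
rewrite !inE !xpair_eqE => /orP[/andP[/eqP -> /eqP ->]|/andP[/eqP -> /eqP ->]].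
  by rewrite eqxx (ltn_eqF (ltnSn N)) /= orbF; case: (s (+) k.1).
by rewrite eqxx (gtn_eqF (ltnSn N)) /=; case: (s (+) k.2).
Qed.

Lemma start_mod i : exists k (b : bool), start i = 4 * k + b /\ i = 2 * k + b.
Proof.
exists i./2, (odd i); split=> //.
by rewrite mul2n addnC odd_double_half.
Qed.

Hypothesis r2 : 2 <= r.
Hypothesis mN : 2 * m + 4 * r <= N.

Lemma start_bound i : i < m -> start i + 4 * r + 2 <= N.
Proof.
move=> im; have := odd_double_half i; rewrite -mul2n /start.
by move: (i./2) (odd i) => k b; lia.
Qed.

(** The bound is [N.-1] so that the index [N.-1] stays free; every facet of [core] uses it, which
    keeps the flips away from them. *)
Lemma body_fst (p : 'I_m * bool) u : u \in odds r (start p.1) p.2 `|` coside p -> u.1 < N.-1.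
Proof.
have := start_bound (ltn_ord p.1) => lt.
have /fsubsetP H : odds r (start p.1) p.2 `|` coside p `<=` Vn N.-1 by apply: odds_evens_Vn; lia.
by move/H; rewrite in_Vn.
Qed.

Lemma body_snd (p : 'I_m * bool) u : u \in odds r (start p.1) p.2 `|` coside p -> u.2 = p.2.
Proof. by rewrite odds_evens => /path2P[i _ ->]. Qed.

Lemma side_coside k p : side k p `|` coside p = edge k p.2 `|` (odds r (start p.1) p.2 `|` coside p).
Proof. by rewrite /side fsetUA. Qed.

Lemma side_cosideP k (p : 'I_m * bool) u : u \in side k p `|` coside p -> u.1 < N ->
  u \in odds r (start p.1) p.2 `|` coside p.
Proof. by rewrite side_coside inE => /orP[/edge_fst /andP[]|//]; lia. Qed.

Lemma side_coside_unpaired k p i b : (i, b) \in side k p `|` coside p ->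
  (i, ~~ b) \notin side k p `|` coside p.
Proof.
rewrite side_coside => ib; rewrite inE negb_or.
move: ib; rewrite inE => /orP[ie|ib].
  rewrite (edge_unpaired ie) /=; apply/negP => /body_fst /=; have := edge_fst ie => /=; lia.
have lt := body_fst ib; rewrite /= in lt; apply/andP; split.
  by apply/negP => /edge_fst /=; lia.
apply/negP => /body_snd /= E; have := body_snd ib; rewrite /= -E; by case: b {ib lt E}.
Qed.

Lemma side_neq0 k p : side k p != fset0.
Proof. by apply/fset0Pn; exists (N, p.2 (+) k.1); rewrite !inE eqxx. Qed.

Lemma coside_neq0 p : coside p != fset0.
Proof. by apply/fset0Pn; exists (start p.1 + 2 * (2 * 0), p.2); apply/path2_map; exists 0. Qed.

Lemma side_coside_disjoint k p : [disjoint side k p & coside p].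
Proof.
apply/fdisjointP => u; rewrite inE => /orP[ue|uo]; apply/negP => uc.
  have := edge_fst ue; have /body_fst : u \in odds r (start p.1) p.2 `|` coside p by rewrite inE uc orbT.
  by lia.
move: uo uc => /path2_map[i ir ->] /path2_map[j jr /eqP].
by rewrite xpair_eqE => /andP[/eqP]; lia.
Qed.

Lemma card_side_coside k p : #|` side k p `|` coside p| = (2 * r.+1).+1.
Proof.
have cE : #|` edge k p.2| = 2 by rewrite cardfs2 xpair_eqE (ltn_eqF (ltnSn N)).
have cO : #|` odds r (start p.1) p.2 `|` coside p| = (2 * r).+1.
  by rewrite odds_evens card_path2 ?size_iota ?iota_uniq.
have : [disjoint edge k p.2 & odds r (start p.1) p.2 `|` coside p]%fset.
  by apply/fdisjointP => u /edge_fst ue; apply/negP => /body_fst; lia.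
rewrite side_coside -leq_card_fsetU => /eqP ->; rewrite cE cO; lia.
Qed.

Lemma card_side k p : r < #|` side k p|.
Proof.
have := card_side_coside k p; have := side_coside_disjoint k p.
rewrite -leq_card_fsetU => /eqP ->.
have -> : #|` coside p| = r.+1.
  rewrite /coside /evens card_path2 ?size_map ?size_iota //.
  by rewrite map_inj_uniq ?iota_uniq // => i j; lia.
move: #|` side k p| => x; lia.
Qed.

Lemma joined_coside p : ~ joined N r N (coside p).
Proof.
move=> [_ [F LF cF]]; apply: (evens_not_face (start_bound (ltn_ord p.1))).
exists F; first exact: LF.
apply/fsubsetP => u uc; apply: (fsubsetP cF); rewrite in_fsetI in_Vn; apply/andP; split; first exact: uc.
have /body_fst : u \in odds r (start p.1) p.2 `|` coside p by rewrite inE uc orbT.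
by lia.
Qed.

Lemma joined_boundary k p b : b \in coside p -> joined N r N ((side k p `|` coside p) `\ b).
Proof.
move=> bc; split; last first.
  exists ((odds r (start p.1) p.2 `|` coside p) `\ b).
    exact: (odds_evens_facet (start_bound (ltn_ord p.1)) bc).
  apply/fsubsetP => u; rewrite in_fsetI in_Vn => /andP[/fsetD1P[ub uS] uN].
  by rewrite in_fsetD1 ub (side_cosideP uS).
split; last first.
  move=> i _ /fsetD1P[_ it]; apply/negP => /fsetD1P[_ if_].
  by have := side_coside_unpaired it; rewrite if_.
move=> u /fsetD1P[_]; rewrite side_coside inE => /orP[/edge_fst|/body_fst H]; first by right.
by left; rewrite in_Vn; lia.
Qed.

Lemma joined_star k p s : joined N r N s -> side k p `<=` s -> s `<=` side k p `|` coside p.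
Proof.
move=> [[s1 s2] [F LF sF]] As; rewrite side_coside.
have oF : odds r (start p.1) p.2 `<=` F.
  apply: fsubset_trans sF; rewrite fsubsetI; apply/andP; split.
    by apply: fsubset_trans As; exact: fsubsetUr.
  apply/fsubsetP => u uo; rewrite in_Vn.
  have /body_fst : u \in odds r (start p.1) p.2 `|` coside p by rewrite inE uo.
  by lia.
have FJ := odds_star (start_bound (ltn_ord p.1)) (LF : link_facets N r F) oF.
apply/fsubsetP => u us; rewrite inE; apply/orP; case: (s1 u us) => [uN|uN].
  by right; apply: (fsubsetP FJ); apply: (fsubsetP sF); rewrite inE us uN.
left; have es : edge k p.2 `<=` s by apply: fsubset_trans As; exact: fsubsetUl.
have uniq_sign i b b' : N <= i -> (i, b) \in s -> (i, b') \in s -> b = b'.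
  by move=> Ni; case: b; case: b' => // h1 h2; [have := s2 i Ni h1; rewrite h2|have := s2 i Ni h2; rewrite h1].
case: u us uN => i b us /= /andP[Ni]; rewrite ltnS leq_eqVlt => /orP[/eqP E|iN].
  have h : (N.+1, p.2 (+) k.2) \in s by apply: (fsubsetP es); rewrite !inE eqxx orbT.
  by subst i; rewrite !inE (uniq_sign N.+1 b (p.2 (+) k.2)) ?eqxx ?orbT //.
have E : i = N by lia.
have h : (N, p.2 (+) k.1) \in s by apply: (fsubsetP es); rewrite !inE eqxx.
by subst i; rewrite !inE (uniq_sign N b (p.2 (+) k.1)) ?eqxx.
Qed.

Lemma side_sep k k' p q : p != q -> ~~ (side k p `<=` side k' q `|` coside q).
Proof.
move=> pq; apply/negP => /fsubsetP H.
have sub x : x < r -> exists2 y, y < (2 * r).+1 &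
    (start p.1 + 2 * (2 * x).+1, p.2) = (start q.1 + 2 * y, q.2) :> U.
  move=> xr; have uo : (start p.1 + 2 * (2 * x).+1, p.2) \in odds r (start p.1) p.2.
    by apply/path2_map; exists x.
  have /H/side_cosideP : (start p.1 + 2 * (2 * x).+1, p.2) \in side k p by rewrite inE uo orbT.
  have /body_fst /= lt : (start p.1 + 2 * (2 * x).+1, p.2) \in odds r (start p.1) p.2 `|` coside p.
    by rewrite inE uo.
  have ltN : start p.1 + 2 * (2 * x).+1 < N by apply: leq_trans lt (leq_pred _).
  move=> /(_ ltN); rewrite odds_evens => /path2P[y]; rewrite mem_iota => yr E.
  by exists y => //; lia.
(* The first and the last odd position force the two starts to differ by an even number of absolute
   value at most 2. Starts are 0 or 1 modulo 4, so they are equal. *)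
have [|y1 y1r [E1 s1]] := sub 0; first lia.
have [|y2 y2r [E2 _]] := sub r.-1; first lia.
have [kp [bp [Sp ip]]] := start_mod p.1; have [kq [bq [Sq iq]]] := start_mod q.1.
rewrite Sp Sq in E1 E2; case/eqP: pq; move: p q ip iq s1 {sub H Sp Sq} => [i s] [j t] /= ip iq <-.
by congr (_, _); apply: val_inj; rewrite /= ip iq; move: E1 E2 {ip iq}; case: bp; case: bq; lia.
Qed.

Lemma coside_sep k' p q : p != q -> ~~ (coside p `<=` side k' q `|` coside q).
Proof.
move=> pq; apply/negP => /fsubsetP H.
have sub x : x < r.+1 -> exists2 y, y < (2 * r).+1 &
    (start p.1 + 2 * (2 * x), p.2) = (start q.1 + 2 * y, q.2) :> U.
  move=> xr; have uo : (start p.1 + 2 * (2 * x), p.2) \in coside p.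
    by apply/path2_map; exists x.
  have /side_cosideP := H _ uo.
  have /body_fst /= lt : (start p.1 + 2 * (2 * x), p.2) \in odds r (start p.1) p.2 `|` coside p.
    by rewrite inE uo orbT.
  have ltN : start p.1 + 2 * (2 * x) < N by apply: leq_trans lt (leq_pred _).
  move=> /(_ ltN); rewrite odds_evens => /path2P[y]; rewrite mem_iota => yr E.
  by exists y => //; lia.
have [|y1 y1r [E1 s1]] := sub 0; first lia.
have [|y2 y2r [E2 _]] := sub r; first lia.
have [kp [bp [Sp ip]]] := start_mod p.1; have [kq [bq [Sq iq]]] := start_mod q.1.
rewrite Sp Sq in E1 E2; case/eqP: pq; move: p q ip iq s1 {sub H Sp Sq} => [i s] [j t] /= ip iq <-.
by congr (_, _); apply: val_inj; rewrite /= ip iq; move: E1 E2 {ip iq}; case: bp; case: bq; lia.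
Qed.

End Family.

Section Complexes.
Variables N r m : nat.
Hypothesis r2 : 2 <= r.
Hypothesis mN : 2 * m + 4 * r <= N.

(* Each index gets no flip or one flip at one of the four edges of the 4-cycle,
   performed together with its antipode. *)
Definition pattern : Type := {ffun 'I_m -> option (bool * bool)}.
Definition chosen (w : pattern) : pred ('I_m * bool) := fun p => w p.1 != None.
(** [odflt] makes the family of simplices total, since the hypotheses on flips are required at every
    position; only those in [chosen w] are performed. *)
Definition flip_side (w : pattern) (p : 'I_m * bool) : {fset U} :=
  side N r (odflt (false, false) (w p.1)) p.
Definition sphere_cpx (w : pattern) : cpx :=
  flipped (joined N r N) (flip_side w) (@coside r m) (enum (chosen w)).

Lemma sphere_bounded w : bounded_by N.+2 (sphere_cpx w).
Proof.
have bJ : bounded_by N.+2 (joined N r N).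
  by move=> s [[s1 _] _] u /s1[|/andP[]//]; rewrite in_Vn; lia.
move=> s [[Js _]|[p _ [sp _]]] u us; first exact: bJ Js u us.
have := fsubsetP sp u us; rewrite /flip_side side_coside in_fsetU => /orP[/edge_fst/andP[_ lt]|]; first exact: lt.
by move=> /(body_fst r2 mN); lia.
Qed.

Lemma sphere_down w : down (sphere_cpx w).
Proof. by apply: flipped_down; exact: down_joined. Qed.

Lemma sphere_PLh (R : realType) w : PLh R (joined N r N) (sphere_cpx w).
Proof.
apply: PLh_flipped_all; last exact: enum_uniq.
- exact: down_joined.
- exact: bounded_joined.
- by move=> p; exact: side_neq0.
- by move=> p; exact: coside_neq0.
- by move=> p; exact: side_coside_disjoint.
- by move=> p; exact: joined_coside.
- by move=> p b; exact: joined_boundary.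
- by move=> p s; exact: joined_star.
- by move=> p q; exact: side_sep.
- by move=> p q; exact: coside_sep.
Qed.

Lemma sphere_thin w : thin (2 * r.+1) (sphere_cpx w).
Proof.
apply: thin_flipped_all; last exact: enum_uniq.
- exact: down_joined.
- by move=> p; exact: side_coside_disjoint.
- by move=> p; exact: joined_coside.
- by move=> p b; exact: joined_boundary.
- by move=> p q; exact: side_sep.
- by move=> p q; exact: coside_sep.
- by move=> p; exact: card_side_coside.
- exact: joined_thin.
Qed.

Lemma sphere_low w s : joined N r N s -> #|` s| <= r -> sphere_cpx w s.
Proof.
move=> Js sr; left; split=> // p _; apply/negP => /fsubset_leq_card le.
by have := leq_trans (card_side r2 mN _ p) (leq_trans le sr); rewrite ltnn.
Qed.

Lemma joined_low s : s `<=` Vn N.+2 -> unpaired s -> #|` s| <= r -> joined N r N s.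
Proof.
move=> sN fs sr; split.
  split; last by move=> i _ /fs.
  by move=> u /(fsubsetP sN); rewrite !in_Vn => lt; have [H|H] := ltnP u.1 N; [left|right; rewrite lt].
apply: (cl_sub (@nzB_Z _ (nz_inclusionsP N) false 0 r.+1)).
apply: nzB_neighborly; first lia.
- exact: fsubsetIr.
- by apply: unpaired_sub fs _; exact: fsubsetIl.
- by rewrite ltnS; apply: leq_trans sr; apply: fsubset_leq_card; exact: fsubsetIl.
Qed.

Lemma sphere_unpaired w s : sphere_cpx w s -> unpaired s.
Proof.
case=> [[/joinedE[F JF sF] _]|[p _ [sp _]]].
  apply: unpaired_sub sF; apply: unpaired_cone2 JF => //; try exact: join_on1.
    by apply: unpaired_cone2 => //; try exact: link_on; exact: (nz_unpaired N).2.
  by apply: unpaired_cone2 => //; try exact: link_on; exact: (nz_unpaired N).2.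
by apply: unpaired_sub sp => i b; exact: side_coside_unpaired.
Qed.

Definition flip_sign (p : 'I_m * bool) : 'I_m * bool := (p.1, ~~ p.2).

Lemma opp_face_path2 c s I : opp_face (path2 c s I) = path2 c (~~ s) I.
Proof.
apply/fsetP => -[i b]; rewrite in_opp_face; apply/path2P/path2P => -[x xI E]; exists x => //.
  by move: E; rewrite /antipode /= => -[-> <-]; rewrite negbK.
by move: E => [-> ->]; rewrite /antipode /= negbK.
Qed.

Lemma opp_faceU s t : opp_face (s `|` t) = opp_face s `|` opp_face t.
Proof. by apply/fsetP => u; rewrite !(in_opp_face, in_fsetU). Qed.

Lemma opp_face_edge k s : opp_face (edge N k s) = edge N k (~~ s).
Proof.
apply/fsetP => -[i b]; rewrite in_opp_face !inE /antipode /= !xpair_eqE.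
by case: k => [] [] []; case: b; case: s.
Qed.

Lemma flip_side_opp w p : opp_face (flip_side w p) = flip_side w (flip_sign p).
Proof. by rewrite /flip_side /side opp_faceU opp_face_edge opp_face_path2. Qed.

Lemma coside_opp p : opp_face (coside r p) = coside r (flip_sign p).
Proof. exact: opp_face_path2. Qed.

Lemma opp_faceI_Vn n s : opp_face s `&` Vn n = opp_face (s `&` Vn n).
Proof. by apply/fsetP => -[i b]; rewrite !(in_opp_face, in_fsetI, in_Vn). Qed.

Lemma joined_opp s : joined N r N s -> joined N r N (opp_face s).
Proof.
move=> [[s1 s2] [F LF sF]]; split; last first.
  by exists (opp_face F); [rewrite nzZ_opp|rewrite opp_faceI_Vn opp_face_sub].
split.
  by move=> u; rewrite in_opp_face => /s1; rewrite !in_Vn.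
move=> i Ni; rewrite !in_opp_face /antipode /= => if_; apply/negP => it.
by have := s2 i Ni it; rewrite if_.
Qed.

Lemma sphere_opp w s : sphere_cpx w s -> sphere_cpx w (opp_face s).
Proof.
have mem p : p \in enum (chosen w) -> flip_sign p \in enum (chosen w).
  by rewrite !mem_enum.
case=> [[Js As]|[p pw [sp Ap]]].
  left; split; first exact: joined_opp.
  move=> p /mem /As; rewrite -(opp_face_sub _ s) flip_side_opp /flip_sign /= negbK.
  by case: p.
right; exists (flip_sign p); first exact: mem.
by rewrite -flip_side_opp -coside_opp -opp_faceU !opp_face_sub.
Qed.

(** The four candidate simplices at a position tell which flip was made there, so the pattern can be
    read off from the labelled sphere. *)
Lemma side_sphereP w k p : sphere_cpx w (side N r k p) <-> w p.1 != Some k.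
Proof.
have sep q k' : q != p -> ~~ (flip_side w q `<=` side N r k' p).
  move=> qp; apply/negP => H; case/negP: (side_sep r2 mN (odflt (false, false) (w q.1)) k' qp).
  exact: fsubset_trans H (fsubsetUl _ _).
split.
  move=> H; apply/eqP => E; have fE : flip_side w p = side N r k p by rewrite /flip_side E.
  have pw : p \in enum (chosen w) by rewrite mem_enum /in_mem /= /chosen E.
  case: H => [[_ /(_ p pw)]|[q _ [Hq Aq]]]; first by rewrite fE fsubset_refl.
  have [E'|pq] := eqVneq p q; first by rewrite -E' fE fsubset_refl in Aq.
  by case/negP: (side_sep r2 mN k (odflt (false, false) (w q.1)) pq).
move=> wk; left; split.
  have /fset0Pn[b bc] := coside_neq0 r p.
  apply: down_joined (joined_boundary r2 mN k bc) _.
  apply/fsubsetP => u us; rewrite in_fsetD1 in_fsetU us andbT.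
  apply: contraTneq us => ->; have := side_coside_disjoint r2 mN k p.
  by rewrite fdisjoint_sym => /fdisjointP; apply.
move=> q; rewrite mem_enum /in_mem /= /chosen => wq.
have [E|] := eqVneq q p; last exact: sep.
rewrite E in wq *; rewrite /flip_side; case wE: (w p.1) wq wk => [k'|] // _ kk /=.
apply/negP => /fsubsetP H.
have h1 : (N, p.2 (+) k'.1) \in edge N k p.2.
  have : (N, p.2 (+) k'.1) \in side N r k p by apply: H; rewrite !inE eqxx.
  rewrite inE => /orP[//|uo]; have /(body_fst r2 mN) /= : (N, p.2 (+) k'.1) \in odds r (start p.1) p.2 `|` coside r p by rewrite inE uo.
  by lia.
have h2 : (N.+1, p.2 (+) k'.2) \in edge N k p.2.
  have : (N.+1, p.2 (+) k'.2) \in side N r k p by apply: H; rewrite !inE eqxx orbT.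
  rewrite inE => /orP[//|uo]; have /(body_fst r2 mN) /= : (N.+1, p.2 (+) k'.2) \in odds r (start p.1) p.2 `|` coside r p by rewrite inE uo.
  by lia.
move: kk h1 h2; rewrite !inE !xpair_eqE !eqxx (ltn_eqF (ltnSn N)) (gtn_eqF (ltnSn N)) /= ?orbF ?orFb.
move: k k' {H wE} => [k1 k2] [k1' k2'] /=.
by case: p.2; case: k1; case: k2; case: k1'; case: k2'.
Qed.

Lemma sphere_inj w w' : (forall s, sphere_cpx w s <-> sphere_cpx w' s) -> w = w'.
Proof.
move=> E; have H i k : (w i != Some k) = (w' i != Some k).
  by apply/idP/idP => /(side_sphereP _ _ (i, false)) /E /side_sphereP.
apply/ffunP => i; case wi: (w i) => [k|]; case wi': (w' i) => [k'|] //.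
- by have := H i k; rewrite wi wi' eqxx => /esym /negbFE /eqP ->.
- by have := H i k; rewrite wi wi' eqxx.
- by have := H i k'; rewrite wi wi' eqxx.
Qed.

(* The cone over the ball [core] is left untouched by all the flips. *)
Definition core : facets := nzB N false 2 r.
Definition core_edge : {fset U} := edge N (false, false) false.

(** A flip touching this face would have its odd positions in [F], and [odds_star] would confine [F]
    to the vertices of the flip. But [F] contains a vertex of index [N.-1]. *)
Lemma core_sphere w F : core F -> sphere_cpx w (core_edge `|` F).
Proof.
move=> cF; have LF : link_facets N r F by exact: (@nzB2_Z _ (nz_inclusionsP N) false 0 r.+1).
have FN : F `<=` Vn N by exact: nzZ_on LF.
left; split.
  split; last first.
    exists F; first exact: LF.
    apply/fsubsetP => u; rewrite in_fsetI in_fsetU in_Vn => /andP[/orP[/edge_fst|//]].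
    by lia.
  split.
    by move=> u; rewrite in_fsetU => /orP[/edge_fst|/(fsubsetP FN)]; [right|left].
  move=> i Ni; have iF b : (i, b) \notin F by apply/negP => /(fsubsetP FN); rewrite in_Vn /=; lia.
  move=> /fsetUP[ie|]; last by rewrite (negbTE (iF _)).
  rewrite in_fsetU negb_or iF andbT; exact: (edge_unpaired ie).
move=> p _; apply/negP => H.
have [t tF] := nzB_top cF.
have oF : odds r (start p.1) p.2 `<=` F.
  apply/fsubsetP => u uo; have : u \in core_edge `|` F.
    by apply: (fsubsetP H); rewrite in_fsetU uo orbT.
  have /(body_fst r2 mN) lt : u \in odds r (start p.1) p.2 `|` coside r p by rewrite in_fsetU uo.
  by rewrite in_fsetU => /orP[/edge_fst|//]; lia.
have /fsubsetP /(_ _ tF) := odds_star (start_bound r2 mN (ltn_ord p.1)) LF oF.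
by move=> /(body_fst r2 mN); rewrite /= ltnn.
Qed.

End Complexes.

(** * Counting isomorphism classes *)

Lemma leq_exp_base m n e : m <= n -> m ^ e <= n ^ e.
Proof. by move=> mn; elim: e => // e IH; rewrite !expnS leq_mul. Qed.

(** Bernoulli's inequality for 5/4 with exponent [x], the quotient of [m] by [D.+1], raised to the
    power [D.+1]. *)
Lemma growth (D K : nat) : exists m0, forall m, m0 <= m -> K * m.+1 ^ D * 4 ^ m <= 5 ^ m.
Proof.
have bern x : 4 ^ x * (x + 4) <= 5 ^ x * 4.
  elim: x => // x IH; rewrite !expnS.
  move: (4 ^ x) (5 ^ x) IH => a b IH.
  have : 4 * a * (x.+1 + 4) <= 5 * (a * (x + 4)) by nia.
  by move=> /leq_trans; apply; rewrite -!mulnA leq_mul2l /= mulnC; rewrite mulnC in IH; lia.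
(* From this bound on, one of the [D.+1] factors [x + 4] absorbs all the constants, while the other
   [D] dominate the power of [m.+1]. *)
exists (D.+1 * (K * D.+1 ^ D * 4 ^ D.+1)) => m mK.
pose x := m %/ D.+1; pose q := m %% D.+1.
have mE : m = x * D.+1 + q by exact: divn_eq.
have qD : q < D.+1 by rewrite ltn_mod.
have xK : K * D.+1 ^ D * 4 ^ D.+1 <= x + 4.
  by apply: leq_trans (leq_addr _ _); rewrite /x leq_divRL // mulnC.
rewrite -(leq_pmul2r (_ : 0 < 4 ^ D.+1)) ?expn_gt0 //.
apply: (@leq_trans (4 ^ q * (4 ^ x * (x + 4)) ^ D.+1)).
  have m1 : m.+1 ^ D <= (D.+1 * (x + 4)) ^ D by apply: leq_exp_base; nia.
  rewrite [in 4 ^ m]mE expnD expnM expnMn [(x + 4) ^ D.+1]expnSr.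
  apply: (@leq_trans (K * (D.+1 * (x + 4)) ^ D * ((4 ^ x) ^ D.+1 * 4 ^ q) * 4 ^ D.+1)).
    by rewrite leq_mul // leq_mul // leq_mul.
  rewrite expnMn; move: xK; move: (D.+1 ^ D) (4 ^ D.+1) ((x + 4) ^ D) ((4 ^ x) ^ D.+1) (4 ^ q) => a b c e f.
  move=> H; have -> : K * (a * c) * (e * f) * b = (K * a * b) * (c * e * f) by ring.
  have -> : f * (e * (c * (x + 4))) = (x + 4) * (c * e * f) by ring.
  by rewrite leq_mul2r H orbT.
rewrite {1}mE expnD expnM -mulnA [_ * 4 ^ _]mulnC mulnA -expnMn [_ * 5 ^ q]mulnC.
apply: leq_mul; last exact: leq_exp_base.
by rewrite leq_exp_base.
Qed.

(** * Isomorphisms are determined by few vertices *)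

Section Rigidity.
Variables N r : nat.

Definition thin_set (n : nat) (d : nat) (G : {set {set V n}}) : Prop :=
  forall (s : {set V n}) x y z, #|s|.+1 = d -> x \notin s -> y \notin s -> z \notin s ->
  x |: s \in G -> y |: s \in G -> z |: s \in G -> [\/ x = y, y = z | x = z].

Lemma card_face_of n (s : {set V n}) : #|` face_of s| = #|s|.
Proof. by rewrite card_in_imfset ?cardE // => ? ? _ _; exact: vertex_inj. Qed.

Lemma face_of_setU1 n (v : V n) s : face_of (v |: s) = vertex v |` face_of s.
Proof.
apply/fsetP => u; rewrite !inE; apply/idP/orP.
  move=> /in_face_of[w]; rewrite !inE => /orP[/eqP -> ->|ws ->]; first by left.
  by right; rewrite vertex_face_of.
by case=> [/eqP ->|/in_face_of[w ws ->]]; rewrite vertex_face_of !inE ?eqxx // ws orbT.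
Qed.

Lemma thin_carrier n d X : thin d X -> thin_set d (carrier n X).
Proof.
move=> tX s x y z sd xs ys zs; rewrite !in_carrier !face_of_setU1 => /asboolP Xx /asboolP Xy /asboolP Xz.
have [||||E|E|E] := tX (face_of s) (vertex x) (vertex y) (vertex z) _ _ _ _ Xx Xy Xz;
  rewrite ?card_face_of ?vertex_face_of //.
- by apply: Or31; exact: vertex_inj.
- by apply: Or32; exact: vertex_inj.
- by apply: Or33; exact: vertex_inj.
Qed.

Notation T := (V N.+2).

Definition core_face (F : {fset U}) : {set T} := trace N.+2 (core_edge N `|` F).

Lemma core_face_U1 v (t : {fset U}) (w : T) : vertex w = v -> core_face (v |` t) = w |: core_face t.
Proof.
move=> wv; apply/setP => u; rewrite !inE -wv.
by rewrite orbCA (inj_eq (@vertex_inj N.+2)).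
Qed.

(** Agreement of [f] and [f'] spreads from facet to adjacent facet of the core: across a ridge,
    thinness leaves only one possible image for the new vertex. It reaches every vertex of index
    below [N]. *)
Lemma core_rigid (f f' : T -> T) (G : {set {set T}}) (F0 : {fset U}) :
  2 <= r -> 2 * r <= N -> injective f -> injective f' -> thin_set (2 * r.+1) G ->
  (forall F, core N r F -> f @: core_face F \in G) ->
  (forall F, core N r F -> f' @: core_face F \in G) ->
  core N r F0 ->
  (forall v, vertex v \in F0 `|` (core_edge N `|` opp_face (core_edge N)) -> f v = f' v) ->
  f =1 f'.
Proof.
move=> r2 rN fI f'I tG fG f'G cF0 agree.
pose P (F : {fset U}) := forall v, v \in core_face F -> f v = f' v.
have edgeN u : u \in core_edge N -> N <= u.1 by move=> /edge_fst /andP[].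
have card_t (t : {fset U}) v : v \notin t -> core N r (v |` t) -> #|core_face t|.+1 = 2 * r.+1.
  move=> vt cvt; have tN : v |` t `<=` Vn N by exact: nzB_on cvt.
  have ct : #|` v |` t|.+2 = 2 * r + 2 by exact: nzB_card cvt.
  rewrite cardfsU1 vt in ct.
  rewrite -card_face_of face_of_trace; last first.
    move=> u; rewrite in_fsetU => /orP[/edge_fst/andP[_ //]|ut].
    have : u \in Vn N by apply: (fsubsetP tN); rewrite in_fsetU ut orbT.
    by rewrite in_Vn; lia.
  have cE : #|` core_edge N| = 2 by rewrite /core_edge /edge cardfs2 xpair_eqE (ltn_eqF (ltnSn N)).
  have : [disjoint core_edge N & t]%fset.
    apply/fdisjointP => u /edgeN Nu; apply/negP => ut.
    have : u \in Vn N by apply: (fsubsetP tN); rewrite in_fsetU ut orbT.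
    by rewrite in_Vn; lia.
  rewrite -leq_card_fsetU => /eqP ->; rewrite cE.
  by case: ct => ->; lia.
have walk : walk_closed (core N r) fset0 P.
  move=> t v w _ /andP[vt cv] /andP[wt cw] Pv.
  have lift x : core N r (x |` t) -> exists2 y : T, vertex y = x & x.1 < N.
    move=> cx; have : x \in Vn N by apply: (fsubsetP (nzB_on cx)); rewrite !inE eqxx.
    rewrite in_Vn => xN; have [|y E] := @vertexP N.+2 x; first by lia.
    by exists y.
  have [v' vE vN] := lift v cv; have [w' wE wN] := lift w cw.
  have [vw|vw] := eqVneq v w; first by rewrite -vw.
  have notin x' x : vertex x' = x -> x.1 < N -> x \notin t -> x' \notin core_face t.
    move=> xE xN xt; rewrite inE xE in_fsetU (negbTE xt) orbF.
    by apply/negP => /edgeN; lia.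
  have v't := notin v' v vE vN vt; have w't := notin w' w wE wN wt.
  rewrite /P (core_face_U1 _ wE) => x; rewrite in_setU1 => /orP[/eqP -> {x}|xt]; last first.
    by apply: Pv; rewrite (core_face_U1 _ vE) in_setU1 xt orbT.
  have ft : f @: core_face t = f' @: core_face t.
    by apply: eq_in_imset => x xt; apply: Pv; rewrite (core_face_U1 _ vE) in_setU1 xt orbT.
  have fv : f v' = f' v' by apply: Pv; rewrite (core_face_U1 _ vE) in_setU1 eqxx.
  (* The vertices [f v'], [f w'] and [f' w'] all complete the same image ridge, so two of them
     coincide. Injectivity excludes that [f v'] is one of the other two. *)
  have [|||||||E|//|E] := tG (f @: core_face t) (f v') (f w') (f' w').
  - by rewrite card_imset //; exact: card_t cv.
  - by rewrite mem_imset.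
  - by rewrite mem_imset.
  - by rewrite ft mem_imset.
  - by rewrite -imsetU1 -(core_face_U1 _ vE); exact: fG.
  - by rewrite -imsetU1 -(core_face_U1 _ wE); exact: fG.
  - by rewrite ft -imsetU1 -(core_face_U1 _ wE); exact: f'G.
  - by case/eqP: vw; rewrite -vE -wE (fI _ _ E).
  - by case/eqP: vw; rewrite -vE -wE; congr vertex; apply: f'I; rewrite -fv.
have PF F : core N r F -> P F.
  move=> cF; apply: (nzB_normal walk cF0 cF); try exact: fsub0set.
  move=> v; rewrite inE => /fsetUP[vE|vF]; apply: agree; apply/fsetUP; last by left.
  by right; apply/fsetUP; left.
(* Neighborliness of the ball puts each vertex of index below [N] into some core facet. The four
   others lie on the core edge or its antipode, where agreement is assumed. *)
move=> v; case: (ltnP v.1 N) => vN.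
  have [||||F cF vF] := @nzB_neighborly N false 2 r [fset vertex v].
  - by rewrite mul2n; lia.
  - by apply/fsubsetP => u; rewrite inE in_Vn => /eqP ->.
  - by move=> i b; rewrite !inE /vertex => /eqP[-> ->]; rewrite xpair_eqE; case: (v.2); rewrite andbF.
  - by rewrite cardfs1.
  apply: (PF F cF); rewrite inE in_fsetU; apply/orP; right.
  by rewrite fsub1set in vF.
apply: agree; rewrite in_fsetU; apply/orP; right.
case: v vN => [[i /= iN] b] /= Ni; rewrite in_fsetU in_opp_face /core_edge /edge /antipode /vertex /= !inE !xpair_eqE /=.
have [E|iN'] := eqVneq i N; first by case: (b); rewrite /= ?andbF ?orbT.
have -> : i == N.+1 by apply/eqP; lia.
by case: (b); rewrite /= ?andbF ?orbT.
Qed.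

End Rigidity.

(** Each complex is encoded by the representative of its class and the images of [W] under a chosen
    isomorphism to it. Rigidity makes the code injective, which bounds every class by the number of
    maps from [W] to the vertices. *)
Lemma isomorphism_classes (n : nat) (GG : {set {set {set V n}}}) (W : seq (V n)) :
  (forall G G' H f f', G \in GG -> G' \in GG -> H \in GG -> injective f -> injective f' ->
     (forall s : {set V n}, (f @: s \in H) = (s \in G)) ->
     (forall s : {set V n}, (f' @: s \in H) = (s \in G')) ->
     {in W, f =1 f'} -> f =1 f') ->
  exists F : {set {set {set V n}}},
    [/\ F \subset GG, #|GG| <= #|F| * (2 * n) ^ size W &
      forall G H, G \in F -> H \in F -> isomorphic G H -> G = H].
Proof.
move=> rigid.
have iso_refl G : isomorphic (T := V n) (T' := V n) G G.
  by exists id; [exists id|move=> s; rewrite imset_id].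
have iso_sym G H : isomorphic (T := V n) (T' := V n) G H -> isomorphic H G.
  move=> [f [g fK gK] fE]; exists g; first by exists f.
  by move=> s; rewrite -fE -imset_comp (eq_imset (g := id)) ?imset_id.
have iso_trans G H K : isomorphic (T := V n) (T' := V n) G H -> isomorphic (T' := V n) H K -> isomorphic G K.
  move=> [f fb fE] [g gb gE]; exists (g \o f); first exact: bij_comp.
  by move=> s; rewrite imset_comp gE fE.
pose rep (G : {set {set V n}}) := odflt G [pick H in GG | `[< isomorphic G H >]].
have repP G : G \in GG -> rep G \in GG /\ isomorphic G (rep G).
  move=> GG_; rewrite /rep; case: pickP => [H /andP[HG /asboolP GH] //|/(_ G)].
  by rewrite GG_ asboolT.
have rep_iso G H : G \in GG -> isomorphic G H -> rep G = rep H.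
  move=> GG_ GH; rewrite /rep.
  have E : (fun K => (K \in GG) && `[< isomorphic G K >]) =1 (fun K => (K \in GG) && `[< isomorphic H K >]).
    move=> K; congr (_ && _); apply/asboolP/asboolP => HK; first by apply: iso_trans HK; exact: iso_sym.
    exact: iso_trans HK.
  rewrite (eq_pick E); case: pickP => // /(_ G).
  by rewrite GG_ asboolT //; exact: iso_sym.
have ex (G : {set {set V n}}) : exists f : V n -> V n, G \in GG ->
    injective f /\ forall s : {set V n}, (f @: s \in rep G) = (s \in G).
  case: (boolP (G \in GG)) => [GG_|_]; last by exists id.
  by have [_ [f fb fE]] := repP G GG_; exists f => _; split; [exact: bij_inj|].
have [phi phiP] := choice ex.
exists (rep @: GG); split.
- by apply/subsetP => _ /imsetP[G GG_ ->]; case: (repP G GG_).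
- pose code G := (rep G, [tuple of map (phi G) (in_tuple W)]).
  have cI : {in GG &, injective code}.
    move=> G G' GG_ GG'_ [E1 E2]; have [fI fE] := phiP G GG_; have [f'I f'E] := phiP G' GG'_.
    rewrite -E1 in f'E.
    have ff : phi G =1 phi G'.
      apply: (rigid G G' (rep G)) => //; first by case: (repP G GG_).
      by apply/eq_in_map.
    by apply/setP => s; rewrite -fE -f'E (eq_imset _ ff).
  rewrite -(card_in_imset cI); apply: leq_trans (_ : _ <= #|setX (rep @: GG) [set: (size W).-tuple (V n)]|) _.
    apply: subset_leq_card; apply/subsetP => _ /imsetP[G GG_ ->].
    by rewrite in_setX imset_f // inE.
  have cV : #|{: V n}| = 2 * n by rewrite card_prod card_ord card_bool mulnC.
  by rewrite cardsX cardsT card_tuple cV.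
- move=> G H /imsetP[G0 G0G ->] /imsetP[H0 H0G ->] iso; apply: rep_iso => //.
  have [_ i1] := repP G0 G0G; have [_ i2] := repP H0 H0G.
  exact: (iso_trans _ _ _ i1 (iso_trans _ _ _ iso (iso_sym _ _ i2))).
Qed.

(** * The spheres on a finite vertex type and the final count *)

Section Final.
Variables N r m : nat.
Hypothesis r2 : 2 <= r.
Hypothesis mN : 2 * m + 4 * r <= N.

Notation T := (V N.+2).

Definition sphere_of (w : pattern m) : {set {set T}} := carrier N.+2 (sphere_cpx N r w).

Lemma face_of_sub_Vn n (s : {set V n}) : face_of s `<=` Vn n.
Proof. by apply/fsubsetP => u /in_face_of[v _ ->]; rewrite in_Vn; exact: ltn_ord. Qed.

Lemma sphere_of_low (w : pattern m) (s : {set T}) : #|s| <= r -> unpaired (face_of s) -> s \in sphere_of w.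
Proof.
move=> sr us; rewrite in_carrier; apply/asboolP; apply: (sphere_low r2 mN); last by rewrite card_face_of.
by apply: (joined_low r2 mN) => //; [exact: face_of_sub_Vn|rewrite card_face_of].
Qed.

Lemma unpaired_face_of n (s : {set V n}) : antipode_free s <-> unpaired (face_of s).
Proof.
split=> [fs i b /in_face_of[v vs vE]|fs v [vs ovs]].
  apply/negP => /in_face_of[w ws wE]; apply: (fs v); split=> //.
  suff -> : opp_vertex v = w by [].
  by apply: vertex_inj; rewrite -wE; move: vE; rewrite /vertex /opp_vertex => -[-> ->].
have := fs (val v.1) v.2; rewrite -/(vertex v) vertex_face_of => /(_ vs) /negP; apply.
by rewrite -(vertex_face_of _ (opp_vertex v)) in ovs.
Qed.

Lemma sphere_of_symmetric (w : pattern m) : centrally_symmetric (sphere_of w).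
Proof.
move=> s; rewrite !in_carrier => /asboolP Xs; split; last first.
  by apply/unpaired_face_of; exact: (sphere_unpaired r2 mN Xs).
apply/asboolP; have := sphere_opp Xs; suff -> : opp_face (face_of s) = face_of [set opp_vertex v | v in s] by [].
apply/fsetP => u; rewrite in_opp_face; apply/idP/idP.
  move=> /in_face_of[v vs vE]; have -> : u = vertex (opp_vertex v) by rewrite -[u]antipodeK vE.
  by rewrite vertex_face_of imset_f.
move=> /in_face_of[_ /imsetP[v vs ->] ->].
rewrite (_ : antipode _ = vertex v) ?vertex_face_of //.
by rewrite /antipode /vertex /= negbK.
Qed.

Lemma sphere_of_neighborly (w : pattern m) : cs_neighborly r (sphere_of w).
Proof. by move=> s sr /unpaired_face_of; exact: sphere_of_low. Qed.

Lemma sphere_of_sphere (R : realType) (w : pattern m) :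
  combinatorial_sphere R (2 * r.+1 - 1) (sphere_of w).
Proof.
split.
  split.
  - apply: sphere_of_low; first by rewrite cards0.
    by move=> i b /in_face_of[v]; rewrite inE.
  - move=> v; apply: sphere_of_low; first by rewrite cards1; lia.
    apply/unpaired_face_of => x []; rewrite !inE => /eqP -> /eqP E.
    by have := congr1 snd E; rewrite /=; case: (v.2).
  - by move=> s t; exact: (carrier_down (@sphere_down N r m w)).
have [||B cB JB] := @joined_sphere R N r; [lia|lia|].
apply: (@PL_simplex_boundary R N.+2 (2 * r.+1 - 1).+1 _ B).
- exact: (@sphere_down N r m w).
- exact: (sphere_bounded r2 mN).
- by rewrite cB; lia.
apply: (@PLh_trans R _ (joined N r N)); last exact: JB.
- exact: (@sphere_down N r m w).
- exact: down_joined.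
- move=> s t [sB nB] ts; split; first exact: fsubset_trans ts sB.
  by move=> Bt; apply: nB; exact: fsubset_trans ts.
by apply: PLh_sym; exact: (sphere_PLh r2 mN).
Qed.

Lemma sphere_of_inj : injective sphere_of.
Proof.
move=> w w' E; apply: (sphere_inj r2 mN) => s.
have in_sphere v u : sphere_cpx N r v u -> trace N.+2 u \in sphere_of v /\ face_of (trace N.+2 u) = u.
  move=> Xu; have uE : face_of (trace N.+2 u) = u.
    by apply: face_of_trace; exact: (sphere_bounded r2 mN Xu).
  by rewrite in_carrier uE asboolT.
split=> /in_sphere[].
  by rewrite E in_carrier => /asboolP + sE; rewrite sE.
by rewrite -E in_carrier => /asboolP + sE; rewrite sE.
Qed.

Lemma sphere_of_classes : exists F : {set {set {set T}}},
  [/\ F \subset [set sphere_of w | w : pattern m],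
      5 ^ m <= #|F| * (2 * N.+2) ^ (2 * r + 4) &
      forall G H, G \in F -> H \in F -> isomorphic G H -> G = H].
Proof.
have [F0 cF0 _] : cl (core N r) fset0.
  apply: nzB_neighborly; first by lia.
  - exact: fsub0set.
  - by move=> i b; rewrite inE.
  - by rewrite cardfs0; lia.
(* One core facet with [2 * r] vertices, the core edge and its antipode: this is the source of the
   exponent [2 * r + 4]. *)
pose D := F0 `|` (core_edge N `|` opp_face (core_edge N)).
have [|F [FG cF isoF]] := @isomorphism_classes N.+2 [set sphere_of w | w : pattern m] (enum (trace N.+2 D)).
  move=> _ _ _ f f' /imsetP[w _ ->] /imsetP[w' _ ->] /imsetP[w'' _ ->] fI f'I fE f'E ff.
  have core_in v F : core N r F -> core_face N F \in sphere_of v.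
    move=> cF; have Xc := core_sphere r2 mN v cF.
    rewrite in_carrier face_of_trace ?asboolT //.
    exact: (sphere_bounded r2 mN Xc).
  apply: (@core_rigid N r f f' (sphere_of w'') F0) => //.
  - by lia.
  - by apply: thin_carrier; exact: (sphere_thin r2 mN).
  - by move=> F cF; rewrite fE core_in.
  - by move=> F cF; rewrite f'E core_in.
  - by move=> v vD; apply: ff; rewrite mem_enum inE.
exists F; split=> //; move: cF.
have -> : #|[set sphere_of w | w : pattern m]| = 5 ^ m.
  rewrite card_imset; last exact: sphere_of_inj.
  by rewrite /pattern card_ffun card_option card_prod card_bool card_ord.
move=> /leq_trans; apply; rewrite leq_mul2l; apply/orP; right.
rewrite leq_pexp2l //; rewrite -cardE.
have DE : face_of (trace N.+2 D) = D.
  apply: face_of_trace => u /fsetUP[uF|/fsetUP[/edge_fst/andP[_ //]|]].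
    by have := fsubsetP (nzB_on cF0) u uF; rewrite in_Vn; lia.
  by rewrite in_opp_face => /edge_fst/andP[_].
rewrite -card_face_of DE.
have cE : #|` core_edge N| = 2 by rewrite /core_edge /edge cardfs2 xpair_eqE (ltn_eqF (ltnSn N)).
have cE' : #|` opp_face (core_edge N)| = 2.
  by rewrite card_imfset //; exact: (can_inj antipodeK).
have cD : #|` F0| = 2 * r by have := nzB_card cF0; rewrite addn2 => -[].
apply: leq_trans (leq_card_fsetU _ _) _; rewrite cD leq_add2l.
by apply: leq_trans (leq_card_fsetU _ _) _; rewrite cE cE'.
Qed.

End Final.

Local Open Scope ring_scope.

Theorem theorem6p2 (R : realType) (k : nat) (hk : (3 <= k)%N) :
  exists2 c : R, 0 < c &
    exists N : nat, forall n : nat, (N <= n)%N ->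
      exists F : {set {set {set V n}}},
        [/\ c * 2 ^+ n <= #|F|%:R,
            forall G, G \in F ->
              [/\ combinatorial_sphere R (2 * k - 1) G,
                  centrally_symmetric G
                & cs_neighborly (k - 1) G]
          & forall G H, G \in F -> H \in F -> isomorphic G H -> G = H].
Proof.
exists 1; first exact: ltr01.
case: k hk => [//|r] hr; have r2 : (2 <= r)%N by [].
(* With [n <= 2 * m + 4 * r + 3], the power [2 ^ n] is at most [2 ^ (4 * r + 3) * 4 ^ m], and
   [2 * n] is at most [(8 * r + 10) * m.+1]. The surplus of [5 ^ m] over [4 ^ m] absorbs both, which
   is why the constant 1 suffices. *)
have [m0 growth_m0] := growth (2 * r + 4) (2 ^ (4 * r + 3) * (8 * r + 10) ^ (2 * r + 4)).
exists (4 * r + 2 * m0 + 4)%N => n nN; have [N nE] : exists N, n = N.+2 by exists n.-2; lia.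
subst n; pose m := ((N - 4 * r)./2)%N.
have dm : (2 * m <= N - 4 * r <= 2 * m + 1)%N.
  by have := odd_double_half (N - 4 * r); rewrite -/m -mul2n; case: (odd _) => /=; lia.
have mN : (2 * m + 4 * r <= N)%N by lia.
have [F [FG cF isoF]] := sphere_of_classes r2 mN.
exists F; split=> //.
  rewrite mul1r -natrX ler_nat.
  have H := leq_trans (growth_m0 m _) cF; rewrite -(leq_pmul2r (_ : (0 < (2 * N.+2) ^ (2 * r + 4))%N)) ?expn_gt0 //.
  apply: leq_trans (H _); last lia.
  have n1 : (N.+2 <= 2 * m + (4 * r + 3))%N by lia.
  have n2 : (2 * N.+2 <= (8 * r + 10) * m.+1)%N by nia.
  apply: (@leq_trans (2 ^ (2 * m + (4 * r + 3)) * ((8 * r + 10) * m.+1) ^ (2 * r + 4))%N).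
    by apply: leq_mul; [rewrite leq_exp2l|exact: leq_exp_base].
  rewrite expnD expnM expnMn (_ : (2 ^ 2 = 4)%N) //.
  by rewrite eq_leq //; ring.
move=> G /(subsetP FG) /imsetP[w _ ->]; split.
- exact: (sphere_of_sphere r2 mN).
- exact: (sphere_of_symmetric r2 mN).
- by rewrite subn1; exact: (sphere_of_neighborly r2 mN).
Qed.
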